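(* Assume Hypothesis A$'$. Let $T>0$ and let $\{f(t,x,v)\}_{t\in[0,T]}$ be a collection of probability densities which is a strong solution of the Boltzmann equation on $[0,T]$, with $f\in C([0,T]\times\mathbb{R}^6)$ and satisfying (B2) (with $\gamma=1$). Suppose there exist a stochastic basis $(\Omega,\mathscr F,(\mathscr F_t)_{t\in[0,T]},P)$, an adapted Poisson random measure $N$ with compensator $m(s,v)\,dv\,Q(d\theta)\,d\phi\,dr\,ds$, and an adapted c\`adl\`ag process $(X_t,Z_t)_{t\in[0,T]}$ satisfying a.s. the system (S), and that $\sup_{t\in[0,T]}\int|z|^2\mu_t(dx,dz)<\infty$, where $\mu_t$ is the law of $(X_t,Z_t)$. Then $\{\mu_t\}_{t\in[0,T]}$ is a weak solution of the bilinear Boltzmann equation related to $f$ on $[0,T]$ (in the measure sense).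
   Context: Collision geometry: for $w\in\mathbb{R}^3\setminus\{0\}$ fix measurable $I(w),J(w)$ such that $w/|w|,I(w)/|w|,J(w)/|w|$ is an orthonormal basis, and set $\Gamma(w,\phi)=I(w)\cos\phi+J(w)\sin\phi$. For $z,v\in\mathbb{R}^3$, $\theta\in(0,\pi]$, $\phi\in[0,2\pi)$ let $\alpha(z,v,\theta,\phi)=\sin^2(\theta/2)(v-z)+\frac{\sin\theta}{2}\Gamma(v-z,\phi)$, $z^\star=z+\alpha$, $v^\star=v-\alpha$. $\Xi=(0,\pi]\times[0,2\pi)$. Hypothesis A$'$ (hard spheres, non-cutoff): $Q$ is a $\sigma$-finite measure on $(0,\pi]$, finite outside every neighbourhood of $0$, with $\int_0^\epsilon\theta Q(d\theta)<\infty$ for all $\epsilon>0$; $\sigma(r)=c\,r$ with $c>0$. Boltzmann equation: $\partial_tf+z\cdot\nabla_xf=Q(f,f)$, $Q(f,f)(t,x,z)=\int_{\mathbb{R}^3\times\Xi}\{f(t,x,z^\star)f(t,x,v^\star)-f(t,x,z)f(t,x,v)\}\sigma(|z-v|)\,dv\,Q(d\theta)\,d\phi$; strong solution on $[0,T]$ means probability densities satisfying it pointwise for each $t\in[0,T]$. (B2): $t\mapsto\sup_{x}\int_{\mathbb{R}^3}|z|^{1+\gamma}f(t,x,z)\,dz\in C([0,T])$. $m(t,v)=\int f(t,x,v)\,dx$, $f(t,x|v)=f(t,x,v)/m(t,v)$. System (S): a.s. for all $t\in[0,T]$, $X_t=X_0+\int_0^tZ_s\,ds$ and $Z_t=Z_0+\int_0^t\int_{\mathbb{R}^3\times\Xi\times[0,\infty)}\alpha(Z_{s-},v,\theta,\phi)\mathbf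 1_{[0,\sigma(|Z_{s-}-v|)f(s,X_s|v)]}(r)\,N(dv,d\theta,d\phi,dr,ds)$. $L_{f(t)}\psi(x,z)=\int_{\mathbb{R}^3\times\Xi}\{\psi(x,z^\star)-\psi(x,z)\}f(t,x,v)\sigma(|z-v|)\,dv\,Q(d\theta)\,d\phi$. Weak (measure) solution of the bilinear Boltzmann equation related to $f$ on $[0,T]$: probability measures $\{\mu_t\}_{t\in[0,T]}$ on $\mathbb{R}^6$ such that for all $t\in[0,T]$ and all $\psi\in C^2_0(\mathbb{R}^6)$: $\int\psi\,d\mu_t=\int\psi\,d\mu_0+\int_0^t\int(z\cdot\nabla_x\psi(x,z))\,\mu_s(dx,dz)\,ds+\int_0^t\int L_{f(s)}\psi(x,z)\,\mu_s(dx,dz)\,ds$. *)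

(* Defs.v *)
From HB Require Import structures.
From mathcomp Require Import all_boot all_order all_algebra.
From mathcomp Require Import all_classical all_reals all_analysis.

Set Implicit Arguments.
Unset Strict Implicit.
Unset Printing Implicit Defensive.

Import Order.TTheory GRing.Theory Num.Def Num.Theory.
Import numFieldNormedType.Exports.

Local Open Scope classical_set_scope.
Local Open Scope ring_scope.

(* R^3 is represented as the product type (R * R) * R, with its product
   topology, product normed-module structure (used only for the notion of
   directional derivative) and product sigma-algebra (= Borel sigma-algebra). *)
Notation V3 R := ((R * R) * R)%type.

Notation leb3 := ((@lebesgue_measure _ \x @lebesgue_measure _) \x @lebesgue_measure _)%E.

Section Defs.
Context {R : realType}.

Definition coord3 (x : V3 R) (i : nat) : R :=
  match i with 0%N => x.1.1 | 1%N => x.1.2 | _ => x.2 end.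

Definition e3 (i : nat) : V3 R :=
  match i with 0%N => (1, 0, 0) | 1%N => (0, 1, 0) | _ => (0, 0, 1) end.

Definition dot3 (x y : V3 R) : R := x.1.1 * y.1.1 + x.1.2 * y.1.2 + x.2 * y.2.

Definition enorm (x : V3 R) : R := Num.sqrt (dot3 x x).

Definition e6 (i : nat) : V3 R * V3 R :=
  if (i < 3)%N then (e3 i, 0) else (0, e3 (i - 3)).

(* measurable I, J such that w/|w|, I(w)/|w|, J(w)/|w| is orthonormal
   (hence an orthonormal basis of R^3) for every w <> 0 *)
Definition frame (I J : V3 R -> V3 R) : Prop :=
  measurable_fun [set: V3 R] I /\ measurable_fun [set: V3 R] J /\
  forall w : V3 R, w != 0 ->
    [/\ dot3 w (I w) = 0, dot3 w (J w) = 0, dot3 (I w) (J w) = 0,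
        dot3 (I w) (I w) = dot3 w w & dot3 (J w) (J w) = dot3 w w].

Definition Gam (I J : V3 R -> V3 R) (w : V3 R) (phi : R) : V3 R :=
  cos phi *: I w + sin phi *: J w.

Definition alpha (I J : V3 R -> V3 R) (z v : V3 R) (theta phi : R) : V3 R :=
  (sin (theta / 2)) ^+ 2 *: (v - z) + (sin theta / 2) *: Gam I J (v - z) phi.

Definition zstar I J z v theta phi : V3 R := z + alpha I J z v theta phi.
Definition vstar I J z v theta phi : V3 R := v - alpha I J z v theta phi.

(* Hypothesis A' (the sigma-finiteness of Q is carried by its type)    *)

Definition hypA' (Q : {measure set R -> \bar R}) (c : R) : Prop :=
  [/\ Q (~` `]0, pi]) = 0%E,
      (forall eps : R, 0 < eps -> (Q [set x : R | (eps <= x)%R] < +oo)%E),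
      (forall eps : R, 0 < eps -> (\int[Q]_(x in `]0%R, eps]%classic) x%:E < +oo)%E)
    & 0 < c].

Definition sigmaK (c r : R) : R := c * r.

Definition Rint d (T : measurableType d) (mu : set T -> \bar R) (D : set T)
  (g : T -> R) : R := fine (\int[mu]_(x in D) (g x)%:E)%E.

(* collision parameters: points p = ((v, theta), phi) of R^3 * Xi *)
Definition Xi3 : set ((V3 R * R) * R) :=
  [set p | 0 < p.1.2 <= pi /\ 0 <= p.2 < 2 * pi].

Definition collmeas (Q : {sigma_finite_measure set R -> \bar R}) :=
  ((leb3 \x Q) \x @lebesgue_measure R)%E.

Definition collint_integrand (I J : V3 R -> V3 R) (c : R)
    (f : R -> V3 R -> V3 R -> R) (t : R) (x z : V3 R) (p : (V3 R * R) * R) : R :=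
  let v := p.1.1 in let th := p.1.2 in let ph := p.2 in
  (f t x (zstar I J z v th ph) * f t x (vstar I J z v th ph) - f t x z * f t x v)
  * sigmaK c (enorm (z - v)).

Definition collint (Q : {sigma_finite_measure set R -> \bar R}) I J c f t x z :=
  Rint (collmeas Q) Xi3 (collint_integrand I J c f t x z).

(* D is the derivative of s |-> f s x z at t, relative to [0,T]
   (one-sided at the endpoints) *)
Definition is_dt (f : R -> V3 R -> V3 R -> R) (T t : R) (x z : V3 R) (D : R) :=
  forall e : R, 0 < e ->
    \forall h \near 0^', 0 <= t + h <= T ->
      `| h^-1 * (f (t + h) x z - f t x z) - D | < e.

Definition strong_solution Q I J c (T : R) (f : R -> V3 R -> V3 R -> R) :=
  forall t, 0 <= t <= T -> forall x z : V3 R,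
    [/\ forall i : 'I_3, derivable (fun y => f t y z) x (e3 i),
        (collmeas Q).-integrable Xi3 (fun p => (collint_integrand I J c f t x z p)%:E)
      & exists D, is_dt f T t x z D /\
          D + \sum_(i < 3) coord3 z i * 'D_(e3 i) (fun y => f t y z) x
          = collint Q I J c f t x z].

Definition prob_densities (T : R) (f : R -> V3 R -> V3 R -> R) :=
  forall t, 0 <= t <= T ->
    [/\ forall x z, 0 <= f t x z,
        measurable_fun [set: V3 R * V3 R] (fun p => f t p.1 p.2)
      & (\int[(leb3 \x leb3)%E]_p (f t p.1 p.2)%:E = 1)%E].

Definition cont_on (T : R) (f : R -> V3 R -> V3 R -> R) :=
  {within [set q : R * (V3 R * V3 R) | 0 <= q.1 <= T],
     continuous (fun q => f q.1 q.2.1 q.2.2)}.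

Definition B2 (T : R) (f : R -> V3 R -> V3 R -> R) :=
  exists g : R -> R, {within `[0, T], continuous g} /\
    forall t, 0 <= t <= T ->
      ereal_sup [set (\int[leb3]_z ((enorm z) ^+ 2 * f t x z)%:E)%E | x in [set: V3 R]]
      = (g t)%:E.

Definition mden (f : R -> V3 R -> V3 R -> R) (t : R) (v : V3 R) : R :=
  Rint leb3 [set: V3 R] (fun x => f t x v).

Definition fcond (f : R -> V3 R -> V3 R -> R) (t : R) (x v : V3 R) : R :=
  f t x v / mden f t v.

Notation Mk := ((((V3 R * R) * R) * R) * R)%type.

Definition pv (p : Mk) := p.1.1.1.1.
Definition pth (p : Mk) := p.1.1.1.2.
Definition pph (p : Mk) := p.1.1.2.
Definition pr (p : Mk) := p.1.2.
Definition ps (p : Mk) := p.2.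

Definition markmeas (Q : {sigma_finite_measure set R -> \bar R}) :=
  ((((leb3 \x Q) \x @lebesgue_measure R) \x @lebesgue_measure R)
     \x @lebesgue_measure R)%E.

Definition markdom (T : R) : set Mk :=
  [set p | [/\ 0 < pth p <= pi, 0 <= pph p < 2 * pi, 0 <= pr p & 0 <= ps p <= T]].

Definition intensity Q (T : R) (f : R -> V3 R -> V3 R -> R) (A : set Mk) : \bar R :=
  (\int[markmeas Q]_(p in A `&` markdom T) (mden f (ps p) (pv p))%:E)%E.

Definition poisson_p (lam : R) (k : nat) : R := expR (- lam) * lam ^+ k / k`!%:R.

Section Stoch.
Context d (Omega : measurableType d).

Definition filtration (T : R) (F : R -> set (set Omega)) :=
  (forall t, 0 <= t <= T -> sigma_algebra [set: Omega] (F t) /\ F t `<=` measurable) /\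
  (forall s t, 0 <= s -> s <= t -> t <= T -> F s `<=` F t).

Definition Gmeas (G : set (set Omega)) (h : Omega -> R) :=
  forall a : R, G [set w | h w <= a].
Definition Gmeasb (G : set (set Omega)) (h : Omega -> \bar R) :=
  forall a : \bar R, G [set w | (h w <= a)%E].

(* (F_t)-Poisson random measure on R^3 x Xi x [0,oo) x [0,T] with
   (deterministic) compensator nu: N is a random integer-valued measure,
   t |-> N(B x (0,t]) is adapted, and for s <= t and pairwise disjoint
   B_1..B_n of finite intensity, the variables N(B_i x (s,t]) are
   independent of F_s, mutually independent and Poisson(nu(B_i x (s,t])). *)
Definition poisson_random_measure (P : probability Omega R)
    (F : R -> set (set Omega)) (T : R) (nu : set Mk -> \bar R)
    (N : Omega -> {measure set Mk -> \bar R}) :=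
  [/\ (forall w (A : set Mk), measurable A ->
          (exists k : nat, N w A = k%:R%:E) \/ N w A = +oo%E),
      (forall A : set Mk, measurable A ->
          Gmeasb measurable (fun w => N w A)),
      (forall (B : set (((V3 R * R) * R) * R)) t, measurable B -> 0 <= t <= T ->
          Gmeasb (F t) (fun w => N w (B `*` `]0, t]))) &
      (forall s t, 0 <= s -> s <= t -> t <= T ->
        forall (n : nat) (B : nat -> set (((V3 R * R) * R) * R)) (k : nat -> nat),
          (forall i, (i < n)%N -> measurable (B i) /\ (nu (B i `*` `]s, t]) < +oo)%E) ->
          (forall i j, (i < n)%N -> (j < n)%N -> i != j -> B i `&` B j = set0) ->
          forall G, F s G ->
            P (G `&` \bigcap_(i < n) [set w | N w (B i `*` `]s, t]) = (k i)%:R%:E])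
            = (P G * (\prod_(i < n) poisson_p (fine (nu (B i `*` `]s, t]))) (k i))%:E)%E)].

Definition adapted3 (F : R -> set (set Omega)) (T : R) (X : R -> Omega -> V3 R) :=
  forall t, 0 <= t <= T -> forall i : 'I_3, Gmeas (F t) (fun w => coord3 (X t w) i).

Definition cadlag_on (T : R) (g : R -> V3 R * V3 R) :=
  (forall t, 0 <= t < T -> g @ t^'+ --> g t) /\
  (forall t, 0 < t <= T -> exists l : V3 R * V3 R, g @ t^'- --> l).

(* (taken componentwise; for cadlag paths this is the left limit in R^3) *)
Definition leftlim (g : R -> V3 R) (s : R) : V3 R :=
  (lim ((fun u => (g u).1.1) @ s^'-), lim ((fun u => (g u).1.2) @ s^'-),
   lim ((fun u => (g u).2) @ s^'-)).

Definition system_S I J c (T : R) f (X Z : R -> Omega -> V3 R)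
    (N : Omega -> {measure set Mk -> \bar R}) (w : Omega) :=
  forall t, 0 <= t <= T ->
    let Dt := [set p : Mk | [/\ 0 < pth p <= pi, 0 <= pph p < 2 * pi,
                               0 <= pr p & 0 < ps p <= t]] in
    let jump (i : nat) (p : Mk) : R :=
      let Zm := leftlim (fun s => Z s w) (ps p) in
      coord3 (alpha I J Zm (pv p) (pth p) (pph p)) i *
      (if pr p <= sigmaK c (enorm (Zm - pv p)) * fcond f (ps p) (X (ps p) w) (pv p)
       then 1 else 0) in
    forall i : 'I_3,
      [/\ coord3 (X t w) i
            = coord3 (X 0 w) i + Rint (@lebesgue_measure R) `[0, t] (fun s => coord3 (Z s w) i),
          (N w).-integrable Dt (fun p => (jump i p)%:E)
        & coord3 (Z t w) i = coord3 (Z 0 w) i + Rint (N w) Dt (jump i)].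
End Stoch.

Definition C2c (psi : V3 R * V3 R -> R) :=
  [/\ continuous psi,
      (forall i j : 'I_6,
         [/\ forall q, derivable psi q (e6 i),
             continuous ('D_(e6 i) psi),
             forall q, derivable ('D_(e6 i) psi) q (e6 j)
           & continuous ('D_(e6 j) ('D_(e6 i) psi))])
    & exists K : set (V3 R * V3 R), compact K /\ forall q, ~ K q -> psi q = 0].

Definition transport (psi : V3 R * V3 R -> R) (q : V3 R * V3 R) : R :=
  \sum_(i < 3) coord3 q.2 i * 'D_(e6 i) psi q.

Definition Lgen_integrand I J c (f : R -> V3 R -> V3 R -> R) (s : R)
    (psi : V3 R * V3 R -> R) (q : V3 R * V3 R) (p : (V3 R * R) * R) : R :=
  let x := q.1 in let z := q.2 in
  let v := p.1.1 in let th := p.1.2 in let ph := p.2 in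
  (psi (x, zstar I J z v th ph) - psi (x, z)) * f s x v * sigmaK c (enorm (z - v)).

Definition Lgen (Q : {sigma_finite_measure set R -> \bar R}) I J c f s psi q :=
  Rint (collmeas Q) Xi3 (Lgen_integrand I J c f s psi q).

Definition weak_solution Q I J c (T : R) f (mu : R -> set (V3 R * V3 R) -> \bar R) :=
  (forall t, 0 <= t <= T ->
     [/\ mu t set0 = 0%E, (forall A, measurable A -> 0 <= mu t A)%E,
         semi_sigma_additive (mu t) & mu t [set: V3 R * V3 R] = 1%E]) /\
  forall t, 0 <= t <= T -> forall psi, C2c psi ->
    [/\ (forall s, 0 <= s <= t ->
           [/\ (mu s).-integrable [set: V3 R * V3 R] (fun q => (transport psi q)%:E),
               (forall q, (collmeas Q).-integrable Xi3
                            (fun p => (Lgen_integrand I J c f s psi q p)%:E))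
             & (mu s).-integrable [set: V3 R * V3 R] (fun q => (Lgen Q I J c f s psi q)%:E)]),
        (@lebesgue_measure R).-integrable `[0, t]
           (fun s => (Rint (mu s) [set: V3 R * V3 R] (transport psi))%:E),
        (@lebesgue_measure R).-integrable `[0, t]
           (fun s => (Rint (mu s) [set: V3 R * V3 R] (Lgen Q I J c f s psi))%:E)
      & Rint (mu t) [set: V3 R * V3 R] psi
        = Rint (mu 0) [set: V3 R * V3 R] psi
          + Rint (@lebesgue_measure R) `[0, t]
              (fun s => Rint (mu s) [set: V3 R * V3 R] (transport psi))
          + Rint (@lebesgue_measure R) `[0, t]
              (fun s => Rint (mu s) [set: V3 R * V3 R] (Lgen Q I J c f s psi))].

End Defs.

Notation Mk R := ((((V3 R * R) * R) * R) * R)%type.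

(* Main.v *)
(* Let E_n increase to the mark space, each E_n having finite intensity. The path of psi(X, Z)
   is telescoped along the grids of mesh t/(m+1). On a cell, the X-increment contributes the
   transport term up to a Taylor error, and the Z-increment is the integral of the jumps over the
   cell. If the cell contains at most one atom in E_n, then the increment of psi differs from the
   N-integral of the increments of psi at the jumps by at most a constant times the integral of
   |alpha| over the marks of the cell outside E_n. The probability that some cell has two atoms in
   E_n tends to 0 with the mesh, so almost surely this happens along a subsequence of grids;
   letting first m, then n tend to infinity gives the pathwise change of variables formula.

   Taking expectations, N is replaced by its compensator: this is checked on the predictable
   rectangles O x (B x ]s,t]) with O in F_s, then extended by the pi-lambda theorem and monotone
   convergence. Integrating the indicator {r <= sigma f(s,x|v)} against m(s,v) dr gives
   sigma f(s,x,v), since f(s,.,v) = 0 by continuity when m(s,v) = 0, and m(s,v) is finite for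
   almost every v. Finally Z_{s-} = Z_s for almost every s. Everything is integrable because, by
   (B2), both generators applied to psi are at most a constant times 1 + |z|^2. *)
From HB Require Import structures.
From mathcomp Require Import all_boot all_order all_algebra.
From mathcomp Require Import all_classical all_reals all_analysis.
From mathcomp Require Import ring lra finmap measurable_realfun measurable_fun_approximation.
Require Import Defs.
Set Implicit Arguments.
Unset Strict Implicit.
Unset Printing Implicit Defensive.
Import Order.TTheory GRing.Theory Num.Def Num.Theory.
Import numFieldNormedType.Exports.
Local Open Scope classical_set_scope.
Local Open Scope ring_scope.

(** * Generalities on measurable functions and kernels *)

Section gen.
Context {R : realType}.

Import HBNNSimple.

(** Without cutoff the jump times may accumulate and cannot be enumerated, and nothing represents N
    as a sum of point masses. Atoms are replaced by a 0-1 argument: a measure of mass one with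
    values in {0, 1} makes every integrable function almost everywhere constant, so the increment of
    psi over the summed jump equals the integral of its increments. The jumps in (S) are absolutely
    integrable against N, which gives a bound K on the whole path of Z; the Taylor error uses this
    random K and no moment. Compensation is proved for nonnegative integrands only. Hence every
    functional is split by a sign e = 1 or -1, and the integrability of the jump term is read off
    its compensator. The thinning in (S) contains X_s, which continuity of X turns into the
    predictable X_{s-}. Two conventions matter: x / 0 = 0, and [fine] sends infinite values to 0.
    Both make the conditional density vanish where the velocity density is 0 or infinite. Data
    controlled on [0, T] only are extended to the line by [clamp]. *)

Lemma ge0_fun_ind d (T : measurableType d) (Pf : (T -> \bar R) -> Prop) :
  (forall A, measurable A -> Pf (fun x => (\1_A x)%:E)) ->
  (forall (k : R) (f g : T -> \bar R), 0 <= k -> measurable_fun [set: T] f -> measurable_fun [set: T] g ->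
    (forall x, (0 <= f x)%E) -> (forall x, (0 <= g x)%E) -> Pf f -> Pf g ->
    Pf (fun x => k%:E * f x + g x)%E) ->
  (forall (u : nat -> T -> \bar R) (f : T -> \bar R), (forall n, measurable_fun [set: T] (u n)) ->
    (forall n x, (0 <= u n x)%E) -> (forall x, nondecreasing_seq (u ^~ x)) ->
    (forall x, u n x @[n --> \oo] --> f x) -> (forall n, Pf (u n)) -> Pf f) ->
  forall f, measurable_fun [set: T] f -> (forall x, (0 <= f x)%E) -> Pf f.
Proof.
move=> H1 H2 H3 f mf f0.
apply: (H3 (fun n x => (nnsfun_approx measurableT mf n x)%:E)).
- by move=> n; apply/measurable_EFinP.
- by move=> n x; rewrite lee_fin.
- by move=> x m n mn; rewrite lee_fin; exact/lefP/nd_nnsfun_approx.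
- by move=> x; apply: cvg_nnsfun_approx.
move=> n; set g := nnsfun_approx _ _ _.
have fing : finite_set (range g) by exact: fimfunP.
have -> : (fun x => (g x)%:E) = (fun x => \sum_(r <- fset_set (range g))
    (r%:E * (\1_(g @^-1` [set r]) x)%:E))%E.
  apply/funext => x; rewrite fimfunE fsbig_finite//= -sumEFin.
  by apply: eq_bigr => r _; rewrite EFinM.
have: forall r : R, r \in fset_set (range g) -> 0 <= r.
  by move=> r; rewrite in_fset_set// => /set_mem[x _ <-].
move=> s0; have {s0} : forall r : R, r \in enum_fset (fset_set (range g)) -> 0 <= r by [].
elim: (enum_fset (fset_set (range g))) => [|r s IH] s0.
  under eq_fun do rewrite big_nil.
  have := H1 _ measurable0; congr Pf; apply/funext => x.
  by rewrite indic0.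
under eq_fun do rewrite big_cons.
have {}IH := IH _.
apply: H2.
- by apply: s0; rewrite inE eqxx.
- by apply/measurable_EFinP; exact: measurable_indic.
- apply: emeasurable_sum => r' ; apply/measurable_funeM.
  by apply/measurable_EFinP; exact: measurable_indic.
- by move=> x; rewrite lee_fin.
- move=> x; rewrite big_seq; apply: sume_ge0 => r' r's.
  by rewrite mule_ge0// lee_fin// s0// inE r's orbT.
- by apply: H1.
- by apply: IH => r' r's; apply: s0; rewrite inE r's orbT.
Qed.

(* Only values on a countable grid are used, which reduces measurability in t of f (g t) t to countable unions. *)
Lemma measurable_fun_grid d d' (T : measurableType d) (U : measurableType d') (g : T -> int) (f : int -> T -> U) :
  measurable_fun setT (fun t => (g t)%:~R : R) ->
  (forall k, measurable_fun setT (f k)) ->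
  measurable_fun setT (fun t => f (g t) t).
Proof.
move=> mg mf _ A mA; rewrite setTI.
have -> : (fun t => f (g t) t) @^-1` A =
   \bigcup_(k : int) ((fun t => (g t)%:~R : R) @^-1` [set k%:~R] `&` f k @^-1` A).
  apply/seteqP; split => [t At|t [k _ [/= /eqP]]].
    by exists (g t) => //; split.
  by rewrite eqr_int => /eqP <-.
apply: countable_bigcupT_measurable => [|k]; first exact: countableP.
apply: measurableI.
  by rewrite -[X in measurable X]setTI; apply: mg => //; exact: measurable_set1.
by rewrite -[X in measurable X]setTI; apply: mf.
Qed.

(** The index of the cell of mesh h that contains x. Ceiling minus one, rather than floor, makes
    cells open on the left and closed on the right, like the time intervals ]s, t] of the random
    measure. *)
Definition cell (h x : R) : int := Num.ceil (x / h) - 1.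

Lemma cell_itv (h x : R) : 0 < h ->
  (cell h x)%:~R * h < x <= (cell h x + 1)%:~R * h.
Proof.
move=> h0; rewrite /cell subrK -ltr_pdivlMr// -ler_pdivrMr//.
exact: ceil_itv.
Qed.

Lemma cell_eq (h x : R) (k : int) : 0 < h ->
  k%:~R * h < x <= (k + 1)%:~R * h -> cell h x = k.
Proof.
move=> h0; rewrite -ltr_pdivlMr// -ler_pdivrMr// => H.
by apply/eqP; rewrite /cell subr_eq ceil_eq addrK.
Qed.

Lemma measurable_cell (h : R) : 0 < h ->
  measurable_fun [set: R] (fun x => (cell h x)%:~R : R).
Proof.
move=> h0; apply: nondecreasing_measurable => // x y xy.
rewrite ler_int /cell lerD2r; apply: le_ceil.
by rewrite ler_pM2r// invr_gt0.
Qed.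

Definition step (t : R) (n : nat) : R := t / n.+1%:R.

Lemma step_gt0 t n : 0 < t -> 0 < step t n.
Proof. by move=> t0; rewrite /step divr_gt0. Qed.

Lemma step_cvg0 t : step t n @[n --> \oo] --> (0 : R).
Proof.
rewrite -[X in _ --> X](mulr0 t); apply: cvgMr.
exact: cvg_harmonic.
Qed.

(** The two ends of the cell of x. The left end is strictly below x, so sampling there produces left
    limits; the right end may coincide with x, so sampling there suits right-continuous paths. *)
Definition gridL (t : R) n (x : R) := (cell (step t n) x)%:~R * step t n.
Definition gridU (t : R) n (x : R) := (cell (step t n) x + 1)%:~R * step t n.

Lemma gridL_lt t n x : 0 < t -> gridL t n x < x.
Proof. by move=> t0; have /andP[] := cell_itv x (step_gt0 n t0). Qed.

Lemma gridU_ge t n x : 0 < t -> x <= gridU t n x.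
Proof. by move=> t0; have /andP[] := cell_itv x (step_gt0 n t0). Qed.

Lemma gridUE t n x : gridU t n x = gridL t n x + step t n.
Proof. by rewrite /gridU /gridL intrD mulrDl mul1r. Qed.

Lemma gridL_cvg t x : 0 < t -> gridL t n x @[n --> \oo] --> x^'-.
Proof.
move=> t0; apply: (@cvg_trans _ ((gridL t ^~ x) @ \oo)) => //.
move=> A [e /= e0 Ae].
have [N _ HN] : \forall n \near \oo, step t n < e.
  have /cvgrPdist_lt/(_ _ e0) := step_cvg0 t.
  by apply: filterS => n; rewrite sub0r normrN; apply: le_lt_trans; exact: ler_norm.
exists N => // n /= /HN ne; apply: Ae; last exact: gridL_lt.
rewrite /= gtr0_norm ?subr_gt0 ?gridL_lt//.
rewrite ltrBlDl; apply: (le_lt_trans (gridU_ge n x t0)).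
by rewrite gridUE ltrD2l.
Qed.

(** The right ends need not converge to x through points different from x, so the filter at x^'+
    alone is not enough: whenever the right end equals x, the value F x itself lies in the
    neighbourhood. *)
Lemma gridU_cvg (V : topologicalType) (F : R -> V) t x : 0 < t ->
  F @ x^'+ --> F x -> F (gridU t n x) @[n --> \oo] --> F x.
Proof.
move=> t0 Fx A /= nA.
have [e /= e0 Ae] := Fx _ nA.
have [N _ HN] : \forall n \near \oo, step t n < e.
  have /cvgrPdist_lt/(_ _ e0) := step_cvg0 t.
  by apply: filterS => n; rewrite sub0r normrN; apply: le_lt_trans; exact: ler_norm.
exists N => // n /= /HN ne.
have := gridU_ge n x t0; rewrite le_eqVlt => /predU1P[<-|h].
  exact: nbhs_singleton.
apply: Ae => //=; rewrite ltr0_norm ?subr_lt0// opprB gridUE.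
have := gridL_lt n x t0; lra.
Qed.

Lemma measurable_fun_gridL d (T : measurableType d) (g : T -> R) (f : R -> T -> R) (F : T -> R) t :
  0 < t -> measurable_fun setT g -> (forall x, measurable_fun setT (f x)) ->
  (forall w, f (gridL t n (g w)) w @[n --> \oo] --> F w) ->
  measurable_fun setT F.
Proof.
move=> t0 mg mf fF.
apply: (@measurable_fun_cvg _ _ _ _ (fun n w => f (gridL t n (g w)) w)) => // n.
rewrite /gridL.
apply: (@measurable_fun_grid _ _ _ _ (fun w => cell (step t n) (g w)) (fun k => f (k%:~R * step t n))) => //.
by apply: (measurableT_comp (measurable_cell (step_gt0 n t0))).
Qed.

Lemma measurable_fun_gridU d (T : measurableType d) (g : T -> R) (f : R -> T -> R) (F : T -> R) t :
  0 < t -> measurable_fun setT g -> (forall x, measurable_fun setT (f x)) ->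
  (forall w, f (gridU t n (g w)) w @[n --> \oo] --> F w) ->
  measurable_fun setT F.
Proof.
move=> t0 mg mf fF.
apply: (@measurable_fun_cvg _ _ _ _ (fun n w => f (gridU t n (g w)) w)) => // n.
rewrite /gridU.
apply: (@measurable_fun_grid _ _ _ _ (fun w => cell (step t n) (g w)) (fun k => f ((k+1)%:~R * step t n))) => //.
by apply: (measurableT_comp (measurable_cell (step_gt0 n t0))).
Qed.

(** Sampling the parameter at the right end of its cell uses countably many values, and right
    continuity recovers f (g w) w as the mesh tends to 0. The horizon 1 that fixes the meshes is
    arbitrary. *)
Lemma measurable_fun_rcont d (T : measurableType d) (g : T -> R) (f : R -> T -> R) :
  measurable_fun setT g -> (forall x, measurable_fun setT (f x)) ->
  (forall w, f x w @[x --> (g w)^'+] --> f (g w) w) ->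
  measurable_fun setT (fun w => f (g w) w).
Proof.
move=> mg mf cf.
apply: (@measurable_fun_gridU _ _ g f _ 1) => // w.
exact: (@gridU_cvg _ (f ^~ w)).
Qed.

Lemma measurable_fun_scont d (T : measurableType d) (g : T -> R) (f : R -> T -> R) :
  measurable_fun setT g -> (forall x, measurable_fun setT (f x)) ->
  (forall w, continuous (f ^~ w)) ->
  measurable_fun setT (fun w => f (g w) w).
Proof.
move=> mg mf cf; apply: measurable_fun_rcont => // w.
exact/cvg_at_right_filter/cf.
Qed.

Lemma cvg_to_pair (T : Type) (U V : topologicalType) (F : set_system T)
    {FF : Filter F} (f : T -> U) (g : T -> V) (a : U) (b : V) :
  f @ F --> a -> g @ F --> b -> (f x, g x) @[x --> F] --> (a, b).
Proof. by move=> fa gb; exact: cvg_pair. Qed.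

Ltac cvg_pairs := repeat first [exact: cvg_id | exact: cvg_cst | apply: cvg_to_pair].

(** Continuity refers to the product topology and measurability to the product sigma-algebra. The
    two are reconciled one real coordinate at a time: a function that is continuous in one
    coordinate, and measurable in the others when that coordinate is frozen, is measurable. *)
Lemma continuous_measurable6 (psi : V3 R * V3 R -> R) : continuous psi ->
  measurable_fun [set: V3 R * V3 R] psi.
Proof.
move=> cpsi.
have E : psi = (fun q => psi (((q.1.1.1, q.1.1.2), q.1.2), ((q.2.1.1, q.2.1.2), q.2.2))).
  by apply/funext => -[[[a b] c] [[d e] f]].
pose m1 := measurableT_comp (@measurable_fst _ _ (R * R)%type R) (@measurable_fst _ _ (V3 R) (V3 R)).
pose m2 := measurableT_comp (@measurable_fst _ _ (R * R)%type R) (@measurable_snd _ _ (V3 R) (V3 R)).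
have cont7 (h : R -> V3 R * V3 R) : continuous h -> continuous (fun x => psi (h x)).
  by move=> ch x; apply: (@continuous_comp _ _ _ h psi); [exact: ch|exact: cpsi].
rewrite E.
apply: (measurable_fun_scont (g := fun q : V3 R * V3 R => q.1.1.1)
  (f := fun x q => psi (((x, q.1.1.2), q.1.2), ((q.2.1.1, q.2.1.2), q.2.2)))).
- exact: (measurableT_comp measurable_fst m1).
- move=> x1; apply: (measurable_fun_scont (g := fun q : V3 R * V3 R => q.1.1.2)
  (f := fun x q => psi (((x1, x), q.1.2), ((q.2.1.1, q.2.1.2), q.2.2)))).
  + exact: (measurableT_comp measurable_snd m1).
  + move=> x2; apply: (measurable_fun_scont (g := fun q : V3 R * V3 R => q.1.2)
    (f := fun x q => psi (((x1, x2), x), ((q.2.1.1, q.2.1.2), q.2.2)))).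
    * exact: (measurableT_comp measurable_snd measurable_fst).
    * move=> x3; apply: (measurable_fun_scont (g := fun q : V3 R * V3 R => q.2.1.1)
      (f := fun x q => psi (((x1, x2), x3), ((x, q.2.1.2), q.2.2)))).
      - exact: (measurableT_comp measurable_fst m2).
      - move=> x4; apply: (measurable_fun_scont (g := fun q : V3 R * V3 R => q.2.1.2)
        (f := fun x q => psi (((x1, x2), x3), ((x4, x), q.2.2)))).
        + exact: (measurableT_comp measurable_snd m2).
        + move=> x5; apply: (measurable_fun_scont (g := fun q : V3 R * V3 R => q.2.2)
          (f := fun x q => psi (((x1, x2), x3), ((x4, x5), x)))).
          * exact: (measurableT_comp measurable_snd measurable_snd).
          * by move=> x6; exact: measurable_cst.
          * by move=> w; apply: cont7 => x; rewrite /continuous_at; cvg_pairs.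
        + by move=> w; apply: cont7 => x; rewrite /continuous_at; cvg_pairs.
      - by move=> w; apply: cont7 => x; rewrite /continuous_at; cvg_pairs.
    * by move=> w; apply: cont7 => x; rewrite /continuous_at; cvg_pairs.
  + by move=> w; apply: cont7 => x; rewrite /continuous_at; cvg_pairs.
- by move=> w; apply: cont7 => x; rewrite /continuous_at; cvg_pairs.
Qed.

Lemma continuous_measurable7 (F : R * (V3 R * V3 R) -> R) : continuous F ->
  measurable_fun [set: R * (V3 R * V3 R)] F.
Proof.
move=> cF; have -> : F = (fun p => F (p.1, p.2)) by apply/funext => -[].
apply: (measurable_fun_scont (g := fst) (f := fun x p => F (x, p.2))).
- exact: measurable_fst.
- move=> x; apply: (@measurableT_comp _ _ _ _ _ _ (fun q => F (x, q))) measurable_snd.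
  apply: continuous_measurable6 => q.
  apply: (@continuous_comp _ _ _ (fun q => (x, q)) F); last exact: cF.
  by rewrite /continuous_at; cvg_pairs.
- move=> w x; apply: (@continuous_comp _ _ _ (fun x => (x, w.2)) F); last exact: cF.
  by rewrite /continuous_at; cvg_pairs.
Qed.

End gen.

Lemma measure_le d (T : measurableType d) (R : realType) (mu : {measure set T -> \bar R}) (A B : set T) :
  measurable A -> measurable B -> A `<=` B -> (mu A <= mu B)%E.
Proof. by move=> mA mB AB; apply: le_measure => //; exact/mem_set. Qed.

Section kernel_agree.
Context {R : realType} d (Omega : measurableType d) (P : probability Omega R)
  dM (M : measurableType dM).
Variables (k1 k2 : Omega -> {measure set M -> \bar R}).
Variable G : set (set (Omega * M)).
Hypothesis fin1 : forall w, (k1 w setT < +oo)%E.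
Hypothesis fin2 : forall w, (k2 w setT < +oo)%E.
Hypothesis GI : setI_closed G.
Hypothesis GT : G setT.
Hypothesis Gm : forall A, G A -> measurable A.
Hypothesis G1 : forall A, G A -> measurable_fun [set: Omega] (fun w => k1 w (xsection A w)).
Hypothesis G2 : forall A, G A -> measurable_fun [set: Omega] (fun w => k2 w (xsection A w)).
Hypothesis GE : forall A, G A ->
  (\int[P]_w k1 w (xsection A w) = \int[P]_w k2 w (xsection A w))%E.
Hypothesis finP : (\int[P]_w k1 w setT < +oo)%E.

Let H : set (set (Omega * M)) := [set A | [/\ measurable A,
  measurable_fun [set: Omega] (fun w => k1 w (xsection A w)),
  measurable_fun [set: Omega] (fun w => k2 w (xsection A w)) &
  (\int[P]_w k1 w (xsection A w) = \int[P]_w k2 w (xsection A w))%E]].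

Let xsT w : xsection [set: Omega * M] w = setT.
Proof. by rewrite xsectionE preimage_setT. Qed.

Let kD (k : Omega -> {measure set M -> \bar R}) A B w :
  (forall w, k w setT < +oo)%E -> measurable A -> measurable B -> B `<=` A ->
  k w (xsection (A `\` B) w) = (k w (xsection A w) - k w (xsection B w))%E.
Proof.
move=> fk mA mB BA.
rewrite xsectionD measureD //; try exact: measurable_xsection.
  congr (_ - k w _)%E; apply/setIidr; exact: le_xsection.
by apply: le_lt_trans (fk w); apply: measure_le => //; exact: measurable_xsection.
Qed.

Let kint (k : Omega -> {measure set M -> \bar R}) A :
  measurable_fun [set: Omega] (fun w => k w (xsection A w)) -> measurable A ->
  (\int[P]_w k w (xsection A w) < +oo)%E ->
  P.-integrable setT (fun w => k w (xsection A w)).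
Proof.
move=> mk mA fk; apply/integrableP; split => //.
rewrite (eq_integral (fun w => k w (xsection A w))) // => w _.
by rewrite gee0_abs.
Qed.

(** Closure under proper differences is where the finiteness of both kernels, and of the mean total
    mass, is used: without it the subtractions would be undefined. *)
Let lambdaH : lambda_system setT H.
Proof.
have H_T : H setT.
  by split; [exact: measurableT|exact: G1|exact: G2|exact: GE].
have fP A : H A -> (\int[P]_w k1 w (xsection A w) < +oo)%E.
  move=> [mA m1 m2 E]; apply: le_lt_trans finP.
  apply: ge0_le_integral => //.
    by have := G1 GT; under eq_fun do rewrite xsT.
  by move=> w _; apply: measure_le => //; exact: measurable_xsection.
split => //.
- move=> A B BA HA HB.
  have [mA mA1 mA2 EA] := HA; have [mB mB1 mB2 EB] := HB.
  have E1 : (fun w => k1 w (xsection (A `\` B) w)) = (fun w => k1 w (xsection A w) - k1 w (xsection B w))%E.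
    by apply/funext => w; exact: kD.
  have E2 : (fun w => k2 w (xsection (A `\` B) w)) = (fun w => k2 w (xsection A w) - k2 w (xsection B w))%E.
    by apply/funext => w; exact: kD.
  split; first exact: measurableD.
  + by rewrite E1; exact: emeasurable_funB.
  + by rewrite E2; exact: emeasurable_funB.
  + rewrite E1 E2 !integralB ?EA ?EB //; apply: kint => //; rewrite -?EA -?EB; exact: fP.
- move=> A ndA HA.
  have mA n : measurable (A n) by have [] := HA n.
  have cvgk (k : Omega -> {measure set M -> \bar R}) w :
      k w (xsection (A n) w) @[n --> \oo] --> k w (xsection (\bigcup_n A n) w).
    rewrite xsection_bigcup; apply: nondecreasing_cvg_mu.
    - by move=> n; exact: measurable_xsection.
    - by apply: bigcup_measurable => n _; exact: measurable_xsection.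
    - by move=> m n mn; apply/subsetPset; apply: le_xsection; apply/subsetPset/ndA.
  have mono (k : Omega -> {measure set M -> \bar R}) w : nondecreasing_seq (fun n => k w (xsection (A n) w)).
    move=> m n mn; apply: measure_le; try exact: measurable_xsection.
    by apply: le_xsection; apply/subsetPset/ndA.
  have m1 : measurable_fun [set: Omega] (fun w => k1 w (xsection (\bigcup_n A n) w)).
    by apply: (emeasurable_fun_cvg (fun n w => k1 w (xsection (A n) w))) => // n; have [] := HA n.
  have m2 : measurable_fun [set: Omega] (fun w => k2 w (xsection (\bigcup_n A n) w)).
    by apply: (emeasurable_fun_cvg (fun n w => k2 w (xsection (A n) w))) => // n; have [] := HA n.
  split => //; first exact: bigcup_measurable.
  have c1 : (\int[P]_w k1 w (xsection (A n) w))%E @[n --> \oo] --> (\int[P]_w k1 w (xsection (\bigcup_n A n) w))%E.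
    have -> : (fun w => k1 w (xsection (\bigcup_n A n) w)) = (fun w => limn (fun n => k1 w (xsection (A n) w))).
      by apply/funext => w; apply/esym/cvg_lim => //; exact: cvgk.
    by apply: cvg_monotone_convergence => // n; have [] := HA n.
  have c2 : (\int[P]_w k2 w (xsection (A n) w))%E @[n --> \oo] --> (\int[P]_w k2 w (xsection (\bigcup_n A n) w))%E.
    have -> : (fun w => k2 w (xsection (\bigcup_n A n) w)) = (fun w => limn (fun n => k2 w (xsection (A n) w))).
      by apply/funext => w; apply/esym/cvg_lim => //; exact: cvgk.
    by apply: cvg_monotone_convergence => // n; have [] := HA n.
  rewrite -(cvg_lim _ c1)// -(cvg_lim _ c2)//; congr (limn _).
  by apply/funext => n; have [] := HA n.
Qed.

(** The pi-lambda theorem for two random finite measures compared in expectation. The integrand must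
    be measurable for the sigma-algebra generated by [G], which is in general smaller than the
    product one; with predictable rectangles for [G] this is exactly predictability. Indicators come
    from the lambda-system, and [ge0_fun_ind] does the rest. *)
Lemma kernel_agree (h : g_sigma_algebraType G -> \bar R) :
  measurable_fun [set: g_sigma_algebraType G] h -> (forall x, (0 <= h x)%E) ->
  [/\ measurable_fun [set: Omega * M] (h : Omega * M -> \bar R),
   measurable_fun [set: Omega] (fun w => \int[k1 w]_p h (w, p))%E,
   measurable_fun [set: Omega] (fun w => \int[k2 w]_p h (w, p))%E &
   (\int[P]_w \int[k1 w]_p h (w, p) = \int[P]_w \int[k2 w]_p h (w, p))%E].
Proof.
pose Pf (h : g_sigma_algebraType G -> \bar R) := [/\ measurable_fun [set: Omega * M] (h : Omega * M -> \bar R),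
   measurable_fun [set: Omega] (fun w => \int[k1 w]_p h (w, p))%E,
   measurable_fun [set: Omega] (fun w => \int[k2 w]_p h (w, p))%E &
   (\int[P]_w \int[k1 w]_p h (w, p) = \int[P]_w \int[k2 w]_p h (w, p))%E].
have mpair (g : g_sigma_algebraType G -> \bar R) w : measurable_fun [set: Omega * M] (g : Omega * M -> \bar R) ->
    measurable_fun [set: M] (fun p => g (w, p)).
  by move=> mg; exact: measurableT_comp mg _.
apply: (@ge0_fun_ind _ _ _ Pf).
- move=> A mA.
  have [mA' m1 m2 E] : H A.
    by apply: (lambda_system_subset GI lambdaH) => // B GB; split; [exact: Gm|exact: G1|exact: G2|exact: GE].
  have EI (k : Omega -> {measure set M -> \bar R}) : (fun w => \int[k w]_p (\1_A (w, p))%:E)%E = fun w => k w (xsection A w).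
    apply/funext => w; have mx : measurable (xsection A w) by exact: measurable_xsection.
    transitivity (\int[k w]_p (\1_(xsection A w) p)%:E)%E; last by rewrite integral_indic// setIT.
    by apply: eq_integral => p _; rewrite !indicE mem_xsection.
  split; rewrite ?EI //.
  exact/measurable_EFinP/measurable_indic.
- move=> k f g k0 mf mg f0 g0 [mf' f1 f2 fE] [mg' g1 g2 gE].
  have EL (kk : Omega -> {measure set M -> \bar R}) : (fun w => \int[kk w]_p (k%:E * f (w, p) + g (w, p)))%E =
     (fun w => k%:E * (\int[kk w]_p f (w, p)) + \int[kk w]_p g (w, p))%E.
    apply/funext => w; rewrite ge0_integralD//.
    + by rewrite ge0_integralZl_EFin//; exact: mpair.
    + by move=> p _; rewrite mule_ge0.
    + by apply/measurable_funeM; exact: mpair.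
    + exact: mpair.
  have i0 (kk : Omega -> {measure set M -> \bar R}) (u : g_sigma_algebraType G -> \bar R) w : (forall x, 0 <= u x)%E -> (0 <= \int[kk w]_p u (w, p))%E.
    by move=> u0; apply: integral_ge0.
  split.
  + by apply: emeasurable_funD => //; exact: measurable_funeM.
  + by rewrite EL; apply: emeasurable_funD => //; exact: measurable_funeM.
  + by rewrite EL; apply: emeasurable_funD => //; exact: measurable_funeM.
  + have EP (kk : Omega -> {measure set M -> \bar R}) :
        measurable_fun [set: Omega] (fun w => \int[kk w]_p f (w, p))%E ->
        measurable_fun [set: Omega] (fun w => \int[kk w]_p g (w, p))%E ->
        (\int[P]_w (k%:E * (\int[kk w]_p f (w, p)) + \int[kk w]_p g (w, p)) =
         k%:E * (\int[P]_w \int[kk w]_p f (w, p)) + \int[P]_w \int[kk w]_p g (w, p))%E.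
      move=> a1 a2; rewrite ge0_integralD ?ge0_integralZl_EFin //.
      * by move=> w _; exact: i0.
      * by move=> w _; rewrite mule_ge0// i0.
      * exact: measurable_funeM.
      * by move=> w _; exact: i0.
    by rewrite !EL !EP // fE gE.
- move=> u f mu u0 ndu uf Hu.
  have cvgk (k : Omega -> {measure set M -> \bar R}) w :
      (\int[k w]_p u n (w, p))%E @[n --> \oo] --> (\int[k w]_p f (w, p))%E.
    have -> : (fun p => f (w, p)) = (fun p => limn (fun n => u n (w, p))).
      by apply/funext => p; apply/esym/cvg_lim => //; exact: uf.
    apply: cvg_monotone_convergence => // n.
    by apply: mpair; have [] := Hu n.
  have mono (k : Omega -> {measure set M -> \bar R}) w : nondecreasing_seq (fun n => \int[k w]_p u n (w, p))%E.
    move=> m n mn; apply: ge0_le_integral => //.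
    + by apply: mpair; have [] := Hu m.
    + by apply: mpair; have [] := Hu n.
    + by move=> p _; exact: ndu.
  have cc (k : Omega -> {measure set M -> \bar R}) : (forall n, measurable_fun [set: Omega] (fun w => \int[k w]_p u n (w, p))%E) ->
     (\int[P]_w \int[k w]_p u n (w, p))%E @[n --> \oo] --> (\int[P]_w \int[k w]_p f (w, p))%E.
    move=> mk.
    have -> : (fun w => \int[k w]_p f (w, p))%E = (fun w => limn (fun n => \int[k w]_p u n (w, p)))%E.
      by apply/funext => w; apply/esym/cvg_lim => //; exact: cvgk.
    by apply: cvg_monotone_convergence => // n w _; exact: integral_ge0.
  split.
  + apply: (emeasurable_fun_cvg (fun n => u n : Omega * M -> \bar R)) => // n; have [] := Hu n; done.
  + by apply: (emeasurable_fun_cvg (fun n w => \int[k1 w]_p u n (w, p))%E) => [n|w _]; [have [] := Hu n|exact: cvgk].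
  + by apply: (emeasurable_fun_cvg (fun n w => \int[k2 w]_p u n (w, p))%E) => [n|w _]; [have [] := Hu n|exact: cvgk].
  + have c1 := @cc k1 (fun n => let: And4 _ a _ _ := Hu n in a).
    have c2 := @cc k2 (fun n => let: And4 _ _ a _ := Hu n in a).
    have E : (fun n => \int[P]_w \int[k2 w]_p u n (w, p))%E = (fun n => \int[P]_w \int[k1 w]_p u n (w, p))%E.
      by apply/funext => n; have [] := Hu n.
    by move: c2; rewrite E => c2; exact: (cvg_unique (@ereal_hausdorff R) c1 c2).
Qed.

End kernel_agree.

(** * Counting measures and the Poisson law *)

Section poisson.
Context {R : realType}.

Lemma poisson_p_ge0 (lam : R) k : 0 <= lam -> 0 <= poisson_p lam k.
Proof. by move=> l0; rewrite /poisson_p !mulr_ge0// ?expR_ge0 ?exprn_ge0 ?invr_ge0. Qed.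

Lemma poisson_p_sum1 (lam : R) : 0 <= lam -> (\sum_(k <oo) (poisson_p lam k)%:E = 1)%E.
Proof.
move=> l0; rewrite [RHS](_ : _ = (expR (- lam))%:E * (expR lam)%:E)%E; last first.
  by rewrite -EFinM expRN mulVf ?gt_eqF ?expR_gt0.
under eq_eseriesr do rewrite /poisson_p -mulrA EFinM.
rewrite nneseriesZl; last by move=> n _; rewrite lee_fin divr_ge0// exprn_ge0.
congr *%E; rewrite expRE -EFin_lim; last first.
  rewrite /pseries/=; under eq_fun do rewrite mulrC.
  exact: is_cvg_series_exp_coeff.
apply/congr_lim/funext => n/=; rewrite /pseries/= /series/= -sumEFin//.
by under eq_bigr do rewrite mulrC.
Qed.

(** The term k = 0 vanishes and (k + 1) p(k + 1) = lam p(k), so a shift of the index leaves lam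
    times the total mass. *)
Lemma poisson_p_mean (lam : R) : 0 <= lam ->
  (\sum_(k <oo) (k%:R * poisson_p lam k)%:E = lam%:E)%E.
Proof.
move=> l0.
have ge k : (0 <= (k%:R * poisson_p lam k)%:E)%E by rewrite lee_fin mulr_ge0// poisson_p_ge0.
rewrite nneseries_recl// mul0r add0e -(nneseries_addn 1)//.
transitivity (\sum_(k <oo) lam%:E * (poisson_p lam k)%:E)%E.
  apply: eq_eseriesr => k _; rewrite -EFinM addn1 /poisson_p; congr EFin.
  have k1 : (k.+1%:R : R) != 0 by [].
  have kf : (k`!%:R : R) != 0 by rewrite pnatr_eq0 -lt0n fact_gt0.
  rewrite factS natrM exprS; move: k1 kf.
  move: (k.+1%:R : R) (k`!%:R : R) (lam ^+ k) => a b c a0 b0.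
  by field; rewrite a0 b0.
rewrite nneseriesZl ?poisson_p_sum1 ?mule1// => k _.
by rewrite lee_fin poisson_p_ge0.
Qed.

Section count.
Context d (Omega : measurableType d) (P : probability Omega R) (V : Omega -> \bar R).
Variable lam : R.
Hypothesis lam0 : 0 <= lam.
Hypothesis Vint : forall w, (exists k : nat, V w = k%:R%:E) \/ V w = +oo%E.
Hypothesis mV : measurable_fun [set: Omega] V.
Hypothesis PV : forall k : nat, P [set w | V w = k%:R%:E] = (poisson_p lam k)%:E.

Let A (k : nat) := [set w | V w = k%:R%:E].

Let mA k : measurable (A k).
Proof. by have := mV measurableT (emeasurable_set1 (k%:R%:E)); rewrite setTI. Qed.

Let tA : trivIset setT A.
Proof.
apply/trivIsetP => i j _ _ ij; apply/seteqP; split => // w [].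
by rewrite /A /= => -> [] /eqP; rewrite eqr_nat (negbTE ij).
Qed.

Let Aoo : ~` (\bigcup_k A k) = [set w | V w = +oo%E].
Proof.
apply/seteqP; split => [w /= H|w /= Hw [k _ /=]]; last by rewrite /A /= Hw.
by have [[k Vk]|//] := Vint w; exfalso; apply: H; exists k.
Qed.

(** The Poisson weights already add up to 1 over the finite values, so no mass remains for the
    infinite one. *)
Lemma poisson_count_lty : P [set w | V w = +oo%E] = 0%E.
Proof.
rewrite -Aoo probability_setC; last by apply: bigcup_measurable => k _.
rewrite measure_semi_bigcup//; last by apply: bigcup_measurable => k _.
by rewrite (eq_eseriesr (fun i _ => PV i)) poisson_p_sum1 // subee.
Qed.

(** Independence of [V] and [G] enters only through the level sets of [V]: G is cut along them, and
    the rest of G lies in the null event where [V] is infinite. *)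
Lemma poisson_count_mean G : measurable G ->
  (forall k : nat, P (G `&` [set w | V w = k%:R%:E]) = (P G * (poisson_p lam k)%:E)%E) ->
  (\int[P]_(w in G) V w = P G * lam%:E)%E.
Proof.
move=> mG PG.
have mU : measurable (\bigcup_k A k) by apply: bigcup_measurable => k _.
have V0 w : (0 <= V w)%E by have [[k ->]|->] := Vint w; rewrite ?lee_fin.
have GE : G = (\bigcup_k (G `&` A k)) `|` (G `\` \bigcup_k A k).
  by rewrite -setI_bigcupr setUIDK.
rewrite {1}GE ge0_integral_setU//; last 4 first.
- by apply: bigcup_measurable => k _; exact: measurableI.
- exact: measurableD.
- by rewrite -GE; exact: measurable_funTS.
- apply/disj_setPS => w [[k _ [_ Ak]] [_ nA]]; by apply: nA; exists k.
rewrite [X in (_ + X)%E]null_set_integral ?adde0; last 3 first.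
- exact: measurableD.
- exact: measurable_funTS.
- apply/eqP; rewrite eq_le measure_ge0 andbT -poisson_count_lty.
  apply: measure_le; [exact: measurableD| |].
    by rewrite -Aoo; exact: measurableC.
  by rewrite -Aoo => w [].
rewrite ge0_integral_bigcup//; last 3 first.
- by move=> k; exact: measurableI.
- exact: measurable_funTS.
- exact: trivIset_setIl.
transitivity (\sum_(k <oo) P G * (k%:R * poisson_p lam k)%:E)%E.
  apply: eq_eseriesr => k _.
  rewrite (eq_integral (fun=> k%:R%:E)); last by move=> w /set_mem[_ /= ->].
  rewrite integral_cst; last exact: measurableI.
  by rewrite [X in (_ * X = _)%E](PG k) muleCA EFinM.
rewrite -{1}(fineK (fin_num_measure P _ mG)) nneseriesZl ?poisson_p_mean ?fineK ?fin_num_measure// => k _.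
by rewrite lee_fin mulr_ge0// poisson_p_ge0.
Qed.

(** The probability is 1 - (1 + lam) exp (- lam), and exp (- lam) >= 1 - lam bounds it by 1 - (1 +
    lam)(1 - lam) = lam^2. The square is what makes the union bound over a grid small. *)
Lemma poisson_count_ge2 : (P [set w | (2%:E <= V w)%E] <= (lam ^+ 2)%:E)%E.
Proof.
have -> : [set w | (2%:E <= V w)%E] = ~` (A 0%N `|` A 1%N).
  apply/seteqP; split => w /=.
    by move=> h [|] /= E; move: h; rewrite E lee_fin; lra.
  move=> h; have [[k Vk]|->] := Vint w; last by rewrite leey.
  rewrite Vk lee_fin; move: k Vk => [|[|k]] Vk.
  - by exfalso; apply: h; left.
  - by exfalso; apply: h; right.
  - by rewrite ler_nat.
rewrite probability_setC; last exact: measurableU.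
rewrite measureU//; last by have /trivIsetP/(_ 0%N 1%N) := tA; exact.
rewrite [X in (1 - X <= _)%E](_ : _ = (poisson_p lam 0 + poisson_p lam 1)%:E); last by rewrite EFinD -(PV 0%N) -(PV 1%N).
rewrite -EFinB lee_fin /poisson_p expr0 expr1 !divr1.
have := expR_ge1Dx (- lam); have := expR_ge0 (- lam); move: lam0; nra.
Qed.
End count.
End poisson.

(** * Product measures *)

Section sprod.
Context d1 d2 (T1 : measurableType d1) (T2 : measurableType d2) (R : realType).
Variable m1 : {sigma_finite_measure set T1 -> \bar R}.
Variable m2 : {sigma_finite_measure set T2 -> \bar R}.

(* The canonical sigma-finite structure of [m1 \x m2] is not found by unification
   (a later instance for probabilities takes precedence), hence this copy. *)
Definition sprod : set (T1 * T2) -> \bar R := (m1 \x m2)%E.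

HB.instance Definition _ := Measure.on sprod.

Let sprod_sigma_finite : sigma_finite setT sprod.
Proof.
have /sigma_finiteP[F [TF ndF Foo]] := sigma_finiteT m1.
have /sigma_finiteP[G [TG ndG Goo]] := sigma_finiteT m2.
exists (fun n => F n `*` G n).
  rewrite -setXTT TF TG predeqE => -[x y]; split.
    move=> [/= [n _ Fnx] [k _ Gky]]; exists (maxn n k) => //; split.
    - by move: x Fnx; exact/subsetPset/ndF/leq_maxl.
    - by move: y Gky; exact/subsetPset/ndG/leq_maxr.
  by move=> [n _ []/= ? ?]; split; exists n.
move=> k; have [? ?] := Foo k; have [? ?] := Goo k.
split; first exact: measurableX.
by rewrite /sprod product_measure1E// lte_mul_pinfty// ge0_fin_numE.
Qed.

HB.instance Definition _ := Measure_isSigmaFinite.Build _ _ _ sprod sprod_sigma_finite.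
End sprod.

(** The identity; it only forces its argument to be elaborated with its bundled sigma-finite
    structure. *)
Definition sfm {d} {T : measurableType d} {R : realType}
  (m : {sigma_finite_measure set T -> \bar R}) := m.

Lemma integral_prod_mul d1 d2 (T1 : measurableType d1) (T2 : measurableType d2) (R : realType)
  (m1 : {sigma_finite_measure set T1 -> \bar R}) (m2 : {sigma_finite_measure set T2 -> \bar R})
  (a : T1 -> \bar R) (b : T2 -> \bar R) :
  measurable_fun setT a -> measurable_fun setT b ->
  (forall x, 0 <= a x)%E -> (forall x, 0 <= b x)%E ->
  (\int[sprod m1 m2]_p (a p.1 * b p.2) = (\int[m1]_x a x) * \int[m2]_y b y)%E.
Proof.
move=> ma mb a0 b0; rewrite fubini_tonelli1//; last 2 first.
- by apply: emeasurable_funM; apply: measurableT_comp.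
- by move=> p; rewrite mule_ge0.
transitivity (\int[m1]_x (a x * \int[m2]_y b y))%E.
  by apply: eq_integral => x _; rewrite /fubini_F /= ge0_integralZl.
by rewrite ge0_integralZr// integral_ge0.
Qed.

Section transfer.
Context d1 d2 (T1 : measurableType d1) (T2 : measurableType d2) (R : realType).
Variables (m1 : {measure set T1 -> \bar R}) (m2 : {measure set T2 -> \bar R}) (phi : T1 -> T2).
Hypothesis mphi : measurable_fun [set: T1] phi.
Hypothesis m12 : forall A, measurable A -> m2 A = m1 (phi @^-1` A).

Lemma ge0_integral_transfer D (f : T2 -> \bar R) : measurable D -> measurable_fun D f ->
  (forall x, D x -> 0 <= f x)%E ->
  (\int[m1]_(x in phi @^-1` D) f (phi x) = \int[m2]_(y in D) f y)%E.
Proof.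
move=> mD mf f0; have f0' : {in D, forall x, (0 <= f x)%E} by move=> x /set_mem; exact: f0.
rewrite -(ge0_integral_pushforward mphi m1 mD mf f0').
by apply: eq_measure_integral => A mA AD; rewrite m12.
Qed.

Lemma integral_transfer D (f : T2 -> \bar R) : measurable D -> measurable_fun D f ->
  (\int[m1]_(x in phi @^-1` D) f (phi x) = \int[m2]_(y in D) f y)%E.
Proof.
move=> mD mf; rewrite integralE [RHS]integralE.
have Ep := @ge0_integral_transfer _ (f^\+)%E mD (measurable_funepos mf) (fun x _ => funepos_ge0 f x).
have En := @ge0_integral_transfer _ (f^\-)%E mD (measurable_funeneg mf) (fun x _ => funeneg_ge0 f x).
by rewrite -Ep -En; congr (_ - _)%E; apply: eq_integral => x _; rewrite ?funeposE ?funenegE.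
Qed.

End transfer.

Section lebR.
Context {R : realType}.

(* [lebesgue_measure] lives on [measurableTypeR R], whose display differs from that of [R];
   this copy and [integral_transfer] reconcile the two. *)
Definition lebR (A : set R) : \bar R := lebesgue_measure A.

Let lebR0 : lebR set0 = 0%E. Proof. exact: measure0. Qed.
Let lebR_ge0 A : (0 <= lebR A)%E. Proof. exact: measure_ge0. Qed.
Let lebR_add : semi_sigma_additive lebR.
Proof. exact: (@measure_semi_sigma_additive _ _ _ (@lebesgue_measure R)). Qed.
HB.instance Definition _ := isMeasure.Build _ _ _ lebR lebR0 lebR_ge0 lebR_add.

Let lebR_sigma_finite : sigma_finite setT lebR.
Proof. exact: (sigma_finiteT (@lebesgue_measure R)). Qed.
HB.instance Definition _ := Measure_isSigmaFinite.Build _ _ _ lebR lebR_sigma_finite.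

Lemma measurable_to_lebR : measurable_fun [set: measurableTypeR R] (id : measurableTypeR R -> R).
Proof. exact: (@measurable_id _ (measurableTypeR R)). Qed.

Lemma lebRE (A : set R) : measurable A -> lebR A = @lebesgue_measure R (id @^-1` A).
Proof. by []. Qed.

Lemma lebR_itv (a b : R) (b0 b1 : bool) : a <= b ->
  lebR [set` Interval (BSide b0 a) (BSide b1 b)] = (b - a)%:E.
Proof.
move=> ab; rewrite /lebR lebesgue_measure_itv /= lte_fin.
by case: ltP => [_|ba]; [rewrite EFinB|rewrite (_ : b - a = 0)//; lra].
Qed.

End lebR.

Section sprod_transfer.
Context d1 d2 d1' d2' (T1 : measurableType d1) (T2 : measurableType d2)
  (T1' : measurableType d1') (T2' : measurableType d2') (R : realType).
Variables (m1 : {measure set T1 -> \bar R}) (m2 : {sigma_finite_measure set T2 -> \bar R}).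
Variables (m1' : {sigma_finite_measure set T1' -> \bar R}) (m2' : {sigma_finite_measure set T2' -> \bar R}).
Variables (phi1 : T1 -> T1') (phi2 : T2 -> T2').
Hypotheses (mphi1 : measurable_fun setT phi1) (mphi2 : measurable_fun setT phi2).
Hypothesis E1 : forall A, measurable A -> m1' A = m1 (phi1 @^-1` A).
Hypothesis E2 : forall A, measurable A -> m2' A = m2 (phi2 @^-1` A).

Let phi (p : T1 * T2) := (phi1 p.1, phi2 p.2).

Lemma measurable_pair_map : measurable_fun setT phi.
Proof. by apply: measurable_fun_pair; apply: measurableT_comp. Qed.

Lemma sprod_transfer A : measurable A -> sprod m1' m2' A = (m1 \x m2)%E (phi @^-1` A).
Proof.
move=> mA; rewrite /sprod /product_measure1.
rewrite -(ge0_integral_transfer mphi1 E1)//; last exact: measurable_fun_xsection.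
rewrite preimage_setT; apply: eq_integral => x _ /=.
rewrite E2; last exact: measurable_xsection.
by congr (m2 _); rewrite !xsectionE.
Qed.
End sprod_transfer.

(** * Velocity, collision and mark measures over a single copy of the real line *)

Section measures.
Context {R : realType}.
Definition lebv : {sigma_finite_measure set (V3 R) -> \bar R} := sfm (sprod (sprod (@lebR R) (@lebR R)) (@lebR R)).
Variable Q : {sigma_finite_measure set R -> \bar R}.
Definition collM : {sigma_finite_measure set (V3 R * R * R)%type -> \bar R} := sfm (sprod (sprod lebv Q) (@lebR R)).
Definition markE : {sigma_finite_measure set (V3 R * R * R * R)%type -> \bar R} := sfm (sprod collM (@lebR R)).
Definition markM : {sigma_finite_measure set (Mk R) -> \bar R} := sfm (sprod markE (@lebR R)).

Let MR := measurableTypeR R.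
Notation id1 := (id : MR -> R).
(** These maps are the identity on points and change only the sigma-algebra display of the real
    factors; Q keeps its own. Each product layer has to be transferred separately, because its
    sigma-algebra is rebuilt from the factors. *)
Let id2 (p : MR * MR) : R * R := (id1 p.1, id1 p.2).
Let id3 (p : MR * MR * MR) : V3 R := (id2 p.1, id1 p.2).
Let id4 (p : MR * MR * MR * R) : V3 R * R := (id3 p.1, id p.2).
Let id5 (p : MR * MR * MR * R * MR) : V3 R * R * R := (id4 p.1, id1 p.2).
Let id6 (p : MR * MR * MR * R * MR * MR) : V3 R * R * R * R := (id5 p.1, id1 p.2).
Let id7 (p : MR * MR * MR * R * MR * MR * MR) : Mk R := (id6 p.1, id1 p.2).

Let m2 : measurable_fun setT id2 := measurable_pair_map measurable_to_lebR measurable_to_lebR.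
Let m3 : measurable_fun setT id3 := measurable_pair_map m2 measurable_to_lebR.
Let m4 : measurable_fun setT id4 := measurable_pair_map m3 (@measurable_id _ R setT).
Let m5 : measurable_fun setT id5 := measurable_pair_map m4 measurable_to_lebR.
Let m6 : measurable_fun setT id6 := measurable_pair_map m5 measurable_to_lebR.
Let m7 : measurable_fun setT id7 := measurable_pair_map m6 measurable_to_lebR.

Let E2 := sprod_transfer (m1' := @lebR R) (m2' := @lebR R) measurable_to_lebR lebRE lebRE.
Let E3 := sprod_transfer (m1' := sprod (@lebR R) (@lebR R)) (m2' := @lebR R) m2 E2 lebRE.
Let E33 := sprod_transfer (m1' := lebv) (m2' := lebv)
  (m2 := sprod (sprod (@lebesgue_measure R) (@lebesgue_measure R)) (@lebesgue_measure R)) m3 E3 E3.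
Let E4 := sprod_transfer (m1' := lebv) (m2' := Q) m3 E3 (fun A _ => erefl).
Let E5 := sprod_transfer (m1' := sprod lebv Q) (m2' := @lebR R) m4 E4 lebRE.
Let E6 := sprod_transfer (m1' := collM) (m2' := @lebR R) m5 E5 lebRE.
Let E7 := sprod_transfer (m1' := markE) (m2' := @lebR R) m6 E6 lebRE.

Lemma integral_lebR (D : set R) (f : R -> \bar R) : measurable D -> measurable_fun D f ->
  (\int[@lebesgue_measure R]_(x in D) f x = \int[lebR]_(x in D) f x)%E.
Proof. exact: (integral_transfer measurable_to_lebR lebRE). Qed.

Lemma integral_lebv (f : V3 R -> \bar R) : measurable_fun setT f ->
  (\int[leb3]_x f x = \int[lebv]_x f x)%E.
Proof.
move=> mf; rewrite -(integral_transfer m3 E3 measurableT mf).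
by apply: eq_integral => -[[a b] c].
Qed.

Lemma integral_lebvv (f : V3 R * V3 R -> \bar R) : measurable_fun setT f ->
  (\int[(leb3 \x leb3)]_x f x = \int[sprod lebv lebv]_x f x)%E.
Proof.
move=> mf; have := integral_transfer (measurable_pair_map m3 m3) E33 measurableT mf.
have -> : (fun p => f (id3 p.1, id3 p.2)) = f by apply/funext => -[[[a b] c] [[a' b'] c']].
by rewrite preimage_setT => <-.
Qed.

Lemma integral_collM D (f : V3 R * R * R -> \bar R) : measurable D -> measurable_fun D f ->
  (\int[collmeas Q]_(x in D) f x = \int[collM]_(x in D) f x)%E.
Proof.
move=> mD mf; rewrite -(integral_transfer m5 E5 mD mf).
have E : id5 = id :> (V3 R * R * R -> V3 R * R * R) by apply/funext => -[[[[a b] c] d] e].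
by rewrite E.
Qed.

Lemma integral_markM D (f : Mk R -> \bar R) : measurable D -> measurable_fun D f ->
  (\int[markmeas Q]_(x in D) f x = \int[markM]_(x in D) f x)%E.
Proof.
move=> mD mf; rewrite -(integral_transfer m7 E7 mD mf).
have E : id7 = id :> (Mk R -> Mk R) by apply/funext => -[[[[[[a b] c] d] e] h] k].
by rewrite E.
Qed.

Lemma integrable_collM D (f : V3 R * R * R -> \bar R) : measurable D -> measurable_fun D f ->
  collM.-integrable D f -> (collmeas Q).-integrable D f.
Proof.
move=> mD mf /integrableP[_ fD]; apply/integrableP; split; first exact: mf.
by rewrite integral_collM//; exact: measurableT_comp.
Qed.

Lemma measurable_pth : measurable_fun [set: Mk R] (@pth R).
Proof. by rewrite /pth; do 3 apply: measurableT_comp => //. Qed.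

Lemma measurable_pv : measurable_fun [set: Mk R] (@pv R).
Proof. by rewrite /pv; do 3 apply: measurableT_comp => //. Qed.

Lemma measurable_pph : measurable_fun [set: Mk R] (@pph R).
Proof. by rewrite /pph; do 2 apply: measurableT_comp => //. Qed.

Lemma measurable_pr : measurable_fun [set: Mk R] (@pr R).
Proof. by rewrite /pr; apply: measurableT_comp => //. Qed.

Lemma measurable_ps : measurable_fun [set: Mk R] (@ps R).
Proof. exact: measurable_snd. Qed.

End measures.

Section clamp.
Context {R : realType}.
(** Continuity of f and regularity of the paths are given on [0, T] only. Precomposing with this
    projection yields objects on the whole line that agree with the given ones on [0, T], so domains
    disappear from measurability statements. *)
Definition clamp (T s : R) : R := Num.min T (Num.max 0 s).

Lemma clamp_id T s : 0 <= s <= T -> clamp T s = s.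
Proof. by move=> /andP[s0 sT]; rewrite /clamp (max_idPr s0) (min_idPr sT). Qed.

Lemma clamp_itv T s : 0 <= T -> 0 <= clamp T s <= T.
Proof. by move=> T0; rewrite /clamp le_min T0 le_max lexx ge_min lexx. Qed.

Lemma continuous_clamp T : continuous (clamp T).
Proof.
have -> : clamp T = cst T \min (cst 0 \max id) by apply/funext.
move=> x; apply: continuous_min; first exact: cvg_cst.
by apply: continuous_max; [exact: cvg_cst|exact: cvg_id].
Qed.

Definition fclamp (T : R) (f : R -> V3 R -> V3 R -> R) (q : R * (V3 R * V3 R)) : R :=
  f (clamp T q.1) q.2.1 q.2.2.

Lemma continuous_fclamp T f : 0 <= T -> cont_on T f -> continuous (fclamp T f).
Proof.
move=> T0 cf q.
have cl : (fun p : R * (V3 R * V3 R) => (clamp T p.1, p.2)) @ q --> (clamp T q.1, q.2).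
  apply: cvg_to_pair; last exact: cvg_snd.
  by apply: (@continuous_comp _ _ _ fst (clamp T)); [exact: cvg_fst|exact: continuous_clamp].
have /subspace_continuousP/(_ (clamp T q.1, q.2) (clamp_itv q.1 T0)) H := cf.
move=> A /= nA; have {}H := H A nA.
by apply: (@filterS _ (nbhs q) _ _ _ _ (cl _ H)) => p /= h; exact: (h (clamp_itv p.1 T0)).
Qed.
End clamp.

(** * The intensity of the Poisson random measure *)

Section intensity.
Context {R : realType}.
Variables (Q : {sigma_finite_measure set R -> \bar R}) (T : R) (f : R -> V3 R -> V3 R -> R).
Hypothesis T0 : 0 < T.
Hypothesis fprob : prob_densities T f.
Hypothesis fcont : cont_on T f.

Let T0' : 0 <= T. Proof. exact: ltW. Qed.

Lemma fclamp_ge0 q : 0 <= fclamp T f q.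
Proof. by have [+ _ _] := fprob (clamp_itv q.1 T0'); exact. Qed.

Lemma measurable_fclamp : measurable_fun [set: R * (V3 R * V3 R)] (fclamp T f).
Proof. by apply: continuous_measurable7; exact: continuous_fclamp. Qed.

Definition mT (p : R * V3 R) : \bar R := (\int[lebv]_x (fclamp T f (p.1, (x, p.2)))%:E)%E.

Lemma mT_ge0 p : (0 <= mT p)%E.
Proof. by apply: integral_ge0 => x _; rewrite lee_fin fclamp_ge0. Qed.

Lemma measurable_mT : measurable_fun [set: R * V3 R] mT.
Proof.
have mg : measurable_fun [set: (R * V3 R) * V3 R] (fun u => (fclamp T f (u.1.1, (u.2, u.1.2)))%:E).
  apply/measurable_EFinP.
  apply: (measurableT_comp measurable_fclamp); apply: measurable_fun_pair.
    exact: measurableT_comp.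
  by apply: measurable_fun_pair => //; exact: measurableT_comp.
by apply: (@measurable_fun_fubini_tonelli_F _ _ _ _ R lebv _ mg) => u; rewrite lee_fin fclamp_ge0.
Qed.

Lemma mT_int s : (\int[lebv]_v mT (s, v) = 1)%E.
Proof.
have [f0 mf f1] := fprob (clamp_itv s T0').
have mf' : measurable_fun [set: V3 R * V3 R] (fun p => (f (clamp T s) p.1 p.2)%:E) by exact/measurable_EFinP.
rewrite -[RHS]f1.
by rewrite (integral_lebvv mf') (@fubini_tonelli2 _ _ _ _ _ lebv lebv _ mf')// => p; rewrite lee_fin.
Qed.

(** The velocity density as a real number. An infinite value of [mT] becomes 0, in accordance with
    [mden]; since [mT] has integral 1 this happens only for a null set of velocities. *)
Definition mr (s : R) (v : V3 R) : R := fine (mT (s, v)).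

Lemma mr_ge0 s v : 0 <= mr s v.
Proof. by rewrite fine_ge0// mT_ge0. Qed.

Lemma mrE s v : 0 <= s <= T -> mr s v = mden f s v.
Proof.
move=> sT; rewrite /mden /Rint integral_lebv; first by rewrite /mr /mT /fclamp /= clamp_id.
apply/measurable_EFinP.
rewrite (_ : (fun x => f s x v) = fclamp T f \o (fun x => (s, (x, v)))); last first.
  by apply/funext => x; rewrite /fclamp /= clamp_id.
apply: measurableT_comp; first exact: measurable_fclamp.
by apply: measurable_fun_pair => //; exact: measurable_fun_pair.
Qed.

Lemma measurable_mr : measurable_fun [set: R * V3 R] (fun p => mr p.1 p.2).
Proof.
rewrite (_ : (fun p => _) = fine \o mT); last by apply/funext => -[].
by apply: measurableT_comp => //; exact: measurable_mT.
Qed.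

Lemma mr_int s : (\int[lebv]_v (mr s v)%:E <= 1)%E.
Proof.
rewrite -(mT_int s); apply: ge0_le_integral => //.
- by move=> v _; rewrite lee_fin mr_ge0.
- apply/measurable_EFinP; exact: (measurableT_comp measurable_mr (measurable_pair1 s)).
- exact: (measurableT_comp measurable_mT (measurable_pair1 s)).
- move=> v _; rewrite /mr; have := mT_ge0 (s, v).
  by case: (mT (s, v)) => [r| |] //= _; rewrite lee_fin.
Qed.

(** The density of the compensator with respect to [markM], with the mark domain absorbed into it as
    an indicator. *)
Definition rho (p : Mk R) : R := (\1_(markdom T) p) * mr (ps p) (pv p).

Lemma rho_ge0 p : 0 <= rho p.
Proof. by rewrite mulr_ge0// mr_ge0. Qed.

Lemma measurable_markdom : measurable (markdom T : set (Mk R)).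
Proof.
have -> : (markdom T : set (Mk R)) = (@pth R) @^-1` `]0, pi] `&` (@pph R) @^-1` `[0, 2 * pi[
   `&` (@pr R) @^-1` `[0, +oo[ `&` (@ps R) @^-1` `[0, T].
  apply/seteqP; split => p /=; rewrite /markdom /= !in_itv /= ?andbT.
    by move=> [].
  by move=> [[[]]].
by repeat apply: measurableI; rewrite -[X in measurable X]setTI;
  first [exact: measurable_pth|exact: measurable_pph|exact: measurable_pr|exact: measurable_ps].
Qed.

Lemma measurable_rho : measurable_fun [set: Mk R] rho.
Proof.
apply: measurable_funM; first by apply: measurable_indic; exact: measurable_markdom.
have mp : measurable_fun [set: Mk R] (fun p : Mk R => (ps p, pv p)).
  by apply: measurable_fun_pair; [exact: measurable_ps|exact: measurable_pv].
exact: (measurableT_comp measurable_mr mp).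
Qed.

Lemma intensityE A : measurable A -> intensity Q T f A = (\int[markM Q]_(p in A) (rho p)%:E)%E.
Proof.
move=> mA; have mr' : measurable_fun [set: Mk R] (fun p => (mr (ps p) (pv p))%:E).
  have mp : measurable_fun [set: Mk R] (fun p : Mk R => (ps p, pv p)).
    by apply: measurable_fun_pair; [exact: measurable_ps|exact: measurable_pv].
  by apply/measurable_EFinP; exact: (measurableT_comp measurable_mr mp).
rewrite /intensity.
transitivity (\int[markmeas Q]_(p in A `&` markdom T) (mr (ps p) (pv p))%:E)%E.
  by apply: eq_integral => p /set_mem [_ [_ _ _ sT]]; rewrite mrE.
rewrite integral_markM; last 2 first.
- by apply: measurableI => //; exact: measurable_markdom.
- exact: measurable_funTS.
rewrite integral_mkcondr; apply: eq_integral => p _.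
rewrite /rho patchE indicE; case: ifPn => pD; last by rewrite mul0r.
by rewrite mul1r.
Qed.

(** The exhausting sets, without their time coordinate: small angles, where Q may be infinite, and
    large r are cut off. Velocities need no cut, because [mr] has total mass at most 1. *)
Definition Bset (n : nat) : set (((V3 R * R) * R) * R) :=
  [set p | [/\ n.+1%:R^-1 <= p.1.1.2 <= pi, 0 <= p.1.2 < 2 * pi & 0 <= p.2 <= n.+1%:R]].

(** A bound on the intensity of [Bset] n per unit of time: the Q-mass of the angles kept, the length
    2 pi of the azimuths, and the length n + 1 of the range of r. *)
Definition Cset (n : nat) : R :=
  fine (Q [set x | n.+1%:R^-1 <= x]) * (2 * pi) * n.+1%:R.

Lemma measurable_Bset n : measurable (Bset n).
Proof.
have -> : Bset n = (fun p => p.1.1.2) @^-1` `[n.+1%:R^-1, pi] `&` (fun p => p.1.2) @^-1` `[0, 2 * pi[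
   `&` (fun p => p.2) @^-1` `[0, n.+1%:R].
  apply/seteqP; split => p /=; rewrite !in_itv /=.
    by move=> [].
  by move=> [[]].
repeat apply: measurableI; rewrite -[X in measurable X]setTI.
- by apply: (measurableT_comp measurable_snd (measurableT_comp measurable_fst measurable_fst)).
- by apply: (measurableT_comp measurable_snd measurable_fst).
- exact: measurable_snd.
Qed.

Hypothesis Qfin : forall eps : R, 0 < eps -> (Q [set x : R | (eps <= x)%R] < +oo)%E.

Lemma Cset_ge0 n : 0 <= Cset n.
Proof. by rewrite /Cset !mulr_ge0// ?fine_ge0// pi_ge0. Qed.

Lemma intensity_slab n s t : 0 <= s -> s <= t -> t <= T ->
  (intensity Q T f (Bset n `*` `]s, t]) <= (Cset n * (t - s))%:E)%E.
Proof.
move=> s0 st tT; rewrite intensityE; last by apply: measurableX; [exact: measurable_Bset|exact: measurable_itv].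
pose th : R -> \bar R := fun x => (\1_([set x | n.+1%:R^-1 <= x]) x)%:E.
pose ph : R -> \bar R := fun x => (\1_(`[0, 2 * pi]) x)%:E.
pose rr : R -> \bar R := fun x => (\1_(`[0, n.+1%:R]) x)%:E.
pose ss : R -> \bar R := fun x => (\1_(`]s, t]) x)%:E.
(* A majorant that factorises at every fixed time. The upper limit on theta and the mark domain are
   dropped, and the azimuth interval is closed. The velocity factor integrates to at most 1 and the
   three others give [Cset] n. *)
pose H (p : Mk R) : \bar R :=
  (((mr (ps p) (pv p))%:E * th (pth p) * ph (pph p) * rr (pr p)) * ss (ps p))%E.
have mi (A : set R) : measurable A -> measurable_fun [set: R] (fun x => (\1_A x)%:E : \bar R).
  by move=> mA; apply/measurable_EFinP/measurable_indic.
have mthS : measurable [set x : R | n.+1%:R^-1 <= x].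
  by rewrite (_ : [set x | _] = [set` `[n.+1%:R^-1, +oo[])//; apply/seteqP; split => x /=; rewrite in_itv /= andbT.
have mth : measurable_fun [set: R] th by exact: mi.
have mph : measurable_fun [set: R] ph by exact: mi.
have mrr : measurable_fun [set: R] rr by exact: mi.
have mss : measurable_fun [set: R] ss by exact: mi.
have th0 x : (0 <= th x)%E by rewrite lee_fin.
have ph0 x : (0 <= ph x)%E by rewrite lee_fin.
have rr0 x : (0 <= rr x)%E by rewrite lee_fin.
have ss0 x : (0 <= ss x)%E by rewrite lee_fin.
have mms : measurable_fun [set: Mk R] (fun p : Mk R => (mr (ps p) (pv p))%:E).
  have mp : measurable_fun [set: Mk R] (fun p : Mk R => (ps p, pv p)).
    by apply: measurable_fun_pair; [exact: measurable_ps|exact: measurable_pv].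
  by apply/measurable_EFinP; exact: (measurableT_comp measurable_mr mp).
have mH : measurable_fun [set: Mk R] H.
  repeat apply: emeasurable_funM => //.
  - exact: measurableT_comp mth measurable_pth.
  - exact: measurableT_comp mph measurable_pph.
  - exact: measurableT_comp mrr measurable_pr.
  - exact: measurableT_comp mss measurable_ps.
have H0 p : (0 <= H p)%E by rewrite /H !mule_ge0// lee_fin mr_ge0.
have mmr u : measurable_fun [set: V3 R] (fun v => (mr u v)%:E).
  by apply/measurable_EFinP; exact: (measurableT_comp measurable_mr (measurable_pair1 u)).
have iE (u : R) : (\int[markE Q]_e H (e, u) <= (Cset n)%:E * ss u)%E.
  have mru0 v : (0 <= (mr u v)%:E)%E by rewrite lee_fin mr_ge0.
  have mc1 : measurable_fun [set: V3 R * R] (fun q : V3 R * R => ((mr u q.1)%:E * th q.2)%E).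
    by apply: emeasurable_funM; [exact: (measurableT_comp (mmr u) measurable_fst)|exact: (measurableT_comp mth measurable_snd)].
  have mc2 : measurable_fun [set: V3 R * R * R] (fun q : V3 R * R * R => ((mr u q.1.1)%:E * th q.1.2 * ph q.2)%E).
    by apply: emeasurable_funM; [exact: (measurableT_comp mc1 measurable_fst)|exact: (measurableT_comp mph measurable_snd)].
  have mc3 : measurable_fun [set: V3 R * R * R * R] (fun q : V3 R * R * R * R => ((mr u q.1.1.1)%:E * th q.1.1.2 * ph q.1.2 * rr q.2)%E).
    by apply: emeasurable_funM; [exact: (measurableT_comp mc2 measurable_fst)|exact: (measurableT_comp mrr measurable_snd)].
  rewrite (_ : (\int[markE Q]_e H (e, u) = (\int[markE Q]_e ((mr u e.1.1.1)%:E * th e.1.1.2 * ph e.1.2 * rr e.2)) * ss u)%E); last first.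
    by rewrite -ge0_integralZr// => e _; rewrite !mule_ge0.
  apply: lee_wpmul2r => //.
  rewrite (integral_prod_mul (collM Q) _ mc2 mrr)//; last by move=> e; rewrite !mule_ge0.
  rewrite (integral_prod_mul _ _ mc1 mph)//; last by move=> e; rewrite !mule_ge0.
  rewrite (integral_prod_mul lebv Q (mmr u) mth)//.
  have Ith : (\int[Q]_x th x)%E = Q [set x | n.+1%:R^-1 <= x].
    by rewrite integral_indic// setIT.
  have Iph : (\int[@lebR R]_x ph x = (2 * pi)%:E)%E.
    rewrite integral_indic// setIT -[X in _ = X%:E]subr0; apply: lebR_itv.
    by rewrite mulr_ge0// pi_ge0.
  have Irr : (\int[@lebR R]_x rr x = (n.+1%:R)%:E)%E.
    by rewrite integral_indic// setIT -[X in _ = X%:E]subr0; exact: lebR_itv.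
  rewrite Ith Iph Irr /Cset (EFinM (fine _ * (2 * pi))) (EFinM (fine _)) fineK; last first.
    by rewrite ge0_fin_numE// Qfin.
  apply: lee_wpmul2r; first by rewrite lee_fin.
  apply: lee_wpmul2r; first by rewrite lee_fin mulr_ge0// pi_ge0.
  by rewrite -[leRHS]mul1e; apply: lee_wpmul2r => //; exact: mr_int.
apply: (@le_trans _ _ (\int[markM Q]_p H p)%E).
  rewrite integral_mkcond; apply: ge0_le_integral => //.
  - by move=> p _; apply: erestrict_ge0 => q _; rewrite lee_fin rho_ge0.
  - apply/(measurable_restrictT _ _).1.
      by apply: measurableX; [exact: measurable_Bset|exact: measurable_itv].
    by apply: measurable_funTS; apply/measurable_EFinP; exact: measurable_rho.
  - move=> p _; rewrite patchE; case: ifPn => [/set_mem pA|_]; last exact: H0.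
    have [[[/andP[a1 a2] /andP[b1 b2] /andP[c1 c2]]] /=] := pA.
    rewrite in_itv /= => /andP[d1 d2].
    rewrite /H /th /ph /rr /ss !indicE !mem_set ?mule1; last 4 first.
    + by rewrite /= in_itv /= /ps d1 d2.
    + by rewrite /= in_itv /= c1 c2.
    + by rewrite /= in_itv /= b1 ltW.
    + exact: a1.
    by rewrite lee_fin /rho indicE ler_piMl// ?mr_ge0//; case: (_ \in _).
rewrite (@fubini_tonelli2 _ _ _ _ R (markE Q) (@lebR R) H)//.
apply: (@le_trans _ _ (\int[@lebR R]_u ((Cset n)%:E * ss u))%E).
  apply: ge0_le_integral => //.
  - by move=> u _; apply: integral_ge0.
  - exact: (@measurable_fun_fubini_tonelli_G _ _ _ _ R (markE Q) H).
  - exact: measurable_funeM.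
  - by move=> u _; exact: iE.
rewrite ge0_integralZl//; last by rewrite lee_fin Cset_ge0.
rewrite integral_indic// setIT (EFinM (Cset n)); apply: lee_wpmul2l; first by rewrite lee_fin Cset_ge0.
by rewrite -(lebR_itv false false st).
Qed.
End intensity.

Lemma sigma_algebra_setI (T : Type) (G : set (set T)) (A B : set T) :
  sigma_algebra [set: T] G -> G A -> G B -> G (A `&` B).
Proof.
move=> [G0 GD GU] GA GB.
have -> : A `&` B = setT `\` \bigcup_n bigcup2 (setT `\` A) (setT `\` B) n.
  by rewrite bigcup2E !setTD setCU !setCK.
by apply: (GD); apply: GU => -[|[|n]] /=; [exact: GD|exact: GD|exact: G0].
Qed.

Lemma Gmeasb_measurable (R : realType) d (Omega : measurableType d) (h : Omega -> \bar R) :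
  Gmeasb measurable h -> measurable_fun setT h.
Proof.
move=> mh; apply: (measurability _ (ErealGenOInfty.measurableE R)) => // _ [_ [x ->] <-].
rewrite setTI (_ : _ @^-1` _ = ~` [set w | (h w <= x%:E)%E]); first exact: measurableC.
by apply/seteqP; split => w /=; rewrite in_itv /= andbT ltNge => /negP.
Qed.

Lemma Gmeas_gt (R : realType) d (Omega : measurableType d) (G : set (set Omega)) (h : Omega -> R) a :
  sigma_algebra [set: Omega] G -> Gmeas G h -> G [set w | a < h w].
Proof.
move=> [_ GD _] Gh; rewrite (_ : [set w | a < h w] = setT `\` [set w | h w <= a]).
  exact: GD.
rewrite setTD; apply/seteqP; split => w /=; rewrite ltNge => /negP; exact.
Qed.

(** * Measures given by a density *)

Section density.
Context d (T : measurableType d) (R : realType) (mu : {measure set T -> \bar R}) (g : T -> R).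
Hypothesis mg : measurable_fun [set: T] g.
Hypothesis g0 : forall x, 0 <= g x.
Let mg' : measurable_fun [set: T] (fun x => (g x)%:E) := (measurable_EFinP _ _).2 mg.
Let g0' x : (0 <= (g x)%:E)%E. Proof. by rewrite lee_fin. Qed.

(** The proofs of measurability and positivity are arguments of the definition, so that the measure
    structure attached below can be inferred from the term itself. *)
Definition mdens of measurable_fun [set: T] g & (forall x, 0 <= g x) :=
  fun A : set T => (\int[mu]_(x in A) (g x)%:E)%E.

Let mdens0 : mdens mg g0 set0 = 0%E. Proof. exact: integral_set0. Qed.
Let mdens_ge0 A : (0 <= mdens mg g0 A)%E.
Proof. by apply: integral_ge0 => x _; rewrite lee_fin. Qed.
Let mdens_add : semi_sigma_additive (mdens mg g0).
Proof.
move=> A mA tA mU; rewrite /mdens ge0_integral_bigcup//; last by apply: measurable_funTS; exact/measurable_EFinP.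
by apply: is_cvg_ereal_nneg_natsum_cond => n _ _; by apply: integral_ge0 => x _; rewrite lee_fin.
Qed.
HB.instance Definition _ := isMeasure.Build _ _ _ (mdens mg g0) mdens0 mdens_ge0 mdens_add.

Lemma integral_mdens h : measurable_fun [set: T] h -> (forall x, (0 <= h x)%E) ->
  (\int[mdens mg g0]_x h x = \int[mu]_x (h x * (g x)%:E))%E.
Proof.
apply: (@ge0_fun_ind _ _ _ (fun h => (\int[mdens mg g0]_x h x = \int[mu]_x (h x * (g x)%:E))%E)).
- move=> A mA; rewrite integral_indic// setIT /= /mdens integral_mkcond.
  apply: eq_integral => x _; rewrite patchE indicE; case: ifPn => _; by rewrite ?mul1e ?mul0e.
- move=> k f f' k0 mf mf' f0 f0' Ef Ef'.
  rewrite ge0_integralD//; last 2 first.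
  + by move=> x _; rewrite mule_ge0.
  + exact: measurable_funeM.
  rewrite ge0_integralZl_EFin// Ef Ef' -ge0_integralZl_EFin//; last 2 first.
  + by move=> x _; rewrite mule_ge0.
  + exact: emeasurable_funM.
  rewrite -ge0_integralD//; last 4 first.
  + by move=> x _; rewrite !mule_ge0.
  + by apply: measurable_funeM; exact: emeasurable_funM.
  + by move=> x _; rewrite !mule_ge0.
  + exact: emeasurable_funM.
  by apply: eq_integral => x _; rewrite muleDl ?muleA// ge0_adde_def// inE ?mule_ge0.
- move=> u f mu' u0 ndu uf Eu.
  have fE x : f x = limn (u ^~ x) by apply/esym/cvg_lim => //; exact: uf.
  have mf : measurable_fun [set: T] f.
    by apply: (emeasurable_fun_cvg u) => // x _; exact: uf.
  have c1 : (\int[mdens mg g0]_x u n x)%E @[n --> \oo] --> (\int[mdens mg g0]_x f x)%E.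
    rewrite (_ : f = fun x => limn (u ^~ x)); last exact/funext.
    exact: cvg_monotone_convergence.
  have c2 : (\int[mu]_x (u n x * (g x)%:E))%E @[n --> \oo] --> (\int[mu]_x (f x * (g x)%:E))%E.
    have fgE x : (f x * (g x)%:E = limn (fun n => u n x * (g x)%:E))%E.
      apply/esym/cvg_lim => //; by apply: cvgeZr => //; exact: uf.
    rewrite (_ : (fun x => (f x * (g x)%:E)%E) = fun x => limn (fun n => u n x * (g x)%:E)%E); last exact/funext.
    apply: cvg_monotone_convergence => //.
    + by move=> n; exact: emeasurable_funM.
    + by move=> n x _; rewrite mule_ge0.
    + by move=> x _ m n mn; apply: lee_wpmul2r => //; exact: ndu.
  have E : (fun n => \int[mdens mg g0]_x u n x)%E = (fun n => \int[mu]_x (u n x * (g x)%:E))%E by exact/funext.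
  by move: c1; rewrite E => c1; exact: (cvg_unique (@ereal_hausdorff R) c1 c2).
Qed.
End density.

(** * Compensation of predictable integrands *)

Section compensation.
Context {R : realType}.
Variables (Q : {sigma_finite_measure set R -> \bar R}) (T : R) (f : R -> V3 R -> V3 R -> R).
Context d (Omega : measurableType d) (P : probability Omega R).
Variables (F : R -> set (set Omega)) (N : Omega -> {measure set (Mk R) -> \bar R}).
Hypothesis T0 : 0 < T.
Hypothesis fprob : prob_densities T f.
Hypothesis fcont : cont_on T f.
Hypothesis Qfin : forall eps : R, 0 < eps -> (Q [set x : R | (eps <= x)%R] < +oo)%E.
Hypothesis hF : filtration T F.
Hypothesis hN : poisson_random_measure P F T (intensity Q T f) N.

Notation nu := (intensity Q T f).

Let mN A : measurable A -> measurable_fun [set: Omega] (fun w => N w A).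
Proof. by move=> mA; have [_ H _ _] := hN; exact/Gmeasb_measurable/H. Qed.

Let FT t : 0 <= t <= T -> F t [set: Omega].
Proof.
move=> tT; have [[F0 FD _] _] := hF.1 _ tT.
by have := FD _ F0; rewrite setD0.
Qed.

Let mslab (B : set (V3 R * R * R * R)) (s t : R) : measurable B -> measurable (B `*` `]s, t]).
Proof. by move=> mB; apply: measurableX => //; exact: measurable_itv. Qed.

Lemma intensity_le (A B : set (Mk R)) : measurable A -> measurable B -> A `<=` B -> (nu A <= nu B)%E.
Proof.
move=> mA mB AB; rewrite !intensityE//; apply: ge0_subset_integral => //.
- by apply: measurable_funTS; apply/measurable_EFinP; exact: measurable_rho.
- by move=> p _; rewrite lee_fin; exact: rho_ge0.
Qed.

Lemma intensity_slab_lty n (B : set (V3 R * R * R * R)) s t : measurable B ->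
  0 <= s -> s <= t -> t <= T -> (nu ((B `&` Bset n) `*` `]s, t]) < +oo)%E.
Proof.
move=> mB s0 st tT; apply: (@le_lt_trans _ _ (Cset Q n * (t - s))%:E); last by rewrite ltry.
apply: le_trans (intensity_slab T0 fprob fcont Qfin n s0 st tT).
apply: intensity_le.
- by apply: mslab; apply: measurableI => //; exact: measurable_Bset.
- by apply: mslab; exact: measurable_Bset.
- by move=> p [[_ ?] ?].
Qed.

Lemma intensity_ge0 A : measurable A -> (0 <= nu A)%E.
Proof.
by move=> mA; rewrite intensityE//; apply: integral_ge0 => p _; rewrite lee_fin; exact: rho_ge0.
Qed.

(** The independence clause for a single set. Intersecting with [Bset] n supplies the finite
    intensity which that clause demands. *)
Lemma prm_slab n (B : set (V3 R * R * R * R)) s t G k : measurable B ->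
  0 <= s -> s <= t -> t <= T -> F s G ->
  P (G `&` [set w | N w ((B `&` Bset n) `*` `]s, t]) = k%:R%:E]) =
  (P G * (poisson_p (fine (nu ((B `&` Bset n) `*` `]s, t]))) k)%:E)%E.
Proof.
move=> mB s0 st tT FG; have [_ _ _ H] := hN.
have mBn : measurable (B `&` Bset n) by apply: measurableI => //; exact: measurable_Bset.
have := H s t s0 st tT 1%N (fun=> B `&` Bset n) (fun=> k).
rewrite big_ord_recl big_ord0 mulr1 /= => <- //.
- congr (P (G `&` _)); apply/seteqP; split => w /=; first by move=> ? i _.
  by move/(_ 0%N isT).
- by move=> i _; split => //; exact: intensity_slab_lty.
- by move=> [|i] [|j].
Qed.

Definition Dset n : set (Mk R) := Bset n `*` `]0, T].

Lemma measurable_Dset n : measurable (Dset n).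
Proof. by apply: mslab; exact: measurable_Bset. Qed.

Lemma slab_Vint A w : measurable A -> (exists k : nat, N w A = k%:R%:E) \/ N w A = +oo%E.
Proof. by have [H _ _ _] := hN; exact: H. Qed.

Lemma prm_lty n (B : set (V3 R * R * R * R)) s t : measurable B ->
  0 <= s -> s <= t -> t <= T ->
  P [set w | N w ((B `&` Bset n) `*` `]s, t]) = +oo%E] = 0%E.
Proof.
move=> mB s0 st tT.
have mA : measurable ((B `&` Bset n) `*` `]s, t]).
  by apply: mslab; apply: measurableI => //; exact: measurable_Bset.
apply: (@poisson_count_lty _ _ _ P (fun w => N w ((B `&` Bset n) `*` `]s, t]))
  (fine (nu ((B `&` Bset n) `*` `]s, t])))).
- by rewrite fine_ge0// intensity_ge0.
- by move=> w; exact: slab_Vint.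
- exact: mN.
- move=> k; have sT : 0 <= s <= T by rewrite s0 (le_trans st).
  by have := prm_slab n k mB s0 st tT (FT sT); rewrite setTI probability_setT mul1e.
Qed.

Lemma prm_mean n (B : set (V3 R * R * R * R)) s t G : measurable B ->
  0 <= s -> s <= t -> t <= T -> F s G ->
  (\int[P]_(w in G) N w ((B `&` Bset n) `*` `]s, t]) = P G * nu ((B `&` Bset n) `*` `]s, t]))%E.
Proof.
move=> mB s0 st tT FG.
have mA : measurable ((B `&` Bset n) `*` `]s, t]).
  by apply: mslab; apply: measurableI => //; exact: measurable_Bset.
have sT : 0 <= s <= T by rewrite s0 (le_trans st).
have mG : measurable G by have [_ H] := hF.1 _ sT; exact: H.
rewrite -[nu _]fineK; last by rewrite ge0_fin_numE ?intensity_ge0// intensity_slab_lty.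
apply: poisson_count_mean => //.
- by rewrite fine_ge0// intensity_ge0.
- by move=> w; exact: slab_Vint.
- exact: mN.
- by move=> k; have := prm_slab n k mB s0 st tT (FT sT); rewrite setTI probability_setT mul1e.
- by move=> k; exact: prm_slab.
Qed.

Lemma prm_ge2 n s t : 0 <= s -> s <= t -> t <= T ->
  (P [set w | (2%:E <= N w (Bset n `*` `]s, t]))%E] <= ((Cset Q n * (t - s)) ^+ 2)%:E)%E.
Proof.
move=> s0 st tT.
have mA : measurable ((Bset n : set (V3 R * R * R * R)) `*` `]s, t]) by apply: mslab; exact: measurable_Bset.
have sT : 0 <= s <= T by rewrite s0 (le_trans st).
have nu0 : 0 <= fine (nu (Bset n `*` `]s, t])) by rewrite fine_ge0// intensity_ge0.
apply: (@le_trans _ _ ((fine (nu (Bset n `*` `]s, t])) ^+ 2)%:E)).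
  apply: (poisson_count_ge2 nu0) => //.
  - by move=> w; exact: slab_Vint.
  - exact: mN.
  - move=> k; have := prm_slab n k measurableT s0 st tT (FT sT).
    by rewrite !setTI probability_setT mul1e.
have C0 : 0 <= Cset Q n * (t - s) by apply: mulr_ge0; [exact: Cset_ge0|rewrite subr_ge0].
rewrite lee_fin; apply: lerXn2r; rewrite ?nnegrE//.
rewrite -lee_fin fineK; last first.
  rewrite ge0_fin_numE ?intensity_ge0//.
  by have := intensity_slab_lty n measurableT s0 st tT; rewrite setTI.
exact: intensity_slab.
Qed.

Definition Ogood : set Omega := [set w | forall n, (N w (Dset n) < +oo)%E].

Lemma measurable_Ogood : measurable Ogood.
Proof.
have -> : Ogood = \bigcap_n [set w | (N w (Dset n) < +oo)%E].
  by apply/seteqP; split => w /= H; [move=> n _; exact: H|move=> n; exact: H].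
apply: bigcap_measurable => // n _.
have := @emeasurable_fun_infty_o _ _ R setT _ measurableT (mN (measurable_Dset n)) +oo%E.
by rewrite setTI.
Qed.

Lemma Ogood_ae : {ae P, forall w, Ogood w}.
Proof.
have H n : {ae P, forall w, (N w (Dset n) < +oo)%E}.
  have := prm_lty n measurableT (lexx 0) (ltW T0) (lexx T); rewrite setTI => PD.
  exists [set w | N w (Dset n) = +oo%E]; split => //.
    have := mN (measurable_Dset n) measurableT (emeasurable_set1 +oo%E).
    by rewrite setTI.
  move=> w /= /negP; rewrite -leNgt leye_eq => /eqP; exact.
exact: ae_foralln.
Qed.

(** The comparison of kernels asks for finite measures at every sample point, whereas N is finite on
    all the [Dset] n only almost surely. Off the event [Ogood] it is replaced by the zero measure,
    which changes no expectation. *)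
Definition N0 (w : Omega) : {measure set (Mk R) -> \bar R} :=
  if `[< Ogood w >] then N w else mzero.

Lemma N0E w : Ogood w -> N0 w = N w.
Proof. by move=> Ow; rewrite /N0 asboolT. Qed.

Lemma measurable_N0 A : measurable A -> measurable_fun [set: Omega] (fun w => N0 w A).
Proof.
move=> mA; rewrite (_ : (fun w => _) = (fun w => if `[< Ogood w >] then N w A else 0%E)); last first.
  by apply/funext => w; rewrite /N0; case: asboolP.
apply: measurable_fun_ifT => //; last exact: mN.
apply: (measurable_fun_bool true); rewrite setTI.
rewrite (_ : _ @^-1` _ = Ogood); first exact: measurable_Ogood.
by apply/seteqP; split => w /=; [move/asboolP|move=> Ow; apply/asboolP].
Qed.

Lemma N0_lty w n : (N0 w (Dset n) < +oo)%E.
Proof. by rewrite /N0; case: asboolP => Ow /=; [exact: Ow|rewrite /mzero ltry]. Qed.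

Lemma integral_N0 G A : measurable G -> measurable A -> (\int[P]_(w in G) N0 w A = \int[P]_(w in G) N w A)%E.
Proof.
move=> mG mA; apply: ge0_ae_eq_integral => //.
- by apply: measurable_funTS; exact: measurable_N0.
- by apply: measurable_funTS; exact: mN.
- by apply: filterS Ogood_ae => w Ow _; rewrite N0E.
Qed.

(** The generators of the predictable sigma-algebra on Omega times the marks: the event must be
    known at the left end of the time interval. The full space is added in [pred_gen] because the
    pi-lambda argument needs it and the rectangles reach only times in ]0, T]. *)
Definition pred_rect : set (set (Omega * Mk R)) :=
  [set A | exists s t O B, [/\ 0 <= s <= T, t <= T, F s O, measurable B & A = O `*` (B `*` `]s, t])]].

Definition pred_gen : set (set (Omega * Mk R)) := [set A | A = setT \/ pred_rect A].

Let Fsetm s O : 0 <= s <= T -> F s O -> measurable O.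
Proof. by move=> sT; have [_ H] := hF.1 _ sT; exact: H. Qed.

(** The intersection of two rectangles starts at the later of the two left ends, and the filtration
    being increasing, both events are known there. *)
Lemma pred_gen_setI : setI_closed pred_gen.
Proof.
move=> A B [->|[s [t [U [C [sT tT FO mC AE]]]]]]; first by rewrite setTI.
move=> [->|[s' [t' [U' [C' [sT' tT' FO' mC' BE]]]]]]; first by rewrite setIT; right; exists s, t, U, C.
right; exists (Num.max s s'), (Num.min t t'), (U `&` U'), (C `&` C'); split.
- move: sT sT' => /andP[a b] /andP[a' b'].
  by rewrite le_max a /= ge_max b b'.
- by rewrite ge_min tT.
- have mT : 0 <= Num.max s s' <= T.
    by move: sT sT' => /andP[a b] /andP[a' b']; rewrite le_max a /= ge_max b b'.
  have [sF _] := hF.1 _ mT.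
  have FI (X Y : set Omega) : F (Num.max s s') X -> F (Num.max s s') Y -> F (Num.max s s') (X `&` Y).
    exact: sigma_algebra_setI.
  apply: FI.
  + apply: (hF.2 s) FO; first by case/andP: sT.
      by rewrite le_max lexx.
    by case/andP: mT.
  + apply: (hF.2 s') FO'; first by case/andP: sT'.
      by rewrite le_max lexx orbT.
    by case/andP: mT.
- exact: measurableI.
- rewrite AE BE; apply/seteqP; split => -[w [e u]] /=; rewrite !in_itv /= gt_max le_min.
    by move=> [[Ow [Ce /andP[a b]]] [Ow' [Ce' /andP[a' b']]]]; rewrite a b a' b'.
  by move=> [[Ow Ow'] [[Ce Ce'] /andP[/andP[a a'] /andP[b b']]]]; rewrite a b a' b'.
Qed.

Lemma pred_gen_measurable A : pred_gen A -> measurable A.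
Proof.
move=> [->|[s [t [U [C [sT tT FO mC ->]]]]]]; first exact: measurableT.
by apply: measurableX; [exact: Fsetm FO|exact: mslab].
Qed.

Let one n : Mk R -> R := \1_(Dset n).
Let mone n : measurable_fun [set: Mk R] (one n).
Proof. by apply: measurable_indic; exact: measurable_Dset. Qed.
Let one0 n p : 0 <= one n p. Proof. by []. Qed.

Let rho' n (p : Mk R) : R := \1_(Dset n) p * rho T f p.
Let mrho' n : measurable_fun [set: Mk R] (rho' n).
Proof. by apply: measurable_funM; [exact: mone|exact: measurable_rho]. Qed.
Let rho'0 n p : 0 <= rho' n p. Proof. by rewrite mulr_ge0// rho_ge0. Qed.

(** The random measure and its deterministic compensator, both cut down to [Dset] n by a density so
    that they become finite. *)
Let k1 n (w : Omega) : {measure set (Mk R) -> \bar R} := mdens (N0 w) (mone n) (one0 n).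
Let k2 n (w : Omega) : {measure set (Mk R) -> \bar R} := mdens (markM Q) (mrho' n) (rho'0 n).

Let k1E n w A : measurable A -> k1 n w A = N0 w (A `&` Dset n).
Proof.
move=> mA; rewrite /k1 /= /mdens integral_indic//; last exact: measurable_Dset.
by rewrite setIC.
Qed.

Let k2E n w A : measurable A -> k2 n w A = nu (A `&` Dset n).
Proof.
move=> mA; rewrite /k2 /= /mdens intensityE//; last by apply: measurableI => //; exact: measurable_Dset.
rewrite [RHS]integral_mkcondr; apply: eq_integral => p _.
by rewrite patchE /rho' indicE; case: ifPn => _; rewrite ?mul1r ?mul0r.
Qed.

Let rectD n (B : set (V3 R * R * R * R)) (s t : R) : 0 <= s -> t <= T ->
  (B `*` `]s, t]) `&` Dset n = (B `&` Bset n) `*` `]s, t].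
Proof.
move=> s0 tT; apply/seteqP; split => -[e u] /=; rewrite !in_itv /=.
  by move=> [[Be /andP[a b]] [Bn _]]; rewrite a b.
move=> [[Be Bn] /andP[a b]]; rewrite a b; split => //; split => //=.
by rewrite in_itv /= (le_lt_trans s0 a) (le_trans b tT).
Qed.

Let kfin1 n w : (k1 n w setT < +oo)%E.
Proof. by rewrite k1E// setTI N0_lty. Qed.

Let nuD n : (nu (Dset n) < +oo)%E.
Proof.
by have := intensity_slab_lty n measurableT (lexx 0) (ltW T0) (lexx T); rewrite setTI.
Qed.

Let kfin2 n w : (k2 n w setT < +oo)%E.
Proof. by rewrite k2E// setTI nuD. Qed.

Let xrect (k : {measure set (Mk R) -> \bar R}) (U : set Omega) (C : set (Mk R)) w :
  k (xsection (U `*` C) w) = ((\1_U w)%:E * k C)%E.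
Proof.
rewrite indicE; case: (boolP (w \in U)) => wU; first by rewrite in_xsectionX// mul1e.
by rewrite notin_xsectionX// measure0 mul0e.
Qed.

Let xsT w : xsection [set: Omega * Mk R] w = setT.
Proof. by rewrite xsectionE preimage_setT. Qed.

Let G1 n A : pred_gen A -> measurable_fun [set: Omega] (fun w => k1 n w (xsection A w)).
Proof.
move=> [->|[s [t [U [C [sT tT FU mC ->]]]]]].
  under eq_fun do rewrite xsT k1E// setTI.
  by apply: measurable_N0; exact: measurable_Dset.
have mU := Fsetm sT FU.
have mS := mslab s t mC.
under eq_fun do rewrite xrect (k1E _ _ mS).
apply: emeasurable_funM; first exact/measurable_EFinP/measurable_indic.
by apply: measurable_N0; apply: measurableI; [exact: mslab|exact: measurable_Dset].
Qed.

Let G2 n A : pred_gen A -> measurable_fun [set: Omega] (fun w => k2 n w (xsection A w)).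
Proof.
move=> [->|[s [t [U [C [sT tT FU mC ->]]]]]].
  by under eq_fun do rewrite xsT; exact: measurable_cst.
have mU := Fsetm sT FU.
under eq_fun do rewrite xrect.
apply: emeasurable_funM; first exact/measurable_EFinP/measurable_indic.
exact: measurable_cst.
Qed.

Let GEr n s t U (C : set (V3 R * R * R * R)) : 0 <= s <= T -> t <= T -> F s U -> measurable C ->
  (\int[P]_w k1 n w (xsection (U `*` (C `*` `]s, t])) w) =
   \int[P]_w k2 n w (xsection (U `*` (C `*` `]s, t])) w))%E.
Proof.
move=> sT tT FU mC; have mU := Fsetm sT FU.
have mS := mslab s t mC; have mSD : measurable ((C `*` `]s, t]) `&` Dset n).
  by apply: measurableI => //; exact: measurable_Dset.
under eq_integral do rewrite xrect (k1E _ _ mS).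
under [in RHS]eq_integral do rewrite xrect (k2E _ _ mS).
rewrite ge0_integralZr ?intensity_ge0//; last exact/measurable_EFinP/measurable_indic.
rewrite integral_indic// setIT.
transitivity (\int[P]_(w in U) N0 w ((C `*` `]s, t]) `&` Dset n))%E.
  rewrite [RHS]integral_mkcond; apply: eq_integral => w _; rewrite patchE indicE.
  by case: ifPn => _; rewrite ?mul1e ?mul0e.
rewrite integral_N0// rectD//; last by case/andP: sT.
(* A rectangle may have t < s, in which case its time interval is empty and both sides vanish. *)
case: (leP s t) => st; first by apply: prm_mean => //; case/andP: sT.
rewrite (_ : `]s, t]%classic = set0) ?setX0; last first.
  by apply/seteqP; split => u //=; rewrite in_itv /= => /andP[a b]; lra.
rewrite intensityE// integral_set0 mule0.
by apply: integral0_eq => w _; rewrite measure0.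
Qed.

Let GE n A : pred_gen A ->
  (\int[P]_w k1 n w (xsection A w) = \int[P]_w k2 n w (xsection A w))%E.
Proof.
move=> [->|[s [t [U [C [sT tT FU mC ->]]]]]]; last exact: GEr.
(* For the full space: both kernels are carried by [Dset] n, which lies in times ]0, T], so the
   rectangle with all events, all marks and the interval ]0, T] has the same measure. *)
have T00 : (0 : R) <= 0 <= T by rewrite lexx ltW.
have := GEr n T00 (lexx T) (FT T00) measurableT.
have E (k : {measure set (Mk R) -> \bar R}) (w : Omega) :
    (forall A, measurable A -> k A = k (A `&` Dset n)) ->
    k (xsection ([set: Omega] `*` ([set: V3 R * R * R * R] `*` `]0, T])) w) = k (xsection [set: Omega * Mk R] w).
  move=> kD; rewrite xrect indicE mem_set// mul1e xsT kD; last exact: mslab.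
  rewrite [RHS]kD// setTI; congr (k _); apply/setIidr => p [_ pT]; by split.
have mD := measurable_Dset n.
rewrite (eq_integral (fun w => k1 n w (xsection [set: Omega * Mk R] w))); last first.
  move=> w _; apply: E => B mB.
  by rewrite (k1E n w mB) (k1E n w (measurableI _ _ mB mD)) -setIA setIid.
rewrite [X in _ = X -> _](eq_integral (fun w => k2 n w (xsection [set: Omega * Mk R] w))); last first.
  move=> w _; apply: E => B mB.
  by rewrite (k2E n w mB) (k2E n w (measurableI _ _ mB mD)) -setIA setIid.
by [].
Qed.

Let finP n : (\int[P]_w k1 n w setT < +oo)%E.
Proof.
have := GE n (or_introl erefl).
under eq_integral do rewrite xsT.
under [in RHS]eq_integral do rewrite xsT k2E// setTI.
move=> ->; have -> : (\int[P]__ nu (Dset n) = nu (Dset n) * P setT)%E by exact: integral_cst.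
by rewrite [P setT]probability_setT mule1; exact: nuD.
Qed.

Let k1int n w (g : Mk R -> \bar R) : measurable_fun setT g -> (forall p, (0 <= g p)%E) ->
  (\int[k1 n w]_p g p = \int[N0 w]_(p in Dset n) g p)%E.
Proof.
move=> mg g0; rewrite (integral_mdens _ _ _ mg g0) [RHS]integral_mkcond.
by apply: eq_integral => p _; rewrite patchE /one indicE; case: ifPn => _; rewrite ?mule1 ?mule0.
Qed.

Let k2int n w (g : Mk R -> \bar R) : measurable_fun setT g -> (forall p, (0 <= g p)%E) ->
  (\int[k2 n w]_p g p = \int[markM Q]_(p in Dset n) (g p * (rho T f p)%:E))%E.
Proof.
move=> mg g0; rewrite (integral_mdens _ _ _ mg g0) [RHS]integral_mkcond.
apply: eq_integral => p _; rewrite patchE /rho' indicE; case: ifPn => _.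
  by rewrite mul1r.
by rewrite mul0r mule0.
Qed.

Lemma compensation_n n (h : g_sigma_algebraType pred_gen -> \bar R) :
  measurable_fun [set: g_sigma_algebraType pred_gen] h -> (forall x, (0 <= h x)%E) ->
  [/\ measurable_fun [set: Omega * Mk R] (h : Omega * Mk R -> \bar R),
   measurable_fun [set: Omega] (fun w => \int[N0 w]_(p in Dset n) h (w, p))%E,
   measurable_fun [set: Omega] (fun w => \int[markM Q]_(p in Dset n) (h (w, p) * (rho T f p)%:E))%E &
   (\int[P]_w \int[N0 w]_(p in Dset n) h (w, p) =
    \int[P]_w \int[markM Q]_(p in Dset n) (h (w, p) * (rho T f p)%:E))%E].
Proof.
move=> mh h0.
have [mh' a b c] := kernel_agree (kfin1 n) (kfin2 n) pred_gen_setI (or_introl erefl)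
  pred_gen_measurable (@G1 n) (@G2 n) (@GE n) (finP n) mh h0.
have mhw w : measurable_fun [set: Mk R] (fun p => h (w, p)) by exact: measurableT_comp mh' _.
pose g w (p : Mk R) := h (w, p).
have E1 : (fun w => \int[k1 n w]_p g w p)%E = (fun w => \int[N0 w]_(p in Dset n) g w p)%E.
  by apply/funext => w; apply: k1int; [exact: mhw|move=> p; exact: h0].
have E2 : (fun w => \int[k2 n w]_p g w p)%E =
    (fun w => \int[markM Q]_(p in Dset n) (g w p * (rho T f p)%:E))%E.
  by apply/funext => w; apply: k2int; [exact: mhw|move=> p; exact: h0].
split; first exact: mh'.
- exact: (eq_ind _ (fun k => measurable_fun [set: Omega] k) a _ E1).
- exact: (eq_ind _ (fun k => measurable_fun [set: Omega] k) b _ E2).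
- have := c; rewrite -/(integral P setT (fun w => \int[k1 n w]_p g w p)%E) -/(integral P setT (fun w => \int[k2 n w]_p g w p)%E).
  by rewrite E1 E2.
Qed.

Lemma bigcup_Dset : \bigcup_n Dset n =
  [set p : Mk R | [/\ 0 < pth p <= pi, 0 <= pph p < 2 * pi, 0 <= pr p & 0 < ps p <= T]].
Proof.
apply/seteqP; split => [p [n _ [[/andP[a b] c /andP[e e']] /=]]|p /=].
  rewrite in_itv /= => ST; split => //.
  by rewrite /pth b andbT; apply: lt_le_trans a.
move=> [/andP[a b] c e g].
(* With this choice n + 1 exceeds both 1 / theta and r, so the mark has escaped both cut-offs. *)
pose n := Num.truncn (Num.max (pth p)^-1 (pr p)).
exists n => //; split; last by rewrite /= in_itv.
have ngt : Num.max (pth p)^-1 (pr p) < n.+1%:R by exact: truncnS_gt.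
split => //.
  rewrite b andbT -[leRHS]invrK lef_pV2 ?posrE ?invr_gt0//.
  by apply: ltW; apply: le_lt_trans ngt; rewrite le_max lexx.
by rewrite e /=; apply: ltW; apply: le_lt_trans ngt; rewrite le_max lexx orbT.
Qed.

Lemma nondecreasing_Dset : nondecreasing_seq Dset.
Proof.
move=> m n mn; apply/subsetPset => p [[/andP[a b] c /andP[e g]] i]; split => //; split => //.
  by rewrite b andbT (le_trans _ a)// lef_pV2 ?posrE// ler_nat.
by rewrite e /= (le_trans g)// ler_nat.
Qed.

Definition Dall : set (Mk R) :=
  [set p : Mk R | [/\ 0 < pth p <= pi, 0 <= pph p < 2 * pi, 0 <= pr p & 0 < ps p <= T]].

(** For a nonnegative integrand both sides are increasing limits of their restrictions to [Dset] n.
    No integrability is assumed and the common value may be infinite, which is what allows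
    finiteness to be deduced from the compensated side later. *)
Theorem compensation (h : g_sigma_algebraType pred_gen -> \bar R) :
  measurable_fun [set: g_sigma_algebraType pred_gen] h -> (forall x, (0 <= h x)%E) ->
  [/\ measurable_fun [set: Omega * Mk R] (h : Omega * Mk R -> \bar R),
   measurable_fun [set: Omega] (fun w => \int[N0 w]_(p in Dall) h (w, p))%E &
   (\int[P]_w \int[N0 w]_(p in Dall) h (w, p) =
    \int[P]_w \int[markM Q]_(p in Dall) (h (w, p) * (rho T f p)%:E))%E].
Proof.
move=> mh h0; have [mh' _ _ _] := compensation_n 0 mh h0.
have mhw w : measurable_fun [set: Mk R] (fun p => h (w, p)) by exact: measurableT_comp mh' _.
have mhr w : measurable_fun [set: Mk R] (fun p => h (w, p) * (rho T f p)%:E)%E.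
  by apply: emeasurable_funM => //; apply/measurable_EFinP; exact: measurable_rho.
have hr0 w p : (0 <= h (w, p) * (rho T f p)%:E)%E by rewrite mule_ge0// lee_fin rho_ge0.
have c1 w : (\int[N0 w]_(p in Dset n) h (w, p))%E @[n --> \oo] --> (\int[N0 w]_(p in Dall) h (w, p))%E.
  rewrite /Dall -bigcup_Dset; apply: ge0_nondecreasing_set_cvg_integral => //.
  - exact: nondecreasing_Dset.
  - exact: measurable_Dset.
  - by move=> n; exact: measurable_funTS.
have c2 w : (\int[markM Q]_(p in Dset n) (h (w, p) * (rho T f p)%:E))%E @[n --> \oo] -->
    (\int[markM Q]_(p in Dall) (h (w, p) * (rho T f p)%:E))%E.
  rewrite /Dall -bigcup_Dset; apply: ge0_nondecreasing_set_cvg_integral => //.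
  - exact: nondecreasing_Dset.
  - exact: measurable_Dset.
  - by move=> n; exact: measurable_funTS.
have m1 n : measurable_fun [set: Omega] (fun w => \int[N0 w]_(p in Dset n) h (w, p))%E.
  by have [] := compensation_n n mh h0.
have m2 n : measurable_fun [set: Omega] (fun w => \int[markM Q]_(p in Dset n) (h (w, p) * (rho T f p)%:E))%E.
  by have [] := compensation_n n mh h0.
split => //.
  by apply: (emeasurable_fun_cvg (fun n w => \int[N0 w]_(p in Dset n) h (w, p))%E) => // w _; exact: c1.
have C1 : (\int[P]_w \int[N0 w]_(p in Dset n) h (w, p))%E @[n --> \oo] -->
    (\int[P]_w \int[N0 w]_(p in Dall) h (w, p))%E.
  rewrite (_ : (fun w => \int[N0 w]_(p in Dall) h (w, p))%E = (fun w => limn (fun n => \int[N0 w]_(p in Dset n) h (w, p))%E)); last first.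
    by apply/funext => w; apply/esym/cvg_lim => //; exact: c1.
  apply: cvg_monotone_convergence => //; first by move=> n w _; exact: integral_ge0.
  move=> w _ m n mn; apply: ge0_subset_integral => //; try exact: measurable_Dset.
  - exact: measurable_funTS.
  - exact/subsetPset/nondecreasing_Dset.
have C2 : (\int[P]_w \int[markM Q]_(p in Dset n) (h (w, p) * (rho T f p)%:E))%E @[n --> \oo] -->
    (\int[P]_w \int[markM Q]_(p in Dall) (h (w, p) * (rho T f p)%:E))%E.
  rewrite (_ : (fun w => \int[markM Q]_(p in Dall) (h (w, p) * (rho T f p)%:E))%E =
     (fun w => limn (fun n => \int[markM Q]_(p in Dset n) (h (w, p) * (rho T f p)%:E))%E)); last first.
    by apply/funext => w; apply/esym/cvg_lim => //; exact: c2.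
  apply: cvg_monotone_convergence => //; first by move=> n w _; exact: integral_ge0.
  move=> w _ m n mn; apply: ge0_subset_integral => //; try exact: measurable_Dset.
  - exact: measurable_funTS.
  - exact/subsetPset/nondecreasing_Dset.
have E : (fun n => \int[P]_w \int[markM Q]_(p in Dset n) (h (w, p) * (rho T f p)%:E))%E =
  (fun n => \int[P]_w \int[N0 w]_(p in Dset n) h (w, p))%E.
  by apply/funext => n; have [] := compensation_n n mh h0.
by move: C2; rewrite E => C2; exact: (cvg_unique (@ereal_hausdorff R) C1 C2).
Qed.

End compensation.

Lemma measurable_fun_pairD d d1 d2 (T : measurableType d) (T1 : measurableType d1)
  (T2 : measurableType d2) (D : set T) (f : T -> T1) (g : T -> T2) :
  measurable_fun D f -> measurable_fun D g -> measurable_fun D (fun x => (f x, g x)).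
Proof.
move=> mf mg mD; move: (mD).
apply: (measurability (preimage_set_system setT fst measurable `|` preimage_set_system setT snd measurable)) => //.
move=> _ [_ [[A mA <-]|[A mA <-]] <-]; rewrite setTI.
  exact: mf.
exact: mg.
Qed.

(** * Predictability of left limits *)

Section predictable.
Context {R : realType}.
Variable (T : R).
Context d (Omega : measurableType d).
Variables (F : R -> set (set Omega)).
Hypothesis T0 : 0 < T.
Hypothesis hF : filtration T F.

Notation PT := (g_sigma_algebraType (pred_gen T F)).
(** The region reached by the predictable rectangles; measurability of left limits and of the mark
    is claimed only there. *)
Definition Upos : set PT := [set u : Omega * Mk R | 0 < ps u.2 <= T].

Lemma measurable_predrect s t (U : set Omega) (B : set (V3 R * R * R * R)) (A : set PT) :
  0 <= s <= T -> t <= T -> F s U -> measurable B -> A = U `*` (B `*` `]s, t]) -> measurable A.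
Proof. by move=> sT tT FU mB AE; apply: sub_sigma_algebra; right; exists s, t, U, B. Qed.

Let FT t : 0 <= t <= T -> F t [set: Omega].
Proof.
move=> tT; have [[F0 FD _] _] := hF.1 _ tT.
by have := FD _ F0; rewrite setD0.
Qed.

Let T00 : (0 : R) <= 0 <= T. Proof. by rewrite lexx ltW. Qed.

Lemma measurable_Upos : measurable Upos.
Proof.
apply: (measurable_predrect T00 (lexx T) (FT T00) measurableT).
apply/seteqP; split => -[w [e u]] /=; rewrite in_itv /=.
  by move=> H.
by move=> [_ [_ H]].
Qed.

Lemma measurable_pred_mark : measurable_fun Upos (snd : PT -> Mk R).
Proof.
have -> : (snd : PT -> Mk R) = (fun u => (u.2.1, u.2.2)) by apply/funext => -[w []].
apply: measurable_fun_pairD => /=.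
  move=> _ B mB; apply: (measurable_predrect T00 (lexx T) (FT T00) mB).
  apply/seteqP; split => -[w [e u]] /=; rewrite in_itv /=.
    by move=> [].
  by move=> [_ []].
apply: (measurability _ (RGenOInfty.measurableE R)) => // _ [_ [x ->] <-].
case: (leP (Num.max 0 x) T) => xT.
  have xT' : 0 <= Num.max 0 x <= T by rewrite xT andbT le_max lexx.
  apply: (measurable_predrect xT' (lexx T) (FT xT') measurableT).
  apply/seteqP; split => -[w [e u]] /=; rewrite !in_itv /= andbT gt_max /Upos /ps /=.
    by move=> [/andP[-> ->] ->].
  by move=> [_ [_ /andP[/andP[-> ->] ->]]].
rewrite (_ : _ `&` _ = set0); first exact: measurable0.
apply/seteqP; split => -[w [e u]] //=; rewrite !in_itv /= andbT /Upos /ps /=.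
move=> [/andP[a b] c]; move: xT; rewrite lt_max => /orP[|]; lra.
Qed.

(** The left limit at s is the limit of the values sampled at the left ends of the cells of s. A
    value sampled at time x is used only at times after x, and an event of F_x times ]x, T] is a
    predictable rectangle. *)
Lemma measurable_leftlim_coord (A : R -> Omega -> R) :
  (forall t, 0 <= t <= T -> Gmeas (F t) (A t)) ->
  (forall w t, 0 < t <= T -> cvg (A ^~ w @ t^'-)) ->
  measurable_fun Upos (fun u : PT => lim (A ^~ u.1 @ (ps u.2)^'-)).
Proof.
move=> mA cA; apply: (measurable_restrictT (fun u : PT => lim (A ^~ u.1 @ (ps u.2)^'-)) measurable_Upos).2.
pose V x : set PT := [set u : Omega * Mk R | x < ps u.2 <= T].
pose g : PT -> R := (fun u => ps u.2) \_ Upos.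
(* The sampled value is switched on strictly after x. For x outside [0, T] nothing is known about A
   x, and the constant 0 takes its place. *)
pose f x : PT -> R := if 0 <= x <= T then (fun u : PT => A x u.1) \_ (V x) else cst 0.
have mg : measurable_fun [set: PT] g.
  apply: (measurable_restrictT (fun u : PT => ps u.2) measurable_Upos).1.
  exact: (measurableT_comp (@measurable_ps R) measurable_pred_mark).
apply: (measurable_fun_gridL T0 mg (f := f)) => [x|[w p]].
  rewrite /f; case: ifPn => xT; last exact: measurable_cst.
  have mV : measurable (V x).
    apply: (measurable_predrect xT (lexx T) (FT xT) measurableT).
    apply/seteqP; split => -[w [e u]] /=; rewrite in_itv /=.
      by move=> H.
    by move=> [_ [_ H]].
  apply: (measurable_restrictT (fun u : PT => A x u.1) mV).1.
  apply: (measurability _ (RGenOInfty.measurableE R)) => // _ [_ [a ->] <-].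
  have [sF _] := hF.1 _ xT.
  apply: (measurable_predrect xT (lexx T) (Gmeas_gt a sF (mA _ xT)) measurableT).
  apply/seteqP; split => -[w [e u]] /=; rewrite !in_itv /= andbT.
    by move=> [H ?].
  by move=> [? [_ H]].
rewrite patchE; case: ifPn => [/set_mem/= pT|pU].
  have E n : f (gridL T n (g (w, p))) (w, p) = A (gridL T n (ps p)) w.
    rewrite /g patchE mem_set//= /f.
    have l := gridL_lt n (ps p) T0.
    (* A positive time lies in a cell of nonnegative index, so the sampled time never leaves [0, T]
       and the default value of f is not met. *)
    have l0 : 0 <= gridL T n (ps p).
      rewrite /gridL mulr_ge0//; last exact/ltW/step_gt0.
      rewrite ler0z /cell subr_ge0 -gtz0_ge1 ceil_gt0 divr_gt0 ?step_gt0//.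
      by case/andP: pT.
    have lT : gridL T n (ps p) <= T by apply: ltW; apply: lt_le_trans l _; case/andP: pT.
    rewrite l0 lT /= patchE mem_set// /V /= l; by case/andP: pT.
  under eq_fun do rewrite E.
  apply: (@cvg_trans _ (A ^~ w @ (ps p)^'-)); last exact: cA.
  apply: (@cvg_comp _ _ _ (fun n => gridL T n (ps p)) (A ^~ w)); first exact: gridL_cvg.
  exact: cvg_id.
have g0 : g (w, p) = 0 by rewrite /g patchE (negbTE pU).
rewrite g0; rewrite (_ : (fun n => _) = cst 0); first exact: cvg_cst.
apply/funext => n; rewrite /f; case: ifPn => // /andP[a b].
by have := gridL_lt n 0 T0; lra.
Qed.

Section leftlims.
Variables X Z : R -> Omega -> V3 R.
Hypothesis aX : adapted3 F T X.
Hypothesis aZ : adapted3 F T Z.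
Hypothesis cXZ : forall w, cadlag_on T (fun t => (X t w, Z t w)).

Lemma measurable_leftlim (Y : R -> Omega -> V3 R) : adapted3 F T Y ->
  (forall w t, 0 < t <= T -> exists l : V3 R, Y ^~ w @ t^'- --> l) ->
  measurable_fun Upos (fun u : PT => leftlim (Y ^~ u.1) (ps u.2)).
Proof.
move=> aY cY.
have aY' t (i : 'I_3) : 0 <= t <= T -> Gmeas (F t) (fun w => coord3 (Y t w) i) by move=> tT; exact: aY.
rewrite /leftlim; apply: measurable_fun_pairD; first apply: measurable_fun_pairD.
- apply: (measurable_leftlim_coord (A := fun s w => (Y s w).1.1)).
    by move=> t tT; exact: (aY' t ord0).
  move=> w t tT; have [l lY] := cY w t tT; apply/cvg_ex; exists l.1.1.
  by apply: cvg_comp; [apply: cvg_comp lY _; exact: cvg_fst|exact: cvg_fst].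
- apply: (measurable_leftlim_coord (A := fun s w => (Y s w).1.2)).
    by move=> t tT; exact: (aY' t (lift ord0 ord0)).
  move=> w t tT; have [l lY] := cY w t tT; apply/cvg_ex; exists l.1.2.
  by apply: cvg_comp; [apply: cvg_comp lY _; exact: cvg_fst|exact: cvg_snd].
- apply: (measurable_leftlim_coord (A := fun s w => (Y s w).2)).
    by move=> t tT; exact: (aY' t ord_max).
  move=> w t tT; have [l lY] := cY w t tT; apply/cvg_ex; exists l.2.
  by apply: cvg_comp lY _; exact: cvg_snd.
Qed.

Lemma measurable_predictable d' (S : measurableType d') (H : (V3 R * V3 R) * Mk R -> S) : measurable_fun setT H ->
  measurable_fun Upos (fun u : PT =>
    H ((leftlim (X ^~ u.1) (ps u.2), leftlim (Z ^~ u.1) (ps u.2)), u.2)).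
Proof.
move=> mH; apply: (measurableT_comp mH).
apply: measurable_fun_pairD; last exact: measurable_pred_mark.
apply: measurable_fun_pairD; apply: measurable_leftlim => // w t tT;
  have [l lXZ] := (cXZ w).2 _ tT; [exists l.1|exists l.2].
  by apply: (cvg_comp (fun t => (X t w, Z t w)) fst lXZ); exact: cvg_fst.
by apply: (cvg_comp (fun t => (X t w, Z t w)) snd lXZ); exact: cvg_snd.
Qed.
End leftlims.
End predictable.

(** * Test functions *)

Section smooth.
Context {R : realType}.
Notation W := (V3 R * V3 R)%type.

(** Only directional derivatives are available, so the mean value theorem is applied to the real
    function u |-> g (q + u v). The intermediate point is located by |c| <= |b|, which covers both
    signs of b. *)
Lemma mvt_dir (g : W -> R) (v q : W) (b : R) : (forall q, derivable g q v) ->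
  exists c : R, `|c| <= `|b| /\ g (q + b *: v) - g q = 'D_v g (q + c *: v) * b.
Proof.
move=> dg; pose h (u : R) := g (q + u *: v).
have quot u : (fun t : R => t^-1 *: ((h \o shift u) (t *: (1 : R)) - h u)) =
    (fun t : R => t^-1 *: ((g \o shift (q + u *: v)) (t *: v) - g (q + u *: v))).
  apply/funext => t; rewrite /h /=; congr (_ *: (g _ - _)).
  by rewrite /shift/= [t *: 1]mulr1 scalerDl addrCA.
have dh u : is_derive u (1 : R) h ('D_v g (q + u *: v)).
  split; first by have := dg (q + u *: v); rewrite /derivable -quot.
  by rewrite /derive -quot.
have ch (A : set R) : {within A, continuous h}.
  apply/continuous_subspaceT => u; apply/differentiable_continuous/derivable1_diffP.
  exact: (@ex_derive _ _ _ _ _ _ _ (dh u)).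
have h0 : h 0 = g q by rewrite /h scale0r addr0.
have [b0|b0] := leP 0 b.
  have [c] := MVT_segment b0 (fun x _ => dh x) (ch _).
  rewrite in_itv /= => /andP[c0 cb] E; exists c; rewrite !ger0_norm//; split => //.
  by rewrite -h0 E subr0.
have [c] := MVT_segment (ltW b0) (fun x _ => dh x) (ch _).
rewrite in_itv /= => /andP[c0 cb] E; exists c; split.
  by rewrite (ler0_norm cb) (ltr0_norm b0) lerN2.
by rewrite -h0 -[LHS]opprB E sub0r mulrN opprK.
Qed.

Lemma bounded_compact_support (g : W -> R) (K : set W) : continuous g -> compact K ->
  (forall q, ~ K q -> g q = 0) -> exists C : R, 0 <= C /\ forall q, `|g q| <= C.
Proof.
move=> cg cK g0; have [K0|/set0P Kn0] := eqVneq K set0.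
  by exists 0; split => // q; rewrite g0 ?normr0// K0.
have cn : {within K, continuous (fun q => `|g q|)}.
  apply: continuous_subspaceT => q; apply: (@continuous_comp _ _ _ g (fun x : R => `|x|)); [exact: cg|exact: norm_continuous].
have [c Kc cmax] := compact_EVT_max Kn0 cK cn.
exists `|g c|; split => // q; have [Kq|nKq] := pselect (K q); first by apply: cmax; apply/mem_set.
by rewrite g0// normr0.
Qed.

(** A compact K is closed, so g vanishes on a neighbourhood of every point outside it. *)
Lemma derive_support (g : W -> R) (K : set W) v : compact K ->
  (forall q, ~ K q -> g q = 0) -> forall q, ~ K q -> 'D_v g q = 0.
Proof.
move=> cK g0 q nKq.
have : nbhs q (~` K).
  by apply: open_nbhs_nbhs; split => //; apply: closed_openC; apply: compact_closed => //; exact: norm_hausdorff.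
move=> nq; rewrite -(derive_cst (0 : R) q v); apply: near_eq_derive.
by apply: filterS nq => y /g0.
Qed.

Definition mk6 (a b c a' b' c' : R) : W := (((a, b), c), ((a', b'), c')).

Let step3 (a b c u : R) : [/\ (a, b, c) + u *: e3 0 = (a + u, b, c) :> V3 R,
  (a, b, c) + u *: e3 1 = (a, b + u, c) :> V3 R & (a, b, c) + u *: e3 2 = (a, b, c + u) :> V3 R].
Proof.
split; rewrite /e3.
- by transitivity ((a + u * 1, b + u * 0, c + u * 0) : V3 R); [by []|rewrite mulr1 mulr0 !addr0].
- by transitivity ((a + u * 0, b + u * 1, c + u * 0) : V3 R); [by []|rewrite mulr1 mulr0 !addr0].
- by transitivity ((a + u * 0, b + u * 0, c + u * 1) : V3 R); [by []|rewrite mulr1 mulr0 !addr0].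
Qed.

Let stepl (x z v : V3 R) (u : R) : (x, z) + u *: (v, 0 : V3 R) = (x + u *: v, z) :> W.
Proof. by transitivity ((x + u *: v, z + u *: 0) : W); [by []|rewrite scaler0 addr0]. Qed.

Let stepr (x z v : V3 R) (u : R) : (x, z) + u *: (0 : V3 R, v) = (x, z + u *: v) :> W.
Proof. by transitivity ((x + u *: 0, z + u *: v) : W); [by []|rewrite scaler0 addr0]. Qed.

Lemma step6 (a b c a' b' c' u : R) :
  ((mk6 a b c a' b' c' + u *: e6 0 = mk6 (a + u) b c a' b' c')%R *
   (mk6 a b c a' b' c' + u *: e6 1 = mk6 a (b + u) c a' b' c')%R *
   (mk6 a b c a' b' c' + u *: e6 2 = mk6 a b (c + u) a' b' c')%R *
   (mk6 a b c a' b' c' + u *: e6 3 = mk6 a b c (a' + u) b' c')%R *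
   (mk6 a b c a' b' c' + u *: e6 4 = mk6 a b c a' (b' + u) c')%R *
   (mk6 a b c a' b' c' + u *: e6 5 = mk6 a b c a' b' (c' + u))%R)%type.
Proof.
have [s0 s1 s2] := step3 a b c u; have [t0 t1 t2] := step3 a' b' c' u.
by repeat split; rewrite /e6 /mk6 /= ?stepl ?stepr ?s0 ?s1 ?s2 ?t0 ?t1 ?t2.
Qed.

(** The l^1 norm: it is the cost of moving one coordinate after the other, and it passes through
    integrals coordinate by coordinate. *)
Definition n1 (y : V3 R) : R := `|y.1.1| + `|y.1.2| + `|y.2|.

Lemma n1_ge0 y : 0 <= n1 y. Proof. by rewrite /n1 !addr_ge0. Qed.

Section bound.
Variables (g : W -> R) (C : R).
Hypothesis dg : forall i : 'I_6, forall q, derivable g q (e6 i).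
Hypothesis bg : forall i : 'I_6, forall q, `|'D_(e6 i) g q| <= C.

Let dirI i (i6 : (i < 6)%N) (q : W) (u : R) : `|g (q + u *: e6 i) - g q| <= C * `|u|.
Proof.
have [c [_ ->]] := mvt_dir q u (@dg (Ordinal i6)).
by rewrite normrM ler_wpM2r// (bg (Ordinal i6)).
Qed.

(** Derivatives are known along the axes only, so the segment between the two points is replaced by
    six steps parallel to the axes. *)
Lemma lip6 (x z a b : V3 R) : `|g (x + a, z + b) - g (x, z)| <= C * (n1 a + n1 b).
Proof.
move: x z a b => [[x0 x1] x2] [[z0 z1] z2] [[a0 a1] a2] [[b0 b1] b2].
have d0 := @dirI 0%N isT (mk6 x0 x1 x2 z0 z1 z2) a0.
have d1 := @dirI 1%N isT (mk6 (x0 + a0) x1 x2 z0 z1 z2) a1.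
have d2 := @dirI 2%N isT (mk6 (x0 + a0) (x1 + a1) x2 z0 z1 z2) a2.
have d3 := @dirI 3%N isT (mk6 (x0 + a0) (x1 + a1) (x2 + a2) z0 z1 z2) b0.
have d4 := @dirI 4%N isT (mk6 (x0 + a0) (x1 + a1) (x2 + a2) (z0 + b0) z1 z2) b1.
have d5 := @dirI 5%N isT (mk6 (x0 + a0) (x1 + a1) (x2 + a2) (z0 + b0) (z1 + b1) z2) b2.
move: d0 d1 d2 d3 d4 d5; rewrite !step6.
rewrite /n1 /=.
have -> : (x0, x1, x2, (z0, z1, z2)) = mk6 x0 x1 x2 z0 z1 z2 by [].
have -> : ((x0, x1, x2) + (a0, a1, a2), (z0, z1, z2) + (b0, b1, b2)) =
  mk6 (x0 + a0) (x1 + a1) (x2 + a2) (z0 + b0) (z1 + b1) (z2 + b2) by [].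
rewrite !ler_norml => /andP[? ?] /andP[? ?] /andP[? ?] /andP[? ?] /andP[? ?] /andP[? ?].
by apply/andP; split; lra.
Qed.

End bound.

(** The displacement is made in three axial steps. On each, the mean value theorem gives a
    derivative at an intermediate point, and by [lip6] it differs from the derivative at the base
    point by at most C n1(a). Multiplying by |a_i| and summing gives C n1(a)^2. Only positions move
    here; the velocity increments are not expanded. *)
Lemma taylor6 (g : W -> R) (C : R) (x z a : V3 R) :
  (forall i : 'I_6, forall q, derivable g q (e6 i)) ->
  (forall i : 'I_6, forall j : 'I_6, forall q, derivable ('D_(e6 i) g) q (e6 j)) ->
  (forall i : 'I_6, forall j : 'I_6, forall q, `|'D_(e6 j) ('D_(e6 i) g) q| <= C) -> 0 <= C ->
  `|g (x + a, z) - g (x, z) - (a.1.1 * 'D_(e6 0) g (x, z) + (a.1.2 * 'D_(e6 1) g (x, z) + a.2 * 'D_(e6 2) g (x, z)))| <= C * (n1 a) ^+ 2.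
Proof.
move=> dg ddg bg C0.
move: x z a => [[x0 x1] x2] [[z0 z1] z2] [[a0 a1] a2].
have [c0 [lc0 E0]] := mvt_dir (mk6 x0 x1 x2 z0 z1 z2) a0 (@dg ord0).
have [c1 [lc1 E1]] := mvt_dir (mk6 (x0 + a0) x1 x2 z0 z1 z2) a1 (@dg (Ordinal (isT : (1 < 6)%N))).
have [c2 [lc2 E2]] := mvt_dir (mk6 (x0 + a0) (x1 + a1) x2 z0 z1 z2) a2 (@dg (Ordinal (isT : (2 < 6)%N))).
have L i (i6 : (i < 6)%N) := lip6 (ddg (Ordinal i6)) (bg (Ordinal i6)).
have L0 := @L 0%N isT (x0, x1, x2) (z0, z1, z2) (c0, 0, 0) 0.
have L1 := @L 1%N isT (x0, x1, x2) (z0, z1, z2) (a0, c1, 0) 0.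
have L2 := @L 2%N isT (x0, x1, x2) (z0, z1, z2) (a0, a1, c2) 0.
move: E0 E1 E2 L0 L1 L2; rewrite !step6 !addr0.
rewrite [(a0, a1, a2).1.1]/= [(a0, a1, a2).1.2]/= [(a0, a1, a2).2]/=.
have -> : ((x0, x1, x2) + (c0, 0, 0), (z0, z1, z2)) = mk6 (x0 + c0) x1 x2 z0 z1 z2 by rewrite /mk6 -[in RHS](addr0 x1) -[in RHS](addr0 x2).
have -> : ((x0, x1, x2) + (a0, c1, 0), (z0, z1, z2)) = mk6 (x0 + a0) (x1 + c1) x2 z0 z1 z2 by rewrite /mk6 -[in RHS](addr0 x2).
have -> : ((x0, x1, x2) + (a0, a1, c2), (z0, z1, z2)) = mk6 (x0 + a0) (x1 + a1) (x2 + c2) z0 z1 z2 by [].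
have -> : (x0, x1, x2, (z0, z1, z2)) = mk6 x0 x1 x2 z0 z1 z2 by [].
have -> : ((x0, x1, x2) + (a0, a1, a2), (z0, z1, z2)) =
  mk6 (x0 + a0) (x1 + a1) (x2 + a2) z0 z1 z2 by [].
set D0 := 'D__ g (mk6 x0 x1 x2 z0 z1 z2); set D0' := 'D__ g (mk6 (x0 + c0) _ _ _ _ _).
set D1 := 'D_(e6 1) g (mk6 x0 x1 x2 z0 z1 z2); set D1' := 'D__ g (mk6 _ (x1 + c1) _ _ _ _).
set D2 := 'D_(e6 2) g (mk6 x0 x1 x2 z0 z1 z2); set D2' := 'D__ g (mk6 _ _ (x2 + c2) _ _ _).
move=> E0 E1 E2; rewrite {1 3 5}/n1 /= normr0 !addr0.
have -> : n1 (0 : V3 R) = 0 by rewrite /n1 /= normr0 !addr0.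
rewrite !addr0.
have -> : g (mk6 (x0 + a0) (x1 + a1) (x2 + a2) z0 z1 z2) - g (mk6 x0 x1 x2 z0 z1 z2) -
   (a0 * D0 + (a1 * D1 + a2 * D2)) = (D0' - D0) * a0 + (D1' - D1) * a1 + (D2' - D2) * a2 by lra.
set n := n1 _.
clearbody D0 D0' D1 D1' D2 D2'; clear dg ddg bg L E0 E1 E2.
have n0 : 0 <= n by exact: n1_ge0.
have nE : n = `|a0| + `|a1| + `|a2| by [].
clearbody n.
have := normr_ge0 a0; have := normr_ge0 a1; have := normr_ge0 a2 => p2 p1 p0.
move=> L0 L1 L2.
have M0 : `|D0' - D0| <= C * n by apply: le_trans L0 _; apply: ler_wpM2l => //; lra.
have M1 : `|D1' - D1| <= C * n by apply: le_trans L1 _; apply: ler_wpM2l => //; lra.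
have M2 : `|D2' - D2| <= C * n by apply: le_trans L2 _; apply: ler_wpM2l => //; lra.
have K (D a : R) : `|D| <= C * n -> `|D * a| <= C * n * `|a|.
  by move=> H; rewrite normrM ler_wpM2r.
have {}M0 := K _ a0 M0; have {}M1 := K _ a1 M1; have {}M2 := K _ a2 M2.
have -> : C * n ^+ 2 = C * n * `|a0| + C * n * `|a1| + C * n * `|a2| by rewrite expr2 {2}nE; ring.
apply: le_trans (ler_normD _ _) _; apply: lerD => //.
by apply: le_trans (ler_normD _ _) _; exact: lerD.
Qed.

Lemma C2c_bounds (psi : W -> R) : C2c psi -> exists C : R, [/\ 0 <= C,
  (forall q, `|psi q| <= C), (forall i : 'I_6, forall q, `|'D_(e6 i) psi q| <= C) &
  (forall i j : 'I_6, forall q, `|'D_(e6 j) ('D_(e6 i) psi) q| <= C)].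
Proof.
move=> [cpsi H [K [cK K0]]].
have [C0 [C00 HC0]] := bounded_compact_support cpsi cK K0.
have K1 (i : 'I_6) := @derive_support psi K (e6 i) cK K0.
have /choice[C1 HC1] (i : 'I_6) : exists C : R, 0 <= C /\ forall q, `|'D_(e6 i) psi q| <= C.
  by have [_ c _ _] := H i i; exact: bounded_compact_support c cK (K1 i).
have /choice[C2 HC2] (ij : 'I_6 * 'I_6) : exists C : R, 0 <= C /\ forall q, `|'D_(e6 ij.2) ('D_(e6 ij.1) psi) q| <= C.
  have [_ _ _ c] := H ij.1 ij.2.
  apply: (bounded_compact_support c cK); exact: (@derive_support _ K (e6 ij.2) cK (K1 ij.1)).
have s1 : 0 <= \sum_i C1 i by apply: sumr_ge0 => i _; exact: (HC1 i).1.
have s2 : 0 <= \sum_ij C2 ij by apply: sumr_ge0 => i _; exact: (HC2 i).1.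
exists (C0 + \sum_i C1 i + \sum_ij C2 ij); split.
- by rewrite !addr_ge0.
- by move=> q; apply: le_trans (HC0 q) _; lra.
- move=> i q; apply: le_trans ((HC1 i).2 q) _.
  have : C1 i <= \sum_i C1 i by rewrite (bigD1 i)//= lerDl sumr_ge0// => k _; exact: (HC1 k).1.
  by lra.
- move=> i j q; apply: le_trans ((HC2 (i, j)).2 q) _.
  have : C2 (i, j) <= \sum_i C2 i by rewrite (bigD1 (i, j))//= lerDl sumr_ge0// => k _; exact: (HC2 k).1.
  by lra.
Qed.

End smooth.

(** * Real-valued integrals and atoms *)

Section rint.
Context d (S : measurableType d) {R : realType} (mu : {measure set S -> \bar R}).
Implicit Types (D : set S) (g h : S -> R).

Definition rintble D g := mu.-integrable D (fun p => (g p)%:E).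

Lemma rintble_measurable D g : rintble D g -> measurable_fun D g.
Proof. by move=> /measurable_int/measurable_EFinP. Qed.

Lemma rintble_le D g h : measurable D -> measurable_fun D g ->
  (forall p, D p -> `|g p| <= h p) -> rintble D h -> rintble D g.
Proof.
move=> mD mg gh; apply: le_integrable => //; first exact/measurable_EFinP.
move=> p Dp; rewrite /= lee_fin (@ger0_norm _ (h p)); first exact: gh.
by apply: le_trans (gh _ Dp).
Qed.

Lemma rintbleS D D' g : measurable D -> measurable D' -> D' `<=` D -> rintble D g -> rintble D' g.
Proof. by move=> mD mD' DD'; exact: integrableS. Qed.

Lemma rintbleD D g h : measurable D -> rintble D g -> rintble D h -> rintble D (fun p => g p + h p).
Proof. by move=> mD ig ih; exact: (integrableD mD ig ih). Qed.

Lemma rintbleB D g h : measurable D -> rintble D g -> rintble D h -> rintble D (fun p => g p - h p).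
Proof. by move=> mD ig ih; exact: (integrableB mD ig ih). Qed.

Lemma rintbleZ D g k : measurable D -> rintble D g -> rintble D (fun p => k * g p).
Proof. by move=> mD ig; exact: (integrableZl mD k ig). Qed.

Lemma rintble_norm D g : rintble D g -> rintble D (fun p => `|g p|).
Proof. by move=> ig; have := integrable_abse ig. Qed.

Lemma rintble_cst D k : measurable D -> (mu D < +oo)%E -> rintble D (fun=> k).
Proof.
move=> mD fD; apply/integrableP; split; first exact: measurable_cst.
by rewrite integral_cst// lte_mul_pinfty.
Qed.

Lemma RintD D g h : measurable D -> rintble D g -> rintble D h ->
  Rint mu D (fun p => g p + h p) = Rint mu D g + Rint mu D h.
Proof. by move=> mD; exact: RintegralD. Qed.

Lemma RintB D g h : measurable D -> rintble D g -> rintble D h ->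
  Rint mu D (fun p => g p - h p) = Rint mu D g - Rint mu D h.
Proof. by move=> mD; exact: RintegralB. Qed.

Lemma RintZ D g k : measurable D -> rintble D g -> Rint mu D (fun p => k * g p) = k * Rint mu D g.
Proof. by move=> mD; exact: RintegralZl. Qed.

Lemma Rint_norm D g : measurable D -> rintble D g -> `|Rint mu D g| <= Rint mu D (fun p => `|g p|).
Proof. by move=> mD; exact: le_normr_Rintegral. Qed.

Lemma Rint_le D g h : measurable D -> rintble D g -> rintble D h ->
  (forall p, D p -> g p <= h p) -> Rint mu D g <= Rint mu D h.
Proof. by move=> mD; exact: le_Rintegral. Qed.

Lemma Rint_ge0 D g : (forall p, D p -> 0 <= g p) -> 0 <= Rint mu D g.
Proof. exact: Rintegral_ge0. Qed.

Lemma Rint_norm_le D g h : measurable D -> measurable_fun D g -> rintble D h ->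
  (forall p, D p -> `|g p| <= h p) -> `|Rint mu D g| <= Rint mu D h.
Proof.
move=> mD mg ih gh; have ig := rintble_le mD mg gh ih.
by apply: le_trans (Rint_norm mD ig) _; apply: Rint_le => //; exact: rintble_norm.
Qed.

Lemma RintU (A B : set S) g : measurable A -> measurable B -> A `&` B = set0 ->
  rintble (A `|` B) g -> Rint mu (A `|` B) g = Rint mu A g + Rint mu B g.
Proof. by move=> mA mB AB ig; apply: Rintegral_setU => //; by apply/eqP. Qed.

Lemma eq_Rint D g h : (forall p, D p -> g p = h p) -> Rint mu D g = Rint mu D h.
Proof. by move=> gh; apply: eq_Rintegral => p /set_mem; exact: gh. Qed.

Lemma Rint_cst D k : measurable D -> Rint mu D (fun=> k) = k * fine (mu D).
Proof. by move=> mD; exact: Rintegral_cst. Qed.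

Lemma ae_eq_Rint D g h : measurable D -> measurable_fun D g -> measurable_fun D h ->
  ae_eq mu D g h -> Rint mu D g = Rint mu D h.
Proof.
move=> mD mg mh gh; rewrite /Rint; congr fine; apply: ae_eq_integral => //; try exact/measurable_EFinP.
by apply: filterS gh => p gh Dp; rewrite gh.
Qed.

Lemma Rint_EFin D g : measurable D -> rintble D g -> (Rint mu D g)%:E = (\int[mu]_(p in D) (g p)%:E)%E.
Proof. by move=> mD ig; rewrite /Rint fineK//; exact: (integrable_fin_num mD ig). Qed.

Lemma Rint_dct D (g_ : nat -> S -> R) g h : measurable D -> (forall n, measurable_fun D (g_ n)) ->
  measurable_fun D g -> (forall p, D p -> g_ n p @[n --> \oo] --> g p) -> rintble D h ->
  (forall n p, D p -> `|g_ n p| <= h p) ->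
  Rint mu D (g_ n) @[n --> \oo] --> Rint mu D g.
Proof.
move=> mD mg_ mg cg ih gh.
have mE (k : S -> R) : measurable_fun D k -> measurable_fun D (fun p => (k p)%:E) by move/measurable_EFinP.
have cE : {ae mu, forall p, D p -> (fun n => (g_ n p)%:E) @ \oo --> (g p)%:E}.
  by apply: aeW => p Dp; apply: cvg_EFin; [exact: nearW|exact: cg].
have bE : {ae mu, forall p n, D p -> (`|(g_ n p)%:E| <= (h p)%:E)%E}.
  by apply: aeW => p n Dp; rewrite lee_fin gh.
have [ig _ c] := dominated_convergence mD (fun n => mE _ (mg_ n)) (mE _ mg) cE ih bE.
by apply: fine_cvg; rewrite Rint_EFin.
Qed.

(** Such a measure behaves like a point mass although no atom is exhibited. The set where g exceeds
    its mean c has measure 0 or 1, so |g - c| is almost everywhere c - g or almost everywhere g - c.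
    Either function has integral 0, hence g = c almost everywhere. *)
Lemma zero_one_mean (B : set S) g : measurable B ->
  (forall A, measurable A -> A `<=` B -> mu A = 0%E \/ mu A = 1%E) -> mu B = 1%E ->
  rintble B g -> ae_eq mu B g (cst (Rint mu B g)).
Proof.
move=> mB z1 B1 ig; set c := Rint mu B g.
have iu : rintble B (fun p => g p - c) by apply: rintbleB => //; apply: rintble_cst => //; rewrite B1 ltry.
have mu' := rintble_measurable iu.
have u0 : Rint mu B (fun p => g p - c) = 0.
  by rewrite RintB ?Rint_cst ?B1 ?mulr1 ?subrr//; apply: rintble_cst => //; rewrite B1 ltry.
pose A := B `&` (fun p => g p - c) @^-1` `]0, +oo[.
have mA : measurable A by apply: mu'.
suff H : Rint mu B (fun p => `|g p - c|) = 0.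
  have : ae_eq mu B (EFin \o (fun p => g p - c)) (cst 0%E).
    apply/ae_eq_integral_abs => //; first exact/measurable_EFinP.
    transitivity (\int[mu]_(p in B) (`|g p - c|)%:E)%E; first by [].
    by rewrite -Rint_EFin ?H//; exact: rintble_norm.
  by apply: filterS => p h Bp; have [] := h Bp; move/eqP; rewrite subr_eq0 => /eqP.
have ma : measurable_fun B (fun p => `|g p - c|) by exact: measurableT_comp.
have [A0|A1] := z1 A mA (@subIsetl _ _ _).
  rewrite (@ae_eq_Rint _ _ (fun p => (- 1) * (g p - c)))//.
  - by rewrite RintZ// u0 mulr0.
  - exact: measurable_funM.
  exists A; split => // p /not_implyP[Bp]; rewrite /A /= in_itv /= andbT => H; split => //.
  rewrite ltNge; apply/negP => n; apply: H; by rewrite ler0_norm// mulN1r.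
have BA0 : mu (B `\` A) = 0%E.
  have BE : B = A `|` (B `\` A) by rewrite setDUK//; exact: subIsetl.
  have : mu B = (mu A + mu (B `\` A))%E.
    by rewrite {1}BE measureU//; [exact: measurableD|exact: setDIK].
  have [-> //|->] := z1 (B `\` A) (measurableD mB mA) (@subDsetl _ _ _).
  rewrite B1 A1 => E; exfalso; have E' : (1 : R) = 1 + 1 by apply: EFin_inj.
  by move: E'; lra.
rewrite (@ae_eq_Rint _ _ (fun p => g p - c))//.
exists (B `\` A); split => //; first exact: measurableD.
move=> p /not_implyP[Bp] H; split => //; rewrite /A /= in_itv /= andbT => -[_ n].
by apply: H; rewrite gtr0_norm.
Qed.

Section slab.
Hypothesis muV : forall A, measurable A -> (exists k : nat, mu A = k%:R%:E) \/ mu A = +oo%E.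
Variables (j : S -> V3 R) (H : V3 R -> R) (C : R) (U B : set S).
Hypotheses (mU : measurable U) (mB : measurable B).
Hypothesis j0 : rintble U (fun p => (j p).1.1).
Hypothesis j1 : rintble U (fun p => (j p).1.2).
Hypothesis j2 : rintble U (fun p => (j p).2).
Hypothesis mH : measurable_fun [set: V3 R] H.
Hypothesis HC : forall y y', `|H (y + y') - H y| <= C * n1 y'.
Hypothesis H0 : H 0 = 0.
Hypothesis C0 : 0 <= C.
Hypothesis UB : ~ (2%:E <= mu (U `&` B))%E.

Definition Rint3 (A : set S) : V3 R :=
  (Rint mu A (fun p => (j p).1.1), Rint mu A (fun p => (j p).1.2), Rint mu A (fun p => (j p).2)).

Lemma rintble_n1 : rintble U (fun p => n1 (j p)).
Proof.
rewrite /n1; apply: rintbleD => //; last exact: rintble_norm.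
by apply: rintbleD => //; exact: rintble_norm.
Qed.

Lemma measurable_jump : measurable_fun U j.
Proof.
have -> : j = fun p => (((j p).1.1, (j p).1.2), (j p).2) by apply/funext => p; case: (j p) => -[].
by apply: measurable_fun_pairD; [apply: measurable_fun_pairD|]; exact: rintble_measurable.
Qed.

Lemma H_le y : `|H y| <= C * n1 y.
Proof. by have := HC 0 y; rewrite add0r H0 subr0. Qed.

Lemma measurable_Hj : measurable_fun U (H \o j).
Proof. exact: measurableT_comp mH measurable_jump. Qed.

Lemma rintble_H : rintble U (H \o j).
Proof.
apply: (@rintble_le _ _ (fun p => C * n1 (j p))) => //.
- exact: measurable_Hj.
- by move=> p _; exact: H_le.
- by apply: rintbleZ => //; exact: rintble_n1.
Qed.

Lemma n1_Rint3 A : measurable A -> A `<=` U -> n1 (Rint3 A) <= Rint mu A (fun p => n1 (j p)).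
Proof.
move=> mA AU; rewrite /n1 /=.
have k0 := rintbleS mU mA AU j0; have k1 := rintbleS mU mA AU j1; have k2 := rintbleS mU mA AU j2.
rewrite RintD//; last 2 first.
- by apply: rintbleD => //; exact: rintble_norm.
- exact: rintble_norm.
rewrite RintD//; try exact: rintble_norm.
by apply: lerD; [apply: lerD|]; exact: Rint_norm.
Qed.

(* At most one atom of [mu] lies in [U `&` B], so [H] commutes with the integral there. *)
Lemma slab_error : `|H (Rint3 U) - Rint mu U (H \o j)| <= 2 * C * Rint mu (U `\` B) (fun p => n1 (j p)).
Proof.
pose U1 := U `&` B; pose U2 := U `\` B.
have mU1 : measurable U1 by exact: measurableI.
have mU2 : measurable U2 by exact: measurableD.
have UE : U = U1 `|` U2 by rewrite /U1 /U2 setUC setDE -setIUr setUCl setIT.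
have U12 : U1 `&` U2 = set0 by rewrite /U1 /U2 setDE setIACA setICr setI0.
have sU1 : U1 `<=` U by exact: subIsetl.
have sU2 : U2 `<=` U by exact: subDsetl.
have split g : rintble U g -> Rint mu U g = Rint mu U1 g + Rint mu U2 g.
  by move=> ig; rewrite {1}UE RintU// -UE.
have E3 : Rint3 U = Rint3 U1 + Rint3 U2 by rewrite /Rint3 !split.
have H1 : H (Rint3 U1) = Rint mu U1 (H \o j).
  (* The values of [mu] are integers or infinite, and the mass of U1 is below 2, so every measurable
     part of U1 has mass 0 or 1. *)
  have V01 A : measurable A -> A `<=` U1 -> mu A = 0%E \/ mu A = 1%E.
    move=> mA AU; have le : (mu A <= mu U1)%E by apply: measure_le.
    have [[[|[|k]] Ak]|Aoo] := muV mA; [by left|by right| |]; exfalso; apply: UB.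
      by apply: le_trans le; rewrite Ak lee_fin ler_nat.
    by apply: le_trans le; rewrite Aoo leey.
  have [U0|U1E] := V01 U1 mU1 (@subset_refl _ _).
    have z g : measurable_fun U1 g -> Rint mu U1 g = 0.
      by move=> mg; rewrite /Rint null_set_integral//; exact/measurable_EFinP.
    have mS g : measurable_fun U g -> measurable_fun U1 g by exact: measurable_funS.
    rewrite z; last exact: mS measurable_Hj.
    rewrite /Rint3 !z ?H0//; apply: mS; exact: rintble_measurable.
  have k0 := rintbleS mU mU1 sU1 j0; have k1 := rintbleS mU mU1 sU1 j1; have k2 := rintbleS mU mU1 sU1 j2.
  have e0 := zero_one_mean mU1 V01 U1E k0.
  have e1 := zero_one_mean mU1 V01 U1E k1.
  have e2 := zero_one_mean mU1 V01 U1E k2.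
  rewrite (@ae_eq_Rint _ (H \o j) (cst (H (Rint3 U1))))//.
  - by rewrite Rint_cst// U1E mulr1.
  - exact: (rintble_measurable (rintbleS mU mU1 sU1 rintble_H)).
  apply: filterS3 e0 e1 e2 => p h0 h1 h2 U1p; rewrite /= /Rint3; congr H.
  by move: (h0 U1p) (h1 U1p) (h2 U1p) => /= <- <- <-; case: (j p) => -[].
rewrite (split _ rintble_H) -H1 E3.
(* The marks outside B are charged twice, once in the argument of H and once in the integral of H
   over U2; this is the origin of the factor 2. *)
have -> : H (Rint3 U1 + Rint3 U2) - (H (Rint3 U1) + Rint mu U2 (H \o j)) =
  (H (Rint3 U1 + Rint3 U2) - H (Rint3 U1)) - Rint mu U2 (H \o j) by lra.
apply: le_trans (ler_normB _ _) _.
have -> : 2 * C * Rint mu U2 (fun p => n1 (j p)) = C * Rint mu U2 (fun p => n1 (j p)) + C * Rint mu U2 (fun p => n1 (j p)) by lra.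
have iN := rintbleS mU mU2 sU2 rintble_n1.
apply: lerD.
  apply: le_trans (HC _ _) _; apply: ler_wpM2l => //; exact: n1_Rint3.
rewrite -RintZ//; apply: Rint_norm_le => //.
- exact: (rintble_measurable (rintbleS mU mU2 sU2 rintble_H)).
- exact: rintbleZ.
- by move=> p _; exact: H_le.
Qed.

End slab.
End rint.

(** * The pathwise change of variables formula *)

Section tgrid.
Context {R : realType}.
Lemma gridL_nat t m (k : nat) (x : R) : 0 < t -> k%:R * step t m < x <= k.+1%:R * step t m ->
  gridL t m x = k%:R * step t m.
Proof.
move=> t0 kx; rewrite /gridL (@cell_eq _ _ _ k%:Z) ?step_gt0// intrD.
by rewrite -[k%:Z%:~R]/(k%:R) -natrD addn1.
Qed.

Lemma gridU_nat t m (k : nat) (x : R) : 0 < t -> k%:R * step t m < x <= k.+1%:R * step t m ->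
  gridU t m x = k.+1%:R * step t m.
Proof. by move=> t0 kx; rewrite gridUE (gridL_nat t0 kx) -natr1 mulrDl mul1r. Qed.

Lemma stepE t m : m.+1%:R * step t m = t :> R.
Proof. by rewrite /step mulrC divfK. Qed.

Context d (S : measurableType d) (mu : {measure set S -> \bar R}) (sg : S -> R) (D : set S).
Hypothesis msg : measurable_fun [set: S] sg.
Hypothesis mD : measurable D.

(** The time map [sg] and the domain are parameters so that one cutting lemma serves both integrals
    of the path: against the random measure, with the time coordinate of a mark, and against
    Lebesgue measure, with the identity. *)
Definition slab a b : set S := D `&` [set p | a < sg p <= b].

Lemma measurable_slab a b : measurable (slab a b).
Proof.
apply: measurableI => //; rewrite (_ : [set p | _] = sg @^-1` `]a, b]).
  by rewrite -[X in measurable X]setTI; apply: msg.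
by apply/seteqP; split => p /=; rewrite in_itv.
Qed.

Lemma slab_sub a b a' b' : a' <= a -> b <= b' -> slab a b `<=` slab a' b'.
Proof.
move=> aa bb p [Dp /= /andP[pa pb]]; split => //=.
by rewrite (le_lt_trans aa pa) (le_trans pb bb).
Qed.

Lemma Rint_slab_cat a b e g : a <= b -> b <= e -> rintble mu (slab a e) g ->
  Rint mu (slab a e) g = Rint mu (slab a b) g + Rint mu (slab b e) g.
Proof.
move=> ab be ig; have E : slab a e = slab a b `|` slab b e.
  apply/seteqP; split => p.
    move=> [Dp /= /andP[p1 p2]]; case: (leP (sg p) b) => pb; [left|right]; split => //=.
      by rewrite p1 pb.
    by rewrite pb p2.
  by move=> [|]; exact: slab_sub.
rewrite {1}E RintU -?E//; try exact: measurable_slab.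
apply/seteqP; split => p // -[[_ /= /andP[_ pb]] [_ /= /andP[bp _]]].
by move: pb; rewrite leNgt bp.
Qed.

Lemma Rint_grid t m g : 0 < t -> rintble mu (slab 0 t) g ->
  Rint mu (slab 0 t) g = \sum_(k < m.+1) Rint mu (slab (k%:R * step t m) (k.+1%:R * step t m)) g.
Proof.
move=> t0 ig; have h0 := step_gt0 m t0.
suff H k : (k <= m.+1)%N -> Rint mu (slab 0 (k%:R * step t m)) g =
    \sum_(i < k) Rint mu (slab (i%:R * step t m) (i.+1%:R * step t m)) g.
  by rewrite -{1}(stepE t m); exact: H.
elim: k => [_|k IH km].
  rewrite big_ord0 mul0r (_ : slab 0 0 = set0) ?/Rint ?integral_set0//.
  by apply/seteqP; split => p // -[_ /= /andP[a b]]; lra.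
have kt : k.+1%:R * step t m <= t by rewrite -[leRHS](stepE t m) ler_pM2r// ler_nat.
have kk : k%:R * step t m <= k.+1%:R * step t m by rewrite ler_pM2r// ler_nat.
have k0 : 0 <= k%:R * step t m by rewrite mulr_ge0// ltW.
rewrite big_ord_recr /= -IH; last exact: ltnW.
apply: Rint_slab_cat => //.
by apply: rintbleS ig; [exact: measurable_slab|exact: measurable_slab|exact: slab_sub].
Qed.

End tgrid.

Section path.
Context {R : realType}.
Variables (M : {measure set (Mk R) -> \bar R}) (t : R) (D : set (Mk R)) (j : Mk R -> V3 R) (X Z : R -> V3 R).
Variables (psi : V3 R * V3 R -> R) (K : R) (B : nat -> set (Mk R)) (LZ : R -> V3 R).
Hypothesis t0 : 0 < t.
Hypothesis mD : measurable D.
Hypothesis MV : forall A, measurable A -> (exists k : nat, M A = k%:R%:E) \/ M A = +oo%E.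
Hypothesis psi2 : C2c psi.
Hypothesis mj : measurable_fun [set: Mk R] j.

Notation E := (slab (@ps R) D).
Notation L := (slab (@id R) setT).

Hypothesis j0 : rintble M (E 0 t) (fun p => (j p).1.1).
Hypothesis j1 : rintble M (E 0 t) (fun p => (j p).1.2).
Hypothesis j2 : rintble M (E 0 t) (fun p => (j p).2).
Hypothesis ZE : forall a b, 0 <= a -> a <= b -> b <= t -> Z b = Z a + Rint3 M j (E a b).
Hypothesis XE : forall a b, 0 <= a -> a <= b -> b <= t -> X b = X a + Rint3 (@lebR R) Z (L a b).
Hypothesis K0 : 0 <= K.
Hypothesis ZK : forall s, n1 (Z s) <= K.
Hypothesis Zr : forall s, Z @ s^'+ --> Z s.
Hypothesis Zl : forall s, 0 < s <= t -> Z @ s^'- --> LZ s.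
Hypothesis mB : forall n, measurable (B n).
Hypothesis Bcov : forall p, E 0 t p -> exists n0, forall n, (n0 <= n)%N -> B n p.
Hypothesis freq : forall n m0 : nat, exists2 m : nat, (m0 <= m)%N &
  forall k, (k <= m)%N -> ~ (2%:E <= M (E (k%:R * step t m)%R (k.+1%:R * step t m)%R `&` B n))%E.

Let mE a b : measurable (E a b). Proof. by apply: measurable_slab => //; exact: measurable_ps. Qed.
Let mL a b : measurable (L a b : set R). Proof. exact: measurable_slab. Qed.

Let LE a b : L a b = `]a, b]%classic.
Proof. by apply/seteqP; split => x /=; rewrite /slab /= in_itv /=; [case|split]. Qed.

Let lebL a b : a <= b -> lebR (L a b) = (b - a)%:E.
Proof. by move=> ab; rewrite LE; exact: lebR_itv. Qed.

Let lebLoo a b : a <= b -> (lebR (L a b) < +oo)%E.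
Proof. by move=> ab; rewrite lebL// ltry. Qed.

Lemma measurable_path_coord (c : V3 R -> R) : continuous c -> measurable_fun [set: R] (fun s => c (Z s)).
Proof.
move=> cc; apply: (@measurable_fun_rcont R _ R id (fun x _ => c (Z x))) => // x.
exact: (cvg_comp Z c (@Zr x) (cc (Z x))).
Qed.

Let cf11 : continuous (fun v : V3 R => v.1.1).
Proof. by move=> v; apply: (cvg_comp fst fst (@cvg_fst _ _ _ _ _)); exact: cvg_fst. Qed.
Let cf12 : continuous (fun v : V3 R => v.1.2).
Proof. by move=> v; apply: (cvg_comp fst snd (@cvg_fst _ _ _ _ _)); exact: cvg_snd. Qed.
Let cf2 : continuous (fun v : V3 R => v.2).
Proof. by move=> v; exact: cvg_snd. Qed.

Let n1_le (y : V3 R) : [/\ `|y.1.1| <= n1 y, `|y.1.2| <= n1 y & `|y.2| <= n1 y].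
Proof. by rewrite /n1; split; have := normr_ge0 y.1.1; have := normr_ge0 y.1.2; have := normr_ge0 y.2; lra. Qed.

Let Zint (c : V3 R -> R) a b : continuous c -> (forall y, `|c y| <= n1 y) -> a <= b ->
  rintble (@lebR R) (L a b) (fun s => c (Z s)).
Proof.
move=> cc cn ab; apply: (@rintble_le _ _ _ _ _ _ (cst K)) => //.
- by apply: measurable_funTS; exact: measurable_path_coord.
- by move=> s _; apply: le_trans (cn _) (ZK s).
- by apply: rintble_cst => //; exact: lebLoo.
Qed.

Lemma X_incr_le a b : 0 <= a -> a <= b -> b <= t ->
  n1 (Rint3 (@lebR R) Z (L a b)) <= K * (b - a).
Proof.
move=> a0 ab bt.
have i0 : rintble (@lebR R) (L a b) (fun s => (Z s).1.1) by apply: (@Zint (fun v => v.1.1)) => // y; case: (n1_le y).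
have i1 : rintble (@lebR R) (L a b) (fun s => (Z s).1.2) by apply: (@Zint (fun v => v.1.2)) => // y; case: (n1_le y).
have i2 : rintble (@lebR R) (L a b) (fun s => (Z s).2) by apply: (@Zint (fun v => v.2)) => // y; case: (n1_le y).
apply: (le_trans (n1_Rint3 (mL a b) i0 i1 i2 (mL a b) (@subset_refl _ _))).
apply: (@le_trans _ _ (Rint (@lebR R) (L a b) (cst K))); last by rewrite Rint_cst// [X in fine X](lebL ab).
apply: Rint_le => //; first exact: rintble_n1.
by apply: rintble_cst => //; exact: lebLoo.
Qed.

(** X is an integral of the bounded path Z, so its increments are at most K times the elapsed
    time. *)
Lemma X_left s : 0 < s <= t -> X @ s^'- --> X s.
Proof.
move=> /andP[s0 st].
suff H (c : V3 R -> R) : (forall u v, c (u + v) = c u + c v) -> (forall y, `|c y| <= n1 y) ->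
    (fun a => c (X a)) @ s^'- --> c (X s).
  have -> : X = fun a => (((X a).1.1, (X a).1.2), (X a).2) by apply/funext => a; case: (X a) => -[].
  apply: cvg_to_pair; first apply: cvg_to_pair.
  - by apply: (H (fun v => v.1.1)) => // y; case: (n1_le y).
  - by apply: (H (fun v => v.1.2)) => // y; case: (n1_le y).
  - by apply: (H (fun v => v.2)) => // y; case: (n1_le y).
move=> cD cn; apply/cvgrPdist_le => e e0.
near=> a.
have a0 : 0 <= a by near: a; apply: nbhs_left_ge.
have as' : a <= s by near: a; exact: nbhs_left_le.
rewrite (XE a0 as' st) cD addrAC subrr add0r.
apply: le_trans (cn _) _; apply: le_trans (X_incr_le a0 as' st) _.
(* K may be 0, hence the division by K + 1. *)
have : s - e / (K + 1) <= a by near: a; apply: nbhs_left_ge; rewrite ltrBlDr ltrDl divr_gt0// ltr_pwDr.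
rewrite lerBlDr -lerBlDl => h.
apply: (@le_trans _ _ (K * (e / (K + 1)))); first by rewrite ler_wpM2l.
rewrite mulrA ler_pdivrMr ?ltr_pwDr// mulrC ler_pM2l//; lra.
Unshelve. all: by end_near. Qed.

Let dpsi (i : 'I_6) q : derivable psi q (e6 i).
Proof. by have [_ H _] := psi2; have [d _ _ _] := H i i; exact: d. Qed.
Let ddpsi (i k : 'I_6) q : derivable ('D_(e6 i) psi) q (e6 k).
Proof. by have [_ H _] := psi2; have [_ _ d _] := H i k; exact: d. Qed.
Let cpsi : continuous psi. Proof. by have [] := psi2. Qed.
Let cdpsi (i : nat) : (i < 6)%N -> continuous ('D_(e6 i) psi).
Proof. by move=> i6; have [_ H _] := psi2; have [_ d _ _] := H (Ordinal i6) (Ordinal i6); exact: d. Qed.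

Definition drift (q : V3 R * V3 R) (z : V3 R) : R :=
  'D_(e6 0) psi q * z.1.1 + ('D_(e6 1) psi q * z.1.2 + 'D_(e6 2) psi q * z.2).
(** The increment over a cell from a to b is split as psi(X_b, Z_b) - psi(X_a, Z_b) plus psi(X_a,
    Z_b) - psi(X_a, Z_a). Hence the transport integrand takes X at the left end and Z at the right
    end, while the jump integrand [Gm] takes both at the left end. The limits [gdr] and [Gj] then
    carry the current Z and its left limit respectively. *)
Definition gm m s := drift (X (gridL t m s), Z (gridU t m s)) (Z s).
Definition gdr s := drift (X s, Z s) (Z s).
Definition Gm m p := psi (X (gridL t m (ps p)), Z (gridL t m (ps p)) + j p)
  - psi (X (gridL t m (ps p)), Z (gridL t m (ps p))).
Definition Gj p := psi (X (ps p), LZ (ps p) + j p) - psi (X (ps p), LZ (ps p)).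

Section withC.
Variable C : R.
Hypothesis C0 : 0 <= C.
Hypothesis psiC : forall q, `|psi q| <= C.
Hypothesis dpsiC : forall i : 'I_6, forall q, `|'D_(e6 i) psi q| <= C.
Hypothesis ddpsiC : forall i k : 'I_6, forall q, `|'D_(e6 k) ('D_(e6 i) psi) q| <= C.

Lemma drift_le q z : `|drift q z| <= C * n1 z.
Proof.
rewrite /drift /n1 !mulrDr -addrA.
have H i (i6 : (i < 6)%N) (u : R) : `|'D_(e6 i) psi q * u| <= C * `|u|.
  by rewrite normrM ler_wpM2r// (dpsiC (Ordinal i6)).
apply: le_trans (ler_normD _ _) _; apply: lerD; first exact: H.
by apply: le_trans (ler_normD _ _) _; apply: lerD; exact: H.
Qed.

Lemma psi_lip x z y : `|psi (x, z + y) - psi (x, z)| <= C * n1 y.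
Proof.
have := lip6 dpsi dpsiC x z 0 y; rewrite addr0.
have -> : n1 (0 : V3 R) = 0 by rewrite /n1 /= normr0 !addr0.
by rewrite add0r.
Qed.

Lemma measurable_gm m : measurable_fun [set: R] (gm m).
Proof.
apply: (@measurable_fun_grid R _ _ _ _ (cell (step t m))
  (fun k s => drift (X (k%:~R * step t m), Z ((k + 1)%:~R * step t m)) (Z s))).
  by apply: measurable_cell; exact: step_gt0.
move=> k; rewrite /drift; apply: measurable_funD; last apply: measurable_funD.
- by apply: measurable_funM => //; exact: (@measurable_path_coord (fun v => v.1.1)).
- by apply: measurable_funM => //; exact: (@measurable_path_coord (fun v => v.1.2)).
- by apply: measurable_funM => //; exact: (@measurable_path_coord (fun v => v.2)).
Qed.

Let mpsi_z x z : measurable_fun [set: V3 R] (fun y => psi (x, z + y) - psi (x, z)).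
Proof.
apply: measurable_funB => //.
have E3 : (fun y : V3 R => psi (x, z + y)) = (fun q : V3 R * V3 R => psi (x, z + q.2)) \o (fun y => (0, y)) by [].
rewrite E3; apply: measurableT_comp; last exact: measurable_fun_pair.
apply: continuous_measurable6 => q; apply: (@continuous_comp _ _ _ (fun q : V3 R * V3 R => (x, z + q.2)) psi); last exact: cpsi.
apply: cvg_to_pair; first exact: cvg_cst.
by apply: cvgD; [exact: cvg_cst|exact: cvg_snd].
Qed.

Lemma measurable_Gm m : measurable_fun [set: Mk R] (Gm m).
Proof.
apply: (@measurable_fun_grid R _ _ _ _ (fun p => cell (step t m) (ps p))
  (fun k p => psi (X (k%:~R * step t m), Z (k%:~R * step t m) + j p) - psi (X (k%:~R * step t m), Z (k%:~R * step t m)))).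
  by apply: (measurableT_comp (measurable_cell (step_gt0 m t0))); exact: measurable_ps.
by move=> k; exact: (measurableT_comp (mpsi_z _ _) mj).
Qed.

Let iK a b (k : R) : a <= b -> rintble (@lebR R) (L a b) (cst k).
Proof. by move=> ab; apply: rintble_cst => //; exact: lebLoo. Qed.

Lemma rintble_gm m a b : a <= b -> rintble (@lebR R) (L a b) (gm m).
Proof.
move=> ab; apply: (@rintble_le _ _ _ _ _ _ (cst (C * K))) => //.
- by apply: measurable_funTS; exact: measurable_gm.
- by move=> s _; apply: le_trans (drift_le _ _) _; apply: ler_wpM2l.
- exact: iK.
Qed.

Let in1 : rintble M (E 0 t) (fun p => n1 (j p)).
Proof. by apply: rintble_n1. Qed.

Lemma rintble_Gm m : rintble M (E 0 t) (Gm m).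
Proof.
apply: (@rintble_le _ _ _ _ _ _ (fun p => C * n1 (j p))) => //.
- by apply: measurable_funTS; exact: measurable_Gm.
- by move=> p _; exact: psi_lip.
- exact: rintbleZ.
Qed.

(** The first half of the splitting is a Taylor expansion in X, whose increment is at most K times
    the mesh. The second half has X frozen and is controlled by [slab_error] with H y = psi (X a, Z
    a + y) - psi (X a, Z a). *)
Lemma one_step m k a b n : a = k%:R * step t m -> b = k.+1%:R * step t m -> (k <= m)%N ->
  ~ (2%:E <= M (E a b `&` B n))%E ->
  `|psi (X b, Z b) - psi (X a, Z a) - Rint (@lebR R) (L a b) (gm m) - Rint M (E a b) (Gm m)|
   <= C * (K * step t m) ^+ 2 + 2 * C * Rint M (E a b `\` B n) (fun p => n1 (j p)).
Proof.
move=> aE bE km fr.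
have h0 := step_gt0 m t0.
have a0 : 0 <= a by rewrite aE mulr_ge0// ltW.
have ab : a <= b by rewrite aE bE ler_pM2r// ler_nat.
have bt : b <= t by rewrite bE -[leRHS](stepE t m) ler_pM2r// ler_nat.
have ba : b - a = step t m by rewrite aE bE -natr1; ring.
have i0 : rintble (@lebR R) (L a b) (fun s => (Z s).1.1) by apply: (@Zint (fun v => v.1.1)) => // y; case: (n1_le y).
have i1 : rintble (@lebR R) (L a b) (fun s => (Z s).1.2) by apply: (@Zint (fun v => v.1.2)) => // y; case: (n1_le y).
have i2 : rintble (@lebR R) (L a b) (fun s => (Z s).2) by apply: (@Zint (fun v => v.2)) => // y; case: (n1_le y).
set u := Rint3 (@lebR R) Z (L a b).
have uK : n1 u <= K * step t m by rewrite -ba; exact: X_incr_le.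
have gE : Rint (@lebR R) (L a b) (gm m) = u.1.1 * 'D_(e6 0) psi (X a, Z b) +
    (u.1.2 * 'D_(e6 1) psi (X a, Z b) + u.2 * 'D_(e6 2) psi (X a, Z b)).
  rewrite (@eq_Rint _ _ _ _ _ _ (fun s => drift (X a, Z b) (Z s))); last first.
    move=> s [_ /= sab]; rewrite /gm (@gridL_nat _ _ _ k)// -?aE -?bE//.
    by rewrite (@gridU_nat _ _ _ k)// -?aE -?bE.
  rewrite /drift RintD//; last 2 first.
  - exact: rintbleZ.
  - by apply: rintbleD => //; exact: rintbleZ.
  rewrite RintD//; try exact: rintbleZ.
  by rewrite !RintZ//; congr (_ + (_ + _)); exact: mulrC.
have T1 := taylor6 (X a) (Z b) u dpsi ddpsi ddpsiC C0.
rewrite -gE -(XE a0 ab bt) in T1.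
have sub1 : E a b `<=` E 0 t by exact: slab_sub.
have k0 := rintbleS (mE 0 t) (mE a b) sub1 j0.
have k1 := rintbleS (mE 0 t) (mE a b) sub1 j1.
have k2 := rintbleS (mE 0 t) (mE a b) sub1 j2.
pose H y := psi (X a, Z a + y) - psi (X a, Z a).
have HC y y' : `|H (y + y') - H y| <= C * n1 y'.
  by rewrite /H opprB addrA subrK addrA; exact: psi_lip.
have H0 : H 0 = 0 by rewrite /H addr0 subrr.
have T2 := slab_error MV (mE a b) (mB n) k0 k1 k2 (mpsi_z (X a) (Z a)) HC H0 C0 fr.
have GE : Rint M (E a b) (Gm m) = Rint M (E a b) (H \o j).
  by apply: eq_Rint => p [_ /= pab]; rewrite /Gm (@gridL_nat _ _ _ k)// -?aE -?bE.
rewrite -GE -(ZE a0 ab bt) in T2.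
have -> : psi (X b, Z b) - psi (X a, Z a) - Rint (@lebR R) (L a b) (gm m) - Rint M (E a b) (Gm m) =
  (psi (X b, Z b) - psi (X a, Z b) - Rint (@lebR R) (L a b) (gm m)) +
  (psi (X a, Z b) - psi (X a, Z a) - Rint M (E a b) (Gm m)) by ring.
apply: le_trans (ler_normD _ _) _; apply: lerD => //.
apply: le_trans T1 _; apply: ler_wpM2l => //; apply: lerXn2r => //; rewrite ?nnegrE ?n1_ge0//.
by rewrite mulr_ge0// ltW.
Qed.

Let mEB n a b : measurable (E a b `\` B n). Proof. exact: measurableD. Qed.
Let slabB n a b : slab (@ps R) (D `\` B n) a b = E a b `\` B n.
Proof. by rewrite /slab !setDE setIAC. Qed.

(** With mesh h there are m + 1 = t / h cells, so the quadratic errors C (K h)^2 add up to C K^2 t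
    h; the integrals over the marks outside B n add up exactly, by additivity over the cells. *)
Lemma grid_error m n : (forall k, (k <= m)%N -> ~ (2%:E <= M (E (k%:R * step t m)%R (k.+1%:R * step t m)%R `&` B n))%E) ->
  `|psi (X t, Z t) - psi (X 0, Z 0) - Rint (@lebR R) (L 0 t) (gm m) - Rint M (E 0 t) (Gm m)|
   <= C * K ^+ 2 * t * step t m + 2 * C * Rint M (E 0 t `\` B n) (fun p => n1 (j p)).
Proof.
move=> fr; pose Y k := psi (X (k%:R * step t m), Z (k%:R * step t m)).
have -> : psi (X t, Z t) - psi (X 0, Z 0) = \sum_(k < m.+1) (Y k.+1 - Y k).
  by rewrite -(big_mkord xpredT (fun k => Y k.+1 - Y k)) telescope_sumr// /Y stepE mul0r.
rewrite (Rint_grid (@measurable_id _ R setT) measurableT m t0 (rintble_gm m (ltW t0))).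
rewrite (Rint_grid (@measurable_ps R) mD m t0 (rintble_Gm m)) -!sumrB.
apply: le_trans (ler_norm_sum _ _ _) _.
have iB : rintble M (slab (@ps R) (D `\` B n) 0 t) (fun p => n1 (j p)).
  by rewrite slabB; apply: rintbleS in1 => //; exact: subDsetl.
have := Rint_grid (@measurable_ps R) (measurableD mD (mB n)) m t0 iB.
rewrite slabB => ->; rewrite mulr_sumr.
have -> : C * K ^+ 2 * t * step t m = \sum_(k < m.+1) C * (K * step t m) ^+ 2.
  rewrite sumr_const card_ord -mulr_natl; move: (stepE t m); move: (step t m) => h <-; ring.
rewrite -big_split /=; apply: ler_sum => k _; rewrite slabB.
have km : (k <= m)%N by rewrite -ltnS.
apply: (@one_step m k _ _ n erefl erefl km); exact: (fr k km).
Qed.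

Lemma gm_cvg s : L 0 t s -> gm m s @[m --> \oo] --> gdr s.
Proof.
move=> [_ /= s0t].
have cX : X (gridL t m s) @[m --> \oo] --> X s.
  by apply: (cvg_comp (fun m => gridL t m s) X); [exact: gridL_cvg|exact: X_left].
have cZ : Z (gridU t m s) @[m --> \oo] --> Z s by apply: gridU_cvg => //; exact: Zr.
have cXZ : (X (gridL t m s), Z (gridU t m s)) @[m --> \oo] --> (X s, Z s) by exact: cvg_to_pair.
have cD i : (i < 6)%N -> 'D_(e6 i) psi (X (gridL t m s), Z (gridU t m s)) @[m --> \oo] --> 'D_(e6 i) psi (X s, Z s).
  by move=> i6; apply: (cvg_comp _ ('D_(e6 i) psi) cXZ); exact: cdpsi.
rewrite /gm /gdr /drift; apply: cvgD; last apply: cvgD.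
- by apply: cvgMl; exact: cD.
- by apply: cvgMl; exact: cD.
- by apply: cvgMl; exact: cD.
Qed.

Lemma Gm_cvg p : E 0 t p -> Gm m p @[m --> \oo] --> Gj p.
Proof.
move=> [_ /= s0t].
have cL : gridL t m (ps p) @[m --> \oo] --> (ps p)^'- by exact: gridL_cvg.
have cX : X (gridL t m (ps p)) @[m --> \oo] --> X (ps p).
  by apply: (cvg_comp (fun m => gridL t m (ps p)) X); [exact: cL|exact: X_left].
have cZ : Z (gridL t m (ps p)) @[m --> \oo] --> LZ (ps p).
  by apply: (cvg_comp (fun m => gridL t m (ps p)) Z); [exact: cL|exact: Zl].
apply: cvgB.
  apply: (cvg_comp (fun m => (X (gridL t m (ps p)), Z (gridL t m (ps p)) + j p)) psi); last exact: cpsi.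
  by apply: cvg_to_pair => //; apply: cvgD => //; exact: cvg_cst.
apply: (cvg_comp (fun m => (X (gridL t m (ps p)), Z (gridL t m (ps p)))) psi); last exact: cpsi.
exact: cvg_to_pair.
Qed.

Lemma measurable_gdr : measurable_fun (L 0 t) gdr.
Proof.
by apply: (measurable_fun_cvg (fun m => measurable_funTS (measurable_gm m))) => s; exact: gm_cvg.
Qed.

Lemma measurable_Gj : measurable_fun (E 0 t) Gj.
Proof.
by apply: (measurable_fun_cvg (fun m => measurable_funTS (measurable_Gm m))) => p; exact: Gm_cvg.
Qed.

Lemma ito_integrable : rintble (@lebR R) (L 0 t) gdr /\ rintble M (E 0 t) Gj.
Proof.
split.
  apply: (@rintble_le _ _ _ _ _ _ (cst (C * K))) => //; first exact: measurable_gdr.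
    by move=> s _; apply: le_trans (drift_le _ _) _; apply: ler_wpM2l.
  by apply: iK; exact: ltW.
apply: (@rintble_le _ _ _ _ _ _ (fun p => C * n1 (j p))) => //; first exact: measurable_Gj.
  by move=> p _; exact: psi_lip.
exact: rintbleZ.
Qed.

(** Each mark belongs to B n for all large n, and n1 of the jumps is integrable, so dominated
    convergence applies. *)
Lemma tail_cvg : Rint M (E 0 t `\` B n) (fun p => n1 (j p)) @[n --> \oo] --> (0 : R).
Proof.
pose g n p : R := \1_(~` B n) p * n1 (j p).
have mn1 : measurable_fun (E 0 t) (fun p => n1 (j p)) by exact: rintble_measurable in1.
have gE n : Rint M (E 0 t `\` B n) (fun p => n1 (j p)) = Rint M (E 0 t) (g n).
  rewrite /Rint setDE integral_mkcondr; congr fine; apply: eq_integral => p _.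
  rewrite patchE /g indicE; case: (boolP (p \in ~` B n)) => _; first by rewrite mul1r.
  by rewrite mul0r.
under eq_fun do rewrite gE.
suff: Rint M (E 0 t) (g n) @[n --> \oo] --> Rint M (E 0 t) (cst 0) by rewrite (Rint_cst _ _ (mE 0 t)) mul0r.
apply: (@Rint_dct _ _ _ M _ g (cst 0) (fun p => n1 (j p))) => //.
- move=> n; apply: measurable_funM => //; apply: measurable_funTS; apply: measurable_indic; exact: measurableC.
- move=> p Ep; apply: cvg_near_cst; have [n0 Hn0] := Bcov Ep.
  exists n0 => // n /= n0n; rewrite /g indicE memNset ?mul0r// => H; apply: H; exact: Hn0.
- move=> n p _; rewrite /g indicE normrM (ger0_norm (n1_ge0 _)).
  by rewrite ler_piMl ?n1_ge0//; case: (_ \in _); rewrite ?normr1 ?normr0.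
Qed.

Lemma ito : psi (X t, Z t) = psi (X 0, Z 0) + Rint (@lebR R) (L 0 t) gdr + Rint M (E 0 t) Gj.
Proof.
have cA : Rint (@lebR R) (L 0 t) (gm m) @[m --> \oo] --> Rint (@lebR R) (L 0 t) gdr.
  apply: (@Rint_dct _ _ _ _ _ _ _ (cst (C * K))) => //.
  - by move=> m; apply: measurable_funTS; exact: measurable_gm.
  - exact: measurable_gdr.
  - exact: gm_cvg.
  - by apply: iK; exact: ltW.
  - by move=> m s _; apply: le_trans (drift_le _ _) _; apply: ler_wpM2l.
have cJ : Rint M (E 0 t) (Gm m) @[m --> \oo] --> Rint M (E 0 t) Gj.
  apply: (@Rint_dct _ _ _ _ _ _ _ (fun p => C * n1 (j p))) => //.
  - by move=> m; apply: measurable_funTS; exact: measurable_Gm.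
  - exact: measurable_Gj.
  - exact: Gm_cvg.
  - exact: rintbleZ.
  - by move=> m p _; exact: psi_lip.
have cS : C * K ^+ 2 * t * step t m @[m --> \oo] --> (0 : R).
  by rewrite -[X in _ --> X](mulr0 (C * K ^+ 2 * t)); apply: cvgMr; exact: step_cvg0.
have cT : 2 * C * Rint M (E 0 t `\` B n) (fun p => n1 (j p)) @[n --> \oo] --> (0 : R).
  by rewrite -[X in _ --> X](mulr0 (2 * C)); apply: cvgMr; exact: tail_cvg.
set A := Rint (@lebR R) (L 0 t) gdr in cA *; set J := Rint M (E 0 t) Gj in cJ *.
suff H e : 0 < e -> `|psi (X t, Z t) - psi (X 0, Z 0) - A - J| <= e.
  have : psi (X t, Z t) - psi (X 0, Z 0) - A - J = 0.
    by apply/normr0_eq0/le_anti; rewrite normr_ge0 andbT; apply/ler_addgt0Pl => e e0; rewrite addr0; exact: H.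
  by move=> h; lra.
(* The cut-off n is fixed before the grid, so that its tail is below e / 4. For this n, [freq]
   provides a grid without double atoms beyond the three thresholds coming from the transport
   integral, the jump integral and the Taylor error. *)
move=> e0; have e4 : 0 < e / 4 by rewrite divr_gt0.
have /cvgrPdist_le/(_ _ e4)[n _ Hn] := cT.
have /cvgrPdist_le/(_ _ e4)[m1 _ H1] := cA.
have /cvgrPdist_le/(_ _ e4)[m2 _ H2] := cJ.
have /cvgrPdist_le/(_ _ e4)[m3 _ H3] := cS.
have [m mm fr] := freq n (maxn m1 (maxn m2 m3)).
move: mm; rewrite !geq_max => /and3P[mm1 mm2 mm3].
have := grid_error fr.
have := Hn n (leqnn n); have := H1 m mm1; have := H2 m mm2; have := H3 m mm3.
rewrite /= !sub0r !normrN.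
move: (Rint _ _ (gm m)) (Rint _ _ (Gm m)) (C * _ * _ * _) (2 * C * _) => a b c d h3 h2 h1 hn h.
have -> : psi (X t, Z t) - psi (X 0, Z 0) - A - J =
  (psi (X t, Z t) - psi (X 0, Z 0) - a - b) - (A - a) - (J - b) by ring.
apply: le_trans (ler_normB _ _) _; apply: (@le_trans _ _ (e / 4 + e / 4 + e / 4 + e / 4)); last by lra.
apply: lerD => //; apply: le_trans (ler_normB _ _) _; apply: lerD => //.
apply: le_trans h _; apply: lerD.
  by apply: le_trans h3; exact: ler_norm.
by apply: le_trans hn; exact: ler_norm.
Qed.
End withC.

Theorem path_ito : [/\ rintble (@lebR R) (L 0 t) gdr, rintble M (E 0 t) Gj &
  psi (X t, Z t) = psi (X 0, Z 0) + Rint (@lebR R) (L 0 t) gdr + Rint M (E 0 t) Gj].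
Proof.
have [C [C0 pC dC ddC]] := C2c_bounds psi2.
have [H1 H2] := ito_integrable C0 dC.
by split => //; exact: (ito C0 dC ddC).
Qed.

Let mZL m : measurable_fun [set: R] (fun s => n1 (Z s - Z (gridL t m s))).
Proof.
apply: (@measurable_fun_grid R _ _ _ _ (cell (step t m)) (fun k s => n1 (Z s - Z (k%:~R * step t m)))).
  by apply: measurable_cell; exact: step_gt0.
move=> k; rewrite /n1 /=; apply: measurable_funD; first apply: measurable_funD.
- by apply: measurableT_comp => //; apply: measurable_funB => //; exact: (@measurable_path_coord (fun v => v.1.1)).
- by apply: measurableT_comp => //; apply: measurable_funB => //; exact: (@measurable_path_coord (fun v => v.1.2)).
- by apply: measurableT_comp => //; apply: measurable_funB => //; exact: (@measurable_path_coord (fun v => v.2)).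
Qed.

Lemma n1B (y y' : V3 R) : n1 (y - y') <= n1 y + n1 y'.
Proof.
rewrite /n1 /=; have := ler_normB y.1.1 y'.1.1; have := ler_normB y.1.2 y'.1.2; have := ler_normB y.2 y'.2.
by lra.
Qed.

Lemma n1_eq0 (y : V3 R) : n1 y = 0 -> y = 0.
Proof.
rewrite /n1; case: y => -[a b] e /= H.
have := normr_ge0 a; have := normr_ge0 b; have := normr_ge0 e => e0 b0 a0.
have /normr0_eq0 -> : `|a| = 0 by lra.
have /normr0_eq0 -> : `|b| = 0 by lra.
by have /normr0_eq0 -> : `|e| = 0 by lra.
Qed.

Let ZL_cvg s : L 0 t s -> n1 (Z s - Z (gridL t m s)) @[m --> \oo] --> n1 (Z s - LZ s).
Proof.
move=> [_ /= s0t].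
have cZ : Z (gridL t m s) @[m --> \oo] --> LZ s.
  by apply: (cvg_comp (fun m => gridL t m s) Z); [exact: gridL_cvg|exact: Zl].
have c (h : V3 R -> R) : (forall y y', h (y - y') = h y - h y') -> continuous h ->
    `|h (Z s - Z (gridL t m s))| @[m --> \oo] --> `|h (Z s - LZ s)|.
  move=> hB hc; apply: cvg_norm; under eq_fun do rewrite hB; rewrite hB.
  by apply: cvgB; [exact: cvg_cst|apply: (cvg_comp _ h cZ); exact: hc].
rewrite /n1; apply: cvgD; first apply: cvgD.
- exact: (c (fun v => v.1.1)).
- exact: (c (fun v => v.1.2)).
- exact: (c (fun v => v.2)).
Qed.

(* The integral over ]0, t] of the increments along a grid of mesh h is at most h times
   the total variation, so in the limit Z has no jump at almost every time. *)
Lemma left_limit_ae : {ae (@lebR R), forall s, L 0 t s -> LZ s = Z s}.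
Proof.
have t0' := ltW t0.
have iN : rintble M (E 0 t) (fun p => n1 (j p)) by apply: rintble_n1.
have bK m s : `|n1 (Z s - Z (gridL t m s))| <= K + K.
  rewrite ger0_norm ?n1_ge0//; apply: le_trans (n1B _ _) _; exact: lerD.
have iKK a b : a <= b -> rintble (@lebR R) (L a b) (cst (K + K)).
  by move=> ab; apply: rintble_cst => //; exact: lebLoo.
have ig m a b : a <= b -> rintble (@lebR R) (L a b) (fun s => n1 (Z s - Z (gridL t m s))).
  move=> ab; apply: rintble_le (iKK _ _ ab) => //; apply: measurable_funTS; exact: mZL.
have mg : measurable_fun (L 0 t) (fun s => n1 (Z s - LZ s)).
  by apply: (measurable_fun_cvg (fun m => measurable_funTS (mZL m))) => s; exact: ZL_cvg.
have c1 : Rint (@lebR R) (L 0 t) (fun s => n1 (Z s - Z (gridL t m s))) @[m --> \oo] -->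
    Rint (@lebR R) (L 0 t) (fun s => n1 (Z s - LZ s)).
  apply: (@Rint_dct _ _ _ _ _ _ _ (cst (K + K))) => //.
  - by move=> m; apply: measurable_funTS; exact: mZL.
  - exact: iKK.
have le m : Rint (@lebR R) (L 0 t) (fun s => n1 (Z s - Z (gridL t m s))) <=
    step t m * Rint M (E 0 t) (fun p => n1 (j p)).
  have h0 := step_gt0 m t0.
  rewrite (Rint_grid (@measurable_id _ R setT) measurableT m t0 (ig m _ _ t0')).
  rewrite (Rint_grid (@measurable_ps R) mD m t0 iN) mulr_sumr; apply: ler_sum => k _.
  set a := k%:R * _; set b := k.+1%:R * _.
  have a0 : 0 <= a by rewrite mulr_ge0// ltW.
  have ab : a <= b by rewrite ler_pM2r// ler_nat.
  have bt : b <= t by rewrite -[leRHS](stepE t m) ler_pM2r// ler_nat.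
  have ba : b - a = step t m by rewrite /b -natr1 mulrDl mul1r [_ + step t m]addrC addrK.
  set J := Rint M (E a b) (fun p => n1 (j p)).
  apply: (@le_trans _ _ (Rint (@lebR R) (L a b) (cst J))); last first.
    by rewrite Rint_cst// [X in fine X](lebL ab) /= ba mulrC.
  apply: Rint_le => //; [exact: ig|by apply: rintble_cst => //; exact: lebLoo|].
  move=> s [_ /= sab]; rewrite (@gridL_nat _ _ _ k)//.
  have [as' sb] : a <= s /\ s <= b by case/andP: sab => /ltW.
  rewrite (ZE a0 as' (le_trans sb bt)) addrAC subrr add0r.
  have sub1 : E a s `<=` E 0 t by apply: slab_sub => //; exact: le_trans bt.
  have sub2 : E a b `<=` E 0 t by exact: slab_sub.
  have k0 := rintbleS (mE 0 t) (mE a s) sub1 j0.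
  have k1 := rintbleS (mE 0 t) (mE a s) sub1 j1.
  have k2 := rintbleS (mE 0 t) (mE a s) sub1 j2.
  apply: le_trans (n1_Rint3 (mE a s) k0 k1 k2 (mE a s) (@subset_refl _ _)) _.
  rewrite /J (Rint_slab_cat (@measurable_ps R) mD as' sb (rintbleS (mE 0 t) (mE a b) sub2 iN)).
  by rewrite lerDl; apply: Rint_ge0 => p _; exact: n1_ge0.
have c0 : step t m * Rint M (E 0 t) (fun p => n1 (j p)) @[m --> \oo] --> (0 : R).
  move: (Rint M _ _) => V; suff: step t m * V @[m --> \oo] --> 0 * V by rewrite mul0r.
  by apply: cvgMl; exact: step_cvg0.
have I0 : Rint (@lebR R) (L 0 t) (fun s => n1 (Z s - LZ s)) = 0.
  apply/le_anti/andP; split; last by apply: Rint_ge0 => s _; exact: n1_ge0.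
  by apply: (ler_cvg_to c1 c0); apply: nearW.
have ilim : rintble (@lebR R) (L 0 t) (fun s => n1 (Z s - LZ s)).
  apply: rintble_le (iKK _ _ t0') => // s Ls; rewrite ger0_norm ?n1_ge0//.
  apply: (ler_cvg_to (ZL_cvg Ls) (cvg_cst (K + K))); apply: nearW => m.
  by apply: le_trans (bK m s); exact: ler_norm.
have : ae_eq (@lebR R) (L 0 t) (fun s => (n1 (Z s - LZ s))%:E) (cst 0%E).
  apply/ae_eq_integral_abs => //; first exact/measurable_EFinP.
  transitivity (\int[@lebR R]_(s in L 0%R t) (n1 (Z s - LZ s))%:E)%E.
    by apply: eq_integral => s _; rewrite gee0_abs// lee_fin n1_ge0.
  by rewrite -Rint_EFin// I0.
apply: filterS => s H Ls; have /n1_eq0/eqP : n1 (Z s - LZ s) = 0 by apply: EFin_inj; exact: H.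
by rewrite subr_eq0 => /eqP.
Qed.

End path.

(** * Collision geometry and moment bounds *)

Section geometry.
Context {R : realType}.
Implicit Types (w x z v : V3 R) (th ph : R).

Lemma dot3_ge0 w : 0 <= dot3 w w.
Proof. by rewrite /dot3 -!expr2 !addr_ge0// sqr_ge0. Qed.

Lemma enorm_ge0 w : 0 <= enorm w. Proof. exact: sqrtr_ge0. Qed.

Lemma enorm_sqr w : enorm w ^+ 2 = dot3 w w.
Proof. by rewrite /enorm sqr_sqrtr// dot3_ge0. Qed.

Lemma enorm_coord w : [/\ `|w.1.1| <= enorm w, `|w.1.2| <= enorm w & `|w.2| <= enorm w].
Proof.
have h a b : 0 <= b -> `|a| <= Num.sqrt (a ^+ 2 + b).
  by move=> b0; rewrite -sqrtr_sqr ler_wsqrtr// lerDl.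
have s0 := sqr_ge0 w.1.1; have s1 := sqr_ge0 w.1.2; have s2 := sqr_ge0 w.2.
split; rewrite /enorm /dot3 -!expr2.
- by rewrite -addrA h// addr_ge0.
- by rewrite -addrA addrCA h// addr_ge0.
- by rewrite addrC h// addr_ge0.
Qed.

Lemma n1_enorm w : n1 w <= 3 * enorm w.
Proof. by have [a b c] := enorm_coord w; rewrite /n1; lra. Qed.

Lemma n1_le_sqr w : n1 w <= 3 * (1 + enorm w ^+ 2).
Proof.
apply: le_trans (n1_enorm w) _; rewrite ler_wpM2l//.
have := enorm_ge0 w; have := sqr_ge0 (enorm w - 1); nra.
Qed.

Lemma enormBC x z : enorm (x - z) = enorm (z - x).
Proof. by rewrite /enorm; congr Num.sqrt; rewrite /dot3 /=; ring. Qed.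

Lemma enormB_sqr x z : enorm (x - z) ^+ 2 <= 2 * (enorm x ^+ 2 + enorm z ^+ 2).
Proof.
rewrite !enorm_sqr /dot3 /=.
have := sqr_ge0 (x.1.1 + z.1.1); have := sqr_ge0 (x.1.2 + z.1.2); have := sqr_ge0 (x.2 + z.2).
rewrite !expr2; nra.
Qed.

Lemma sin_ge0_le th : 0 <= th -> sin th <= th.
Proof.
move=> th0; have := @MVT_segment R (@sin R) (@cos R) 0 th th0 (fun u _ => is_derive_sin u) _.
case; first by apply: continuous_subspaceT; exact: continuous_sin.
move=> c _; rewrite sin0 !subr0 => ->.
by rewrite ler_piMl// (le_trans (ler_norm _))// cos_max.
Qed.

Section frame.
Variables (I J : V3 R -> V3 R).
Hypothesis IJ : frame I J.

(** Linear in theta, to match the integrability of theta against Q. Both sin^2(theta/2) and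
    sin(theta)/2 are at most theta/2, and the frame vectors have the length of v - z. Each
    coordinate is thus at most 3/2 theta |z - v|, rounded up to 3, and there are three coordinates.
    The case v = z is excluded, since [frame] constrains I and J only off 0. *)
Lemma n1_alpha z v th ph : 0 < th <= pi -> v - z != 0 ->
  n1 (alpha I J z v th ph) <= 9 * th * enorm (z - v).
Proof.
move=> /andP[th0 thpi] w0; have [_ [_ /(_ _ w0)[_ _ _ EI EJ]]] := IJ.
rewrite enormBC; set w := v - z in w0 EI EJ *.
have eI : enorm (I w) = enorm w by rewrite /enorm EI.
have eJ : enorm (J w) = enorm w by rewrite /enorm EJ.
have e0 := enorm_ge0 w.
have s1 : `|sin th / 2| <= th / 2.
  have s0 : 0 <= sin th by apply: sin_ge0_pi; rewrite ltW.
  by rewrite ger0_norm ?divr_ge0// ler_pM2r ?invr_gt0//; apply: sin_ge0_le; exact: ltW.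
have s2 : `|sin (th / 2) ^+ 2| <= th / 2.
  have t2 : 0 <= th / 2 by rewrite divr_ge0// ltW.
  have s0 : 0 <= sin (th / 2) by apply: sin_ge0_pi; rewrite t2 /=; lra.
  rewrite ger0_norm ?sqr_ge0// expr2; apply: (@le_trans _ _ (sin (th / 2) * 1)).
    by rewrite ler_wpM2l// sin_le1.
  by rewrite mulr1; exact: sin_ge0_le.
have H a b c : `|a| <= enorm w -> `|b| <= enorm w -> `|c| <= enorm w ->
    `|sin (th / 2) ^+ 2 * a + sin th / 2 * (cos ph * b + sin ph * c)| <= 3 * th * enorm w.
  move=> ha hb hc; apply: le_trans (ler_normD _ _) _; rewrite [X in X + _]normrM [X in _ + X]normrM.
  have k1 : `|sin (th / 2) ^+ 2| * `|a| <= th / 2 * enorm w by apply: ler_pM.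
  have k2 : `|cos ph * b + sin ph * c| <= enorm w + enorm w.
    apply: le_trans (ler_normD _ _) _; rewrite !normrM.
    by apply: lerD; [rewrite -[enorm w]mul1r; apply: ler_pM => //; exact: cos_max|
      rewrite -[enorm w]mul1r; apply: ler_pM => //; exact: sin_max].
  have k3 : `|sin th / 2| * `|cos ph * b + sin ph * c| <= th / 2 * (enorm w + enorm w) by apply: ler_pM.
  have : 0 <= th * enorm w by rewrite mulr_ge0// ltW.
  by move: k1 k3; lra.
have [a1 a2 a3] := enorm_coord w; have [b1 b2 b3] := enorm_coord (I w); have [c1 c2 c3] := enorm_coord (J w).
rewrite eI in b1 b2 b3; rewrite eJ in c1 c2 c3.
have h1 := H _ _ _ a1 b1 c1; have h2 := H _ _ _ a2 b2 c2; have h3 := H _ _ _ a3 b3 c3.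
have -> : 9 * th * enorm w = 3 * th * enorm w + 3 * th * enorm w + 3 * th * enorm w by ring.
by rewrite /n1; apply: lerD => //; exact: lerD.
Qed.

Section meas.
Context d (S : measurableType d).

Lemma measurable_V3 (h : S -> V3 R) : measurable_fun setT (fun s => (h s).1.1) ->
  measurable_fun setT (fun s => (h s).1.2) -> measurable_fun setT (fun s => (h s).2) ->
  measurable_fun setT h.
Proof.
move=> m1 m2 m3; have -> : h = fun s => (((h s).1.1, (h s).1.2), (h s).2).
  by apply/funext => s; case: (h s) => -[].
by apply: measurable_fun_pair => //; exact: measurable_fun_pair.
Qed.

Lemma measurable_V3_coord (h : S -> V3 R) : measurable_fun setT h ->
  [/\ measurable_fun setT (fun s => (h s).1.1), measurable_fun setT (fun s => (h s).1.2) &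
   measurable_fun setT (fun s => (h s).2)].
Proof.
move=> mh; have m1 := measurableT_comp measurable_fst mh.
by split; [exact: (measurableT_comp measurable_fst m1)|exact: (measurableT_comp measurable_snd m1)|
  exact: (measurableT_comp measurable_snd mh)].
Qed.

Lemma measurable_V3D (g h : S -> V3 R) : measurable_fun setT g -> measurable_fun setT h ->
  measurable_fun setT (fun s => g s + h s).
Proof.
move=> /measurable_V3_coord[g1 g2 g3] /measurable_V3_coord[h1 h2 h3].
by apply: measurable_V3 => /=; exact: measurable_funD.
Qed.

Lemma measurable_V3B (g h : S -> V3 R) : measurable_fun setT g -> measurable_fun setT h ->
  measurable_fun setT (fun s => g s - h s).
Proof.
move=> /measurable_V3_coord[g1 g2 g3] /measurable_V3_coord[h1 h2 h3].
by apply: measurable_V3 => /=; exact: measurable_funB.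
Qed.

Lemma measurable_V3Z (k : S -> R) (h : S -> V3 R) : measurable_fun setT k -> measurable_fun setT h ->
  measurable_fun setT (fun s => k s *: h s).
Proof.
move=> mk /measurable_V3_coord[h1 h2 h3].
by apply: measurable_V3 => /=; exact: measurable_funM.
Qed.

Lemma measurable_enorm (h : S -> V3 R) : measurable_fun setT h -> measurable_fun setT (fun s => enorm (h s)).
Proof.
move=> /measurable_V3_coord[h1 h2 h3].
apply: (measurableT_comp (f := @Num.sqrt R)); first by apply: continuous_measurable_fun; exact: sqrt_continuous.
by rewrite /dot3; apply: measurable_funD; [apply: measurable_funD|]; exact: measurable_funM.
Qed.

Lemma measurable_alpha (z v : S -> V3 R) (th ph : S -> R) : measurable_fun setT z -> measurable_fun setT v ->
  measurable_fun setT th -> measurable_fun setT ph ->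
  measurable_fun setT (fun s => alpha I J (z s) (v s) (th s) (ph s)).
Proof.
move=> mz mv mth mph; have [mI [mJ _]] := IJ.
have ms : measurable_fun [set: R] (@sin R) by apply: continuous_measurable_fun; exact: continuous_sin.
have mc : measurable_fun [set: R] (@cos R) by apply: continuous_measurable_fun; exact: continuous_cos.
have mw : measurable_fun setT (fun s => v s - z s) by exact: measurable_V3B.
apply: measurable_V3D; apply: measurable_V3Z => //.
- apply: measurable_funX; apply: (measurableT_comp ms); exact: measurable_funM.
- by apply: measurable_funM => //; exact: (measurableT_comp ms mth).
- apply: measurable_V3D; apply: measurable_V3Z.
  + exact: (measurableT_comp mc mph).
  + exact: (measurableT_comp mI mw).
  + exact: (measurableT_comp ms mph).
  + exact: (measurableT_comp mJ mw).
Qed.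
End meas.
End frame.
End geometry.

Lemma sprod_rect d1 d2 (T1 : measurableType d1) (T2 : measurableType d2) (R : realType)
  (m1 : {sigma_finite_measure set T1 -> \bar R}) (m2 : {sigma_finite_measure set T2 -> \bar R}) A B :
  measurable A -> measurable B -> sprod m1 m2 (A `*` B) = (m1 A * m2 B)%E.
Proof. exact: product_measure1E. Qed.

(** * Uniform moment bounds on the density *)

Section moments.
Context {R : realType}.
Definition box3 (r : R) : set (V3 R) := (`[- r, r] `*` `[- r, r]) `*` `[- r, r].

Lemma box3P r (x : V3 R) : box3 r x <-> [/\ `|x.1.1| <= r, `|x.1.2| <= r & `|x.2| <= r].
Proof.
rewrite /box3 /= !in_itv /= -!ler_norml; split; first by move=> [[]].
by move=> [].
Qed.

Lemma compact_box3 r : compact (box3 r).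
Proof. by apply: compact_setX; [apply: compact_setX|]; exact: segment_compact. Qed.

Lemma measurable_box3 r : measurable (box3 r).
Proof. by apply: measurableX; [apply: measurableX|]; exact: measurable_itv. Qed.

Lemma lebv_box3 r : 0 <= r -> (lebv (box3 r) < +oo)%E.
Proof.
move=> r0; have rr : - r <= r by rewrite (le_trans _ r0)// oppr_le0.
pose i : set R := `[- r, r]%classic.
have mi : measurable i by exact: measurable_itv.
have lr : lebR i = (r - - r)%:E := lebR_itv true false rr.
have -> : lebv (box3 r) = (lebR i * lebR i * lebR i)%E.
  transitivity ((sprod (@lebR R) (@lebR R) (i `*` i)) * lebR i)%E.
    by apply: sprod_rect => //; exact: measurableX.
  by congr (_ * _)%E; exact: sprod_rect.
by rewrite lr -!EFinM ltry.
Qed.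

(** Only the position is confined. A collision leaves it unchanged, so outside the box both terms of
    the collision difference vanish. *)
Lemma support_box (psi : V3 R * V3 R -> R) : C2c psi ->
  exists r, 0 <= r /\ forall q, ~ box3 r q.1 -> psi q = 0.
Proof.
move=> [_ _ [K [cK K0]]]; have [r0 [_ Hr]] := compact_bounded cK.
pose r := Num.max 0 (r0 + 1).
have rr : r0 < r by rewrite lt_max ltrDl ltr01 orbT.
exists r; split; first by rewrite le_max lexx.
move=> q nb; apply: K0 => Kq; apply: nb; apply/box3P.
have := Hr r rr q Kq; case: q {Kq} => [[[a b] c] z] /=.
rewrite !prod_normE /= !ge_max => /andP[/andP[/andP[? ?] ?] _]; by split.
Qed.

Lemma max_on_compact (S : topologicalType) (A : set S) (g : S -> R) : compact A -> continuous g ->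
  exists C, 0 <= C /\ forall x, A x -> g x <= C.
Proof.
move=> cA cg; have [A0|/set0P An0] := eqVneq A set0; first by exists 0; rewrite A0.
have cw : {within A, continuous g} by exact: continuous_subspaceT.
have [y _ ymax] := compact_EVT_max An0 cA cw.
exists (Num.max 0 (g y)); split; first by rewrite le_max lexx.
by move=> x Ax; rewrite le_max ymax ?orbT//; exact/mem_set.
Qed.

Variables (T : R) (f : R -> V3 R -> V3 R -> R).
Hypothesis T0 : 0 < T.
Hypothesis fprob : prob_densities T f.
Hypothesis fcont : cont_on T f.
Hypothesis fB2 : B2 T f.

Let f0 := fclamp_ge0 T0 fprob.
Let mf := measurable_fclamp T0 fcont.

Lemma measurable_fclamp_v s x : measurable_fun [set: V3 R] (fun v => fclamp T f (s, (x, v))).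
Proof. by apply: (measurableT_comp mf); apply: measurable_fun_pair => //; exact: measurable_fun_pair. Qed.

Lemma measurable_enorm2f s x : measurable_fun [set: V3 R] (fun v => enorm v ^+ 2 * fclamp T f (s, (x, v))).
Proof.
apply: measurable_funM; last exact: measurable_fclamp_v.
by apply: measurable_funX; exact: measurable_enorm.
Qed.

(** The function of time in (B2) is continuous, hence bounded on [0, T], and it already contains the
    supremum over positions. *)
Lemma moment2 : exists G, 0 <= G /\ forall s x, (\int[lebv]_v (enorm v ^+ 2 * fclamp T f (s, (x, v)))%:E <= G%:E)%E.
Proof.
have [g [cg Hg]] := fB2.
have T0' : 0 <= T by exact: ltW.
have an0 : (`[0, T]%classic : set R) !=set0 by exists 0; rewrite /= in_itv /= lexx.
have [y _ ymax] := compact_EVT_max an0 (@segment_compact _ 0 T) cg.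
exists (Num.max 0 (g y)); split; first by rewrite le_max lexx.
move=> s x; have sT := clamp_itv s T0'.
apply: (@le_trans _ _ (g (clamp T s))%:E); last first.
  by rewrite lee_fin le_max ymax ?orbT//; apply/mem_set; rewrite /= in_itv.
rewrite -Hg//; apply: ereal_sup_ubound => /=; exists x => //.
rewrite -integral_lebv//; apply/measurable_EFinP; exact: measurable_enorm2f.
Qed.

(** Outside the unit box |v| exceeds 1 and f is dominated by |v|^2 f, which [moment2] controls.
    Inside it f is bounded by continuity on a compact set, and this is why the position is kept in a
    box. *)
Lemma moment0 r : 0 <= r -> exists M, 0 <= M /\ forall s x, box3 r x ->
  (\int[lebv]_v (fclamp T f (s, (x, v)))%:E <= M%:E)%E.
Proof.
move=> r0; have [G [G0 HG]] := moment2.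
have [C [C0 HC]] := max_on_compact (compact_setX (@segment_compact R 0 T) (compact_setX (@compact_box3 r) (@compact_box3 1)))
  (continuous_fclamp (ltW T0) fcont).
have b1 : (lebv (box3 1) < +oo)%E by exact: lebv_box3.
exists (C * fine (lebv (box3 1)) + G); split; first by rewrite addr_ge0// mulr_ge0// fine_ge0.
move=> s x xr.
apply: (@le_trans _ _ (\int[lebv]_v (C%:E * (\1_(box3 1) v)%:E + (enorm v ^+ 2 * fclamp T f (s, (x, v)))%:E))%E).
  apply: ge0_le_integral => //.
  - by move=> v _; rewrite lee_fin f0.
  - apply/measurable_EFinP; exact: measurable_fclamp_v.
  - apply: emeasurable_funD; last by apply/measurable_EFinP; exact: measurable_enorm2f.
    by apply: measurable_funeM; apply/measurable_EFinP; apply: measurable_indic; exact: measurable_box3.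
  move=> v _; rewrite -EFinM -EFinD lee_fin indicE; case: (boolP (v \in box3 1)) => [/set_mem vb|/negP vb].
    rewrite mulr1; apply: (@le_trans _ _ C); last by rewrite lerDl mulr_ge0// sqr_ge0.
    have -> : fclamp T f (s, (x, v)) = fclamp T f (clamp T s, (x, v)) by rewrite /fclamp /= (clamp_id (clamp_itv s (ltW T0))).
    by apply: HC; split => //=; rewrite in_itv /=; apply: clamp_itv; exact: ltW.
  rewrite mulr0 add0r ler_peMl//.
  rewrite exprn_ege1//.
  rewrite leNgt; apply/negP => v1; apply: vb; apply/mem_set/box3P.
  by have [a b c] := enorm_coord v; split; apply: le_trans (ltW v1).
rewrite ge0_integralD//; last 4 first.
- by move=> v _; rewrite -EFinM lee_fin mulr_ge0.
- by apply: measurable_funeM; apply/measurable_EFinP; apply: measurable_indic; exact: measurable_box3.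
- by move=> v _; rewrite lee_fin mulr_ge0// sqr_ge0.
- by apply/measurable_EFinP; exact: measurable_enorm2f.
rewrite EFinD; apply: leeD; last exact: HG.
rewrite ge0_integralZl_EFin//; last by apply/measurable_EFinP; apply: measurable_indic; exact: measurable_box3.
rewrite integral_indic ?setIT//; last exact: measurable_box3.
by rewrite EFinM fineK// ge0_fin_numE.
Qed.

End moments.

Section cont0.
Context {R : realType}.

Lemma lebv_box_at (x : V3 R) e : 0 < e ->
  let b := ((`[x.1.1 - e, x.1.1 + e] `*` `[x.1.2 - e, x.1.2 + e]) `*` `[x.2 - e, x.2 + e])%classic in
  measurable b /\ (0 < lebv b)%E.
Proof.
move=> e0 b; pose i (y : R) : set R := `[y - e, y + e]%classic.
have mi y : measurable (i y) by exact: measurable_itv.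
have li y : lebR (i y) = (y + e - (y - e))%:E by apply: (lebR_itv true false); lra.
split; first by apply: measurableX => //; exact: measurableX.
have -> : lebv b = (lebR (i x.1.1) * lebR (i x.1.2) * lebR (i x.2))%E.
  transitivity ((sprod (@lebR R) (@lebR R) (i x.1.1 `*` i x.1.2)) * lebR (i x.2))%E.
    by apply: sprod_rect => //; exact: measurableX.
  by congr (_ * _)%E; exact: sprod_rect.
by rewrite !li -!EFinM lte_fin !mulr_gt0//; lra.
Qed.

(** If g were positive at x, it would exceed g x / 2 on a box around x, which has positive
    measure. *)
Lemma continuous_integral_eq0 (g : V3 R -> R) : continuous g -> measurable_fun setT g -> (forall x, 0 <= g x) ->
  (\int[lebv]_x (g x)%:E = 0)%E -> forall x, g x = 0.
Proof.
move=> cg mg g0 I0 x; apply/eqP; rewrite eq_le g0 andbT leNgt; apply/negP => gx.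
have gx2 : 0 < g x / 2 by rewrite divr_gt0.
have /cvgrPdist_lt/(_ _ gx2) := cg x.
rewrite nearE -nbhs_ballE => -[e /= e0 He].
have e20 : 0 < e / 2 by rewrite divr_gt0.
have /= := lebv_box_at x e20; set b := (X in measurable X) => -[mb b0].
have bg y : b y -> g x / 2 <= g y.
  move=> [[/= y1 y2] y3].
  have : `|g x - g y| < g x / 2.
    apply: He; move: y1 y2 y3; rewrite /= !in_itv /= => /andP[? ?] /andP[? ?] /andP[? ?].
    split; first split; rewrite /ball /= ltr_norml; apply/andP; split; lra.
  rewrite ltr_norml => /andP[_]; lra.
have : ((g x / 2)%:E * lebv b <= \int[lebv]_y (g y)%:E)%E.
  rewrite -integral_cst//; apply: (@le_trans _ _ (\int[lebv]_(y in b) (g y)%:E)%E).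
    apply: ge0_le_integral => //.
    - by move=> y _; rewrite lee_fin ltW.
    - by apply: measurable_funTS; exact/measurable_EFinP.
  apply: ge0_subset_integral => //; first exact/measurable_EFinP.
  by move=> y _; rewrite lee_fin.
rewrite I0 leNgt => /negP; apply; exact: mule_gt0.
Qed.
End cont0.

Lemma measurable_invr (R : realType) : measurable_fun [set: R] (fun y : R => y^-1).
Proof.
have -> : [set: R] = [set 0] `|` ~` [set 0] by rewrite setUv.
apply/measurable_funU => //; first exact: measurableC.
split; first exact: measurable_fun_set1.
apply: open_continuous_measurable_fun; first by apply: closed_openC; exact: closed_eq.
by move=> y /set_mem/= /eqP y0; apply: cvgV => //; exact: cvg_id.
Qed.

(** * The collision operator *)

Section lambda.
Context {R : realType}.
Variables (Q : {sigma_finite_measure set R -> \bar R}) (c : R) (I J : V3 R -> V3 R).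
Variables (T : R) (f : R -> V3 R -> V3 R -> R) (psi : V3 R * V3 R -> R).
Hypothesis QA : hypA' Q c.
Hypothesis IJ : frame I J.
Hypothesis T0 : 0 < T.
Hypothesis fprob : prob_densities T f.
Hypothesis fcont : cont_on T f.
Hypothesis fB2 : B2 T f.
Hypothesis psi2 : C2c psi.

Notation CP := (V3 R * R * R)%type.
Notation SQ := (R * (V3 R * V3 R))%type.

Definition jumpH (q : V3 R * V3 R) (p : CP) : R := psi (q.1, zstar I J q.2 p.1.1 p.1.2 p.2) - psi q.
Definition rate (u : SQ) (v : V3 R) : R := fclamp T f (u.1, (u.2.1, v)) * sigmaK c (enorm (u.2.2 - v)).
Definition lam (u : SQ) (p : CP) : R := jumpH u.2 p * rate u p.1.1.
(** For e = 1 and e = -1 these are the positive and the negative part of [lam] on the collision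
    parameters, extended by 0 to the whole space. *)
Definition lampos (e : R) (u : SQ) (p : CP) : R := \1_(Xi3 (R := R)) p * Num.max (e * lam u p) 0.

Lemma measurable_Xi3 : measurable (Xi3 (R := R)).
Proof.
have -> : Xi3 (R := R) = (fun p => p.1.2) @^-1` `]0, pi] `&` (fun p => p.2) @^-1` `[0, 2 * pi[.
  by apply/seteqP; split => p /=; rewrite /Xi3 /= !in_itv.
apply: measurableI; rewrite -[X in measurable X]setTI.
  by apply: (measurableT_comp measurable_snd measurable_fst).
exact: measurable_snd.
Qed.

Lemma c_gt0 : 0 < c. Proof. by have [] := QA. Qed.

Lemma rate_ge0 u v : 0 <= rate u v.
Proof. by rewrite mulr_ge0 ?(fclamp_ge0 T0)// mulr_ge0 ?enorm_ge0// ltW// c_gt0. Qed.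

Section meas.
Context d (S : measurableType d).
Variables (q : S -> V3 R * V3 R) (p : S -> CP) (s : S -> R).
Hypotheses (mq : measurable_fun setT q) (mp : measurable_fun setT p) (ms : measurable_fun setT s).

Let mv : measurable_fun setT (fun y => (p y).1.1).
Proof. by apply: (measurableT_comp measurable_fst); exact: (measurableT_comp measurable_fst mp). Qed.
Let mx : measurable_fun setT (fun y => (q y).1).
Proof. exact: (measurableT_comp measurable_fst mq). Qed.
Let mz : measurable_fun setT (fun y => (q y).2).
Proof. exact: (measurableT_comp measurable_snd mq). Qed.

Lemma measurable_jumpH : measurable_fun setT (fun y => jumpH (q y) (p y)).
Proof.
have mpsi : measurable_fun setT psi by apply: continuous_measurable6; case: psi2.
apply: measurable_funB; last exact: (measurableT_comp mpsi mq).
apply: (measurableT_comp mpsi); apply: measurable_fun_pair => //.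
apply: measurable_V3D => //; apply: measurable_alpha => //.
- by apply: (measurableT_comp measurable_snd); exact: (measurableT_comp measurable_fst mp).
- exact: (measurableT_comp measurable_snd mp).
Qed.

Lemma measurable_rate : measurable_fun setT (fun y => rate (s y, q y) (p y).1.1).
Proof.
apply: measurable_funM => /=.
  apply: (measurableT_comp (measurable_fclamp T0 fcont)); apply: measurable_fun_pair => //.
  exact: measurable_fun_pair.
by apply: measurable_funM => //; apply: measurable_enorm; exact: measurable_V3B.
Qed.

Lemma measurable_lam : measurable_fun setT (fun y => lam (s y, q y) (p y)).
Proof. by apply: measurable_funM; [exact: measurable_jumpH|exact: measurable_rate]. Qed.

Lemma measurable_lampos e : measurable_fun setT (fun y => lampos e (s y, q y) (p y)).
Proof.
apply: measurable_funM.
  by apply: (measurableT_comp _ mp); apply: measurable_indic; exact: measurable_Xi3.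
by apply: measurable_maxr => //; apply: measurable_funM => //; exact: measurable_lam.
Qed.
End meas.

Lemma lampos_ge0 e u p : 0 <= lampos e u p.
Proof. by rewrite /lampos mulr_ge0// le_max lexx orbT. Qed.

Definition Lam (e : R) (u : SQ) : \bar R := (\int[collM Q]_p (lampos e u p)%:E)%E.

Lemma measurable_Lam e : measurable_fun [set: SQ] (Lam e).
Proof.
have mg : measurable_fun [set: SQ * CP] (fun y => (lampos e y.1 y.2)%:E).
  apply/measurable_EFinP.
  have -> : (fun y : SQ * CP => lampos e y.1 y.2) = (fun y => lampos e (y.1.1, y.1.2) y.2) by apply/funext => -[[]].
  apply: measurable_lampos => //; [exact: (measurableT_comp measurable_snd measurable_fst)|
    exact: (measurableT_comp measurable_fst measurable_fst)].
by apply: (@measurable_fun_fubini_tonelli_F _ _ _ _ R (collM Q) _ mg) => u; rewrite lee_fin lampos_ge0.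
Qed.

Lemma Lam_ge0 e u : (0 <= Lam e u)%E.
Proof. by apply: integral_ge0 => p _; rewrite lee_fin lampos_ge0. Qed.

(** The increment of psi is at most 9 C theta |z - v| and the rate contributes another factor c |z -
    v|. The resulting |z - v|^2 is at most 2 (|z|^2 + |v|^2), which the moments of order 0 and 2 of
    f absorb; theta is integrable against Q on ]0, pi]. *)
Lemma Lam_bound : exists K, 0 <= K /\ forall u, (\int[collM Q]_(p in Xi3 (R := R)) `|lam u p|%:E <= (K * (1 + enorm u.2.2 ^+ 2))%:E)%E.
Proof.
have [C [C0 pC dC ddC]] := C2c_bounds psi2.
have [r [r0 Hr]] := support_box psi2.
have [G [G0 HG]] := moment2 T0 fcont fB2.
have [M [M0 HM]] := moment0 T0 fprob fcont fB2 r0.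
have c0 := c_gt0.
have [_ _ Qth _] := QA.
have q1fin := Qth _ (pi_gt0 R).
set q1 := (\int[Q]_(x in `]0%R, pi%R]) x%:E)%E in q1fin.
have q10 : (0 <= q1)%E by apply: integral_ge0 => x /=; rewrite in_itv /= lee_fin => /andP[/ltW].
(* The factor 18 is 9 from [n1_alpha] times 2 from [enormB_sqr]. *)
have [A [AE A0]] : exists A, A = 18 * C * c /\ 0 <= A.
  by exists (18 * C * c); split => //; rewrite !mulr_ge0// ltW.
have fq0 : 0 <= fine q1 by exact: fine_ge0.
have pi2 : 0 <= 2 * pi :> R by rewrite mulr_ge0// pi_ge0.
have K0 := mulr_ge0 (mulr_ge0 (mulr_ge0 A0 (addr_ge0 M0 G0)) fq0) pi2.
exists (A * (M + G) * fine q1 * (2 * pi)); split; first exact: K0.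
move=> [s [x z]] /=.
have f0 := fclamp_ge0 T0 fprob.
have [xr|xr] := pselect (box3 r x); last first.
  rewrite integral0_eq; first by rewrite lee_fin mulr_ge0// addr_ge0// sqr_ge0.
  by move=> p _; rewrite /lam /jumpH /= !Hr// subrr mul0r normr0.
pose a (v : V3 R) : \bar R := ((A * (enorm z ^+ 2)) * fclamp T f (s, (x, v)) + A * (enorm v ^+ 2 * fclamp T f (s, (x, v))))%:E.
pose th (y : R) : \bar R := (\1_(`]0, pi]) y * y)%:E.
pose ph (y : R) : \bar R := (\1_(`[0, 2 * pi]) y)%:E.
have ma : measurable_fun setT a.
  apply/measurable_EFinP; apply: measurable_funD; apply: measurable_funM => //.
    exact: measurable_fclamp_v.
  exact: measurable_enorm2f.
have mth : measurable_fun setT th by apply/measurable_EFinP; apply: measurable_funM => //; exact: measurable_indic.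
have mph : measurable_fun setT ph by apply/measurable_EFinP; exact: measurable_indic.
have a0' v : 0 <= A * enorm z ^+ 2 * fclamp T f (s, (x, v)) + A * (enorm v ^+ 2 * fclamp T f (s, (x, v))).
  by rewrite addr_ge0// !mulr_ge0// ?enorm_ge0.
have a0 v : (0 <= a v)%E by rewrite lee_fin a0'.
have th0 y : (0 <= th y)%E.
  rewrite lee_fin indicE; case: (boolP (y \in _)) => [/set_mem/=|_]; last by rewrite mul0r.
  by rewrite in_itv /= mul1r => /andP[/ltW].
have ph0 y : (0 <= ph y)%E by rewrite lee_fin.
have mat : measurable_fun [set: V3 R * R] (fun y => (a y.1 * th y.2)%E).
  by apply: emeasurable_funM; [exact: (measurableT_comp ma measurable_fst)|exact: (measurableT_comp mth measurable_snd)].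
apply: (@le_trans _ _ (\int[collM Q]_p (a p.1.1 * th p.1.2 * ph p.2))%E).
  rewrite integral_mkcond; apply: ge0_le_integral => //.
  - by move=> p _; rewrite patchE; case: ifPn.
  - apply/(measurable_restrictT _ _).1; first exact: measurable_Xi3.
    apply: measurable_funTS; apply/measurable_EFinP; apply: measurableT_comp => //.
    by apply: (@measurable_lam _ _ (cst (x, z)) id (cst s)).
  - by apply: emeasurable_funM; [exact: (measurableT_comp mat measurable_fst)|exact: (measurableT_comp mph measurable_snd)].
  move=> [[v y] p] _; rewrite patchE; case: ifPn => [/set_mem[/= yI pI]|_]; last by rewrite !mule_ge0.
  have i1 : \1_(`]0, pi]) y = 1 :> R by rewrite indicE mem_set//= in_itv.
  have i2 : \1_(`[0, 2 * pi]) p = 1 :> R.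
    by rewrite indicE mem_set//= in_itv /=; case/andP: pI => -> /ltW.
  rewrite /th /ph i1 i2 mul1r mule1.
  rewrite /a -EFinM lee_fin /lam normrM (ger0_norm (rate_ge0 _ _)) /rate /sigmaK /=.
  have y0 : 0 < y by case/andP: yI.
  (* At v = z the frame is unconstrained and alpha has no bound, but there the collision rate is
     0. *)
  have [vz|vz] := eqVneq (v - z) 0.
    have -> : z - v = 0 by rewrite -opprB vz oppr0.
    have -> : enorm (0 : V3 R) = 0 by rewrite /enorm /dot3 /= !mulr0 !addr0 sqrtr0.
    by rewrite !mulr0 mulr_ge0 ?(ltW y0)//; exact: a0'.
  have e0 := enorm_ge0 (z - v).
  have L : `|jumpH (x, z) (v, y, p)| <= C * (9 * y * enorm (z - v)).
    rewrite /jumpH /= /zstar.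
    have := lip6 (g := psi) (C := C) _ dC x z 0 (alpha I J z v y p); rewrite addr0.
    have -> : n1 (0 : V3 R) = 0 by rewrite /n1 /= normr0 !addr0.
    rewrite add0r => H; apply: le_trans (H _) _.
      by move=> i q; have [_ D _] := psi2; have [dd _ _ _] := D i i; exact: dd.
    by rewrite ler_wpM2l// n1_alpha.
  apply: le_trans (ler_wpM2r _ L) _; first by rewrite !mulr_ge0// ltW.
  have := enormB_sqr z v; have := f0 (s, (x, v)); move: (fclamp _ _ _) => F F0 H.
  rewrite (_ : C * _ * _ = (9 * C * c * y * F) * enorm (z - v) ^+ 2); last by ring.
  apply: le_trans (ler_wpM2l _ H) _; first by rewrite !mulr_ge0// ltW.
  by rewrite AE le_eqVlt; apply/orP; left; apply/eqP; ring.
rewrite (@integral_prod_mul _ _ _ _ _ (sfm (sprod lebv Q)) (@lebR R) _ _ mat mph)//; last by move=> y; rewrite mule_ge0.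
rewrite (@integral_prod_mul _ _ _ _ _ lebv Q _ _ ma mth)//.
have -> : (\int[Q]_y th y = q1)%E.
  rewrite /q1 [RHS]integral_mkcond; apply: eq_integral => y _; rewrite /th patchE indicE.
  by case: ifPn => _; rewrite ?mul1r ?mul0r.
have -> : (\int[lebR]_y ph y = (2 * pi)%:E)%E.
  rewrite integral_indic// setIT -[X in _ = X%:E]subr0; apply: lebR_itv.
  by rewrite mulr_ge0// pi_ge0.
have Ia : (\int[lebv]_v a v <= (A * (M + G) * (1 + enorm z ^+ 2))%:E)%E.
  rewrite (_ : (\int[lebv]_v a v = \int[lebv]_v ((A * enorm z ^+ 2)%:E * (fclamp T f (s, (x, v)))%:E +
    A%:E * (enorm v ^+ 2 * fclamp T f (s, (x, v)))%:E))%E); last by [].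
  have k0 : 0 <= A * enorm z ^+ 2 by rewrite mulr_ge0// sqr_ge0.
  have m1 : measurable_fun [set: V3 R] (fun v => (fclamp T f (s, (x, v)))%:E).
    by apply/measurable_EFinP; exact: measurable_fclamp_v.
  have m2 : measurable_fun [set: V3 R] (fun v => (enorm v ^+ 2 * fclamp T f (s, (x, v)))%:E).
    by apply/measurable_EFinP; exact: measurable_enorm2f.
  have p1 v : (0 <= (fclamp T f (s, (x, v)))%:E)%E by rewrite lee_fin.
  have p2 v : (0 <= (enorm v ^+ 2 * fclamp T f (s, (x, v)))%:E)%E by rewrite lee_fin mulr_ge0// sqr_ge0.
  rewrite ge0_integralD//; last 4 first.
  - by move=> v _; rewrite mule_ge0// lee_fin.
  - exact: measurable_funeM.
  - by move=> v _; rewrite mule_ge0// lee_fin.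
  - exact: measurable_funeM.
  rewrite !ge0_integralZl_EFin//.
  apply: (@le_trans _ _ ((A * enorm z ^+ 2)%:E * M%:E + A%:E * G%:E)%E).
    by apply: leeD; [apply: lee_wpmul2l; [rewrite lee_fin|exact: HM]|apply: lee_wpmul2l; [rewrite lee_fin|exact: HG]].
  rewrite -!EFinM -EFinD lee_fin.
  have := sqr_ge0 (enorm z); move: (enorm z ^+ 2) => E E0.
  rewrite (_ : A * (M + G) * (1 + E) = A * E * M + A * G + (A * M + A * G * E)); last by ring.
  by rewrite lerDl addr_ge0// !mulr_ge0// ?enorm_ge0.
rewrite -[q1 in leLHS]fineK ?ge0_fin_numE//.
rewrite (_ : A * (M + G) * fine q1 * (2 * pi) * (1 + enorm z ^+ 2) = A * (M + G) * (1 + enorm z ^+ 2) * fine q1 * (2 * pi)); last by ring.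
apply: (@le_trans _ _ ((A * (M + G) * (1 + enorm z ^+ 2))%:E * (fine q1)%:E * (2 * pi)%:E)%E); last by [].
apply: lee_wpmul2r; first by rewrite lee_fin.
by apply: lee_wpmul2r => //; rewrite lee_fin fine_ge0.
Qed.

Lemma Lgen_integrandE s q p : 0 <= s <= T -> Lgen_integrand I J c f s psi q p = lam (s, q) p.
Proof.
move=> sT; rewrite /Lgen_integrand /lam /jumpH /rate /fclamp /= (clamp_id sT).
by case: q => x z /=; rewrite mulrA.
Qed.

Lemma lampos_le e u p : `|e| = 1 -> lampos e u p <= \1_(Xi3 (R := R)) p * `|lam u p|.
Proof.
move=> e1; rewrite /lampos; apply: ler_wpM2l => //.
by rewrite ge_max normr_ge0 andbT (le_trans (ler_norm _))// normrM e1 mul1r.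
Qed.

Lemma measurable_lam_p u : measurable_fun setT (fun p => lam u p).
Proof. by case: u => s q; apply: (@measurable_lam _ _ (cst q) id (cst s)). Qed.

Lemma Lam_le e u K : `|e| = 1 ->
  (\int[collM Q]_(p in Xi3 (R := R)) `|lam u p|%:E <= K%:E)%E -> (Lam e u <= K%:E)%E.
Proof.
move=> e1; apply: le_trans; rewrite [leRHS]integral_mkcond; apply: ge0_le_integral => //.
- by move=> p _; rewrite lee_fin lampos_ge0.
- apply/measurable_EFinP; case: u => s q; exact: (@measurable_lampos _ _ (cst q) id (cst s)).
- apply/(measurable_restrictT _ _).1; first exact: measurable_Xi3.
  by apply: measurable_funTS; apply/measurable_EFinP; apply: measurableT_comp => //; exact: measurable_lam_p.
move=> p _; rewrite patchE; have := lampos_le u p e1; rewrite indicE.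
by case: (p \in _); rewrite ?mul1r ?mul0r lee_fin.
Qed.

Lemma integrable_lam u : (collM Q).-integrable (Xi3 (R := R)) (fun p => (lam u p)%:E).
Proof.
have [K [K0 HK]] := Lam_bound; apply/integrableP; split.
  by apply: measurable_funTS; apply/measurable_EFinP; exact: measurable_lam_p.
by apply: le_lt_trans (HK u) _; rewrite ltry.
Qed.

Lemma integrable_Lgen s q : 0 <= s <= T ->
  (collmeas Q).-integrable (Xi3 (R := R)) (fun p => (Lgen_integrand I J c f s psi q p)%:E).
Proof.
move=> sT; have -> : (fun p => (Lgen_integrand I J c f s psi q p)%:E) = (fun p => (lam (s, q) p)%:E).
  by apply/funext => p; rewrite Lgen_integrandE.
apply: integrable_collM; [exact: measurable_Xi3| |exact: integrable_lam].
by apply: measurable_funTS; apply/measurable_EFinP; exact: measurable_lam_p.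
Qed.

Lemma Lgen_Lam s q : 0 <= s <= T ->
  Lgen Q I J c f s psi q = fine (Lam 1 (s, q)) - fine (Lam (-1) (s, q)).
Proof.
move=> sT; have [K [K0 HK]] := Lam_bound.
have fin e : `|e| = 1 -> Lam e (s, q) \is a fin_num.
  by move=> e1; rewrite ge0_fin_numE ?Lam_ge0//; apply: le_lt_trans (Lam_le e1 (HK _)) _; rewrite ltry.
rewrite /Lgen /Rint.
have -> : (fun p => (Lgen_integrand I J c f s psi q p)%:E) = (fun p => (lam (s, q) p)%:E).
  by apply/funext => p; rewrite Lgen_integrandE.
rewrite integral_collM; last 2 first.
- exact: measurable_Xi3.
- by apply: measurable_funTS; apply/measurable_EFinP; exact: measurable_lam_p.
have E e (h : CP -> \bar R) : (forall p, h p = (Num.max (e * lam (s, q) p) 0)%:E) ->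
    (\int[collM Q]_(p in Xi3 (R := R)) h p = Lam e (s, q))%E.
  move=> hE; rewrite /Lam integral_mkcond; apply: eq_integral => p _.
  by rewrite patchE /lampos indicE hE; case: (p \in _); rewrite ?mul1r ?mul0r.
rewrite integralE.
rewrite (E 1 ((fun p => (lam (s, q) p)%:E)^\+)%E); last by move=> p; rewrite funeposE mul1r -EFin_max.
rewrite (E (-1) ((fun p => (lam (s, q) p)%:E)^\-)%E); last by move=> p; rewrite funenegE mulN1r -EFin_max.
by apply: fineB; apply: fin; rewrite ?normrN1 ?normr1.
Qed.

(** The acceptance indicator of the thinning. Where [mr] is 0 the quotient is 0 by convention, so
    among r >= 0 only r = 0 is accepted. *)
Definition thin (q : V3 R * V3 R) (p : Mk R) : R :=
  if pr p <= sigmaK c (enorm (q.2 - pv p)) * (fclamp T f (ps p, (q.1, pv p)) / mr T f (ps p) (pv p)) then 1 else 0.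

Definition hmark (e : R) (q : V3 R * V3 R) (p : Mk R) : R :=
  Num.max (e * jumpH q p.1.1) 0 * thin q p.

Lemma hmark_ge0 e q p : 0 <= hmark e q p.
Proof. by rewrite /hmark /thin mulr_ge0 ?le_max ?lexx ?orbT//; case: ifP. Qed.

Lemma measurable_hmark e : measurable_fun [set: (V3 R * V3 R) * Mk R] (fun y => hmark e y.1 y.2).
Proof.
have mq : measurable_fun [set: (V3 R * V3 R) * Mk R] fst by exact: measurable_fst.
have mp : measurable_fun [set: (V3 R * V3 R) * Mk R] snd by exact: measurable_snd.
have mv : measurable_fun [set: (V3 R * V3 R) * Mk R] (fun y => pv y.2) by exact: measurableT_comp (@measurable_pv R) mp.
have ms : measurable_fun [set: (V3 R * V3 R) * Mk R] (fun y => ps y.2) by exact: measurableT_comp (@measurable_ps R) mp.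
apply: measurable_funM.
  apply: measurable_maxr => //; apply: measurable_funM => //; apply: measurable_jumpH => //.
  by apply: (measurableT_comp measurable_fst); exact: (measurableT_comp measurable_fst mp).
apply: measurable_fun_ifT => //; apply: measurable_fun_ler.
  exact: (measurableT_comp (@measurable_pr R) mp).
apply: measurable_funM.
  apply: measurable_funM => //; apply: measurable_enorm; apply: measurable_V3B => //.
  exact: (measurableT_comp measurable_snd mq).
apply: measurable_funM.
  apply: (measurableT_comp (measurable_fclamp T0 fcont)); apply: measurable_fun_pair => //.
  by apply: measurable_fun_pair => //; exact: (measurableT_comp measurable_fst mq).
apply: (measurableT_comp (f := fun y : R => y^-1)); first exact: measurable_invr.
exact: (measurableT_comp (measurable_mr T0 fprob fcont) (measurable_fun_pair ms mv)).
Qed.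

(** If [mr] vanishes because the integral of f(s, y, v) over y is 0, then the nonnegative continuous
    function y |-> f(s, y, v) is identically 0. The other way for [mr] to vanish is that this
    integral is infinite, which happens only for a null set of v. *)
Lemma null_marginal s x : measurable [set v | mr T f s v = 0 /\ fclamp T f (s, (x, v)) != 0] /\
  lebv [set v | mr T f s v = 0 /\ fclamp T f (s, (x, v)) != 0] = 0%E.
Proof.
set A := [set v | _].
have mms : measurable_fun [set: V3 R] (fun v => mr T f s v).
  exact: (measurableT_comp (measurable_mr T0 fprob fcont) (measurable_pair1 s)).
have mA : measurable A.
  have -> : A = (fun v => mr T f s v) @^-1` [set 0] `&` (fun v => fclamp T f (s, (x, v))) @^-1` (~` [set 0]).
    by apply/seteqP; split => v /= [a b]; split => //; apply/eqP.
  apply: measurableI; rewrite -[X in measurable X]setTI; first exact: mms.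
  by apply: (measurable_fclamp_v T0 fcont s x) => //; exact: measurableC.
split => //; apply/eqP; rewrite -measure_le0.
have mmT : measurable_fun [set: V3 R] (fun v => mT T f (s, v)).
  exact: (measurableT_comp (measurable_mT T0 fprob fcont) (measurable_pair1 s)).
have iT : lebv.-integrable setT (fun v => mT T f (s, v)).
  apply/integrableP; split => //.
  rewrite (eq_integral (fun v => mT T f (s, v))); first by rewrite (mT_int T0 fprob) ltry.
  by move=> v _; rewrite gee0_abs// (mT_ge0 T0 fprob).
have [B [mB B0 HB]] := integrable_ae measurableT iT.
rewrite -[leRHS]B0; apply: measure_le => // v [m0 fv]; apply: HB => /= /(_ Logic.I) fin.
case/eqP: fv; have cf : continuous (fun y => fclamp T f (s, (y, v))).
  move=> y; apply: (@continuous_comp _ _ _ (fun y => (s, (y, v))) (fclamp T f)); last exact: (continuous_fclamp (ltW T0) fcont).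
  by apply: cvg_to_pair; [exact: cvg_cst|apply: cvg_to_pair; [exact: cvg_id|exact: cvg_cst]].
apply: (continuous_integral_eq0 cf).
- apply: (measurableT_comp (measurable_fclamp T0 fcont)); apply: measurable_fun_pair => //.
- by move=> y; exact: (fclamp_ge0 T0 fprob).
by rewrite -[LHS](fineK fin) -[fine _]/(mr T f s v) m0.
Qed.

Lemma collM_cylinder (A : set (V3 R)) : measurable A -> lebv A = 0%E ->
  collM Q ((fun p => p.1.1) @^-1` A) = 0%E.
Proof.
move=> mA A0; have -> : (fun p : CP => p.1.1) @^-1` A = (A `*` [set: R]) `*` [set: R].
  by apply/seteqP; split => p /=; [|case=> -[]].
transitivity (sprod lebv Q (A `*` [set: R]) * lebR [set: R])%E.
  by apply: sprod_rect => //; exact: measurableX.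
by rewrite (sprod_rect lebv Q mA measurableT) A0 mul0e mul0e.
Qed.

(** Integrating the acceptance indicator over r gives the threshold sigma f / m, and the density m
    of the compensator turns it into the rate sigma f. The factor max(e jump, 0) does not involve
    r. *)
Lemma hmark_slice e s q : 0 < s <= T ->
  (\int[markE Q]_y ((\1_(Dall T) (y, s) * hmark e q (y, s))%:E * (rho T f (y, s))%:E) = Lam e (s, q))%E.
Proof.
move=> sT; have [s0 sT'] := andP sT.
have s0T : 0 <= s <= T by rewrite sT' ltW.
have mh : measurable_fun [set: CP * R] (fun y : CP * R => hmark e q (y, s)).
  have m2 : measurable_fun [set: CP * R] (fun y : CP * R => (q, (y, s)) : (V3 R * V3 R) * Mk R).
    by apply: measurable_fun_pair => //; exact: measurable_fun_pair.
  exact: (measurableT_comp (measurable_hmark e) m2).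
have mDall : measurable (Dall T : set (Mk R)).
  rewrite /Dall -(bigcup_Dset T); apply: bigcup_measurable => n _; exact: measurable_Dset.
have mD : measurable_fun [set: CP * R] (fun y : CP * R => \1_(Dall T) (y, s) : R).
  apply: (measurableT_comp (f := \1_(Dall T) : Mk R -> R)); first by apply: measurable_indic.
  exact: measurable_fun_pair.
have mr' : measurable_fun [set: CP * R] (fun y : CP * R => rho T f (y, s)).
  apply: (measurableT_comp (measurable_rho T0 fprob fcont)); exact: measurable_fun_pair.
set F := fun y : CP * R => ((\1_(Dall T) (y, s) * hmark e q (y, s))%:E * (rho T f (y, s))%:E)%E.
have mF : measurable_fun setT F.
  by apply: emeasurable_funM; apply/measurable_EFinP => //; exact: measurable_funM.
have F0 y : (0 <= F y)%E.
  by rewrite mule_ge0// lee_fin ?(rho_ge0 T0 fprob)// mulr_ge0// hmark_ge0.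
rewrite (@fubini_tonelli1 _ _ _ _ _ (collM Q) (@lebR R) F mF)//.
pose k (p : CP) := \1_(Xi3 (R := R)) p * Num.max (e * jumpH q p) 0.
have k0 p : 0 <= k p by rewrite mulr_ge0// le_max lexx orbT.
pose a (p : CP) := sigmaK c (enorm (q.2 - p.1.1)) * (fclamp T f (s, (q.1, p.1.1)) / mr T f s p.1.1).
have c0 := c_gt0.
have a0 p : 0 <= a p.
  by rewrite mulr_ge0// ?divr_ge0 ?(fclamp_ge0 T0 fprob) ?(mr_ge0 T0 fprob)// mulr_ge0 ?enorm_ge0// ltW.
(* The conditions r >= 0, from the mark domain, and r <= a p, from the thinning, leave the interval
   [0, a p]. *)
have slice p : (\int[lebR]_r F (p, r) = (k p * mr T f s p.1.1 * a p)%:E)%E.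
  transitivity (\int[lebR]_r ((k p * mr T f s p.1.1)%:E * (\1_(`[0, a p]%classic) r)%:E))%E.
    apply: eq_integral => r _; rewrite /F /rho /hmark /thin !indicE /= -!EFinM; congr EFin.
    rewrite -/(a p) /pr /ps /pv /=.
    have dE : ((p, r, s) \in Dall T) = (p \in Xi3 (R := R)) && (0 <= r).
      apply/idP/idP => [/set_mem[d1 d2 d3 _]|/andP[/set_mem[d1 d2] r0]].
        by apply/andP; split; [apply/mem_set; split|].
      by apply/mem_set; split.
    have mE : ((p, r, s) \in markdom T) = (p \in Xi3 (R := R)) && (0 <= r).
      apply/idP/idP => [/set_mem[d1 d2 d3 _]|/andP[/set_mem[d1 d2] r0]].
        by apply/andP; split; [apply/mem_set; split|].
      by apply/mem_set; split.
    have iE : (r \in `[0, a p]%classic) = (0 <= r) && (r <= a p) by rewrite mem_setE in_itv.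
    rewrite dE mE iE /k indicE.
    case: (p \in Xi3 (R := R)); case: (0 <= r); case: (r <= a p); rewrite /= ?mul1r ?mul0r ?mulr0 ?mulr1 ?mul0r//.
  have km : 0 <= k p * mr T f s p.1.1 by rewrite mulr_ge0// (mr_ge0 T0 fprob).
  rewrite ge0_integralZl_EFin//; last by apply/measurable_EFinP; apply: measurable_indic; exact: measurable_itv.
  rewrite integral_indic// setIT.
  by rewrite [X in (_ * X)%E](lebR_itv true false (a0 p)) subr0 -EFinM.
rewrite /fubini_F; under eq_integral do rewrite slice.
have mu := @measurable_lampos _ CP (cst q) id (cst s) (measurable_cst _) (@measurable_id _ _ _) (measurable_cst _) e.
have mms : measurable_fun [set: V3 R] (fun v => mr T f s v).
  exact: (measurableT_comp (measurable_mr T0 fprob fcont) (measurable_pair1 s)).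
have mpv : measurable_fun [set: CP] (fun p : CP => p.1.1).
  exact: (measurableT_comp measurable_fst measurable_fst).
have mmr : measurable_fun [set: CP] (fun p : CP => mr T f s p.1.1).
  exact: (measurableT_comp mms mpv).
have mJ := @measurable_jumpH _ CP (cst q) id (measurable_cst _) (@measurable_id _ _ _).
have mrt := @measurable_rate _ CP (cst q) id (cst s) (measurable_cst _) (@measurable_id _ _ _) (measurable_cst _).
have [mA A0] := null_marginal s q.1.
apply: ge0_ae_eq_integral => //.
- apply/measurable_EFinP; apply: measurable_funM.
    apply: measurable_funM => //; apply: measurable_funM.
      by apply: measurable_indic; exact: measurable_Xi3.
    by apply: measurable_maxr => //; exact: measurable_funM.
  have -> : a = fun p => rate (s, q) p.1.1 / mr T f s p.1.1.
    by apply/funext => p; rewrite /a /rate /= mulrCA mulrA.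
  apply: measurable_funM => //.
  by apply: (measurableT_comp (f := fun y : R => y^-1)); first exact: measurable_invr.
- exact/measurable_EFinP.
- move=> p _; rewrite lee_fin; apply: mulr_ge0 => //; apply: mulr_ge0 => //; exact: (mr_ge0 T0 fprob).
- by move=> p _; rewrite lee_fin lampos_ge0.
(* The cancellation of m against 1 / m fails only where m = 0 while f does not vanish;
   [null_marginal] makes this a null set of velocities, hence of collision parameters. *)
exists ((fun p : CP => p.1.1) @^-1` [set v | mr T f s v = 0 /\ fclamp T f (s, (q.1, v)) != 0]); split.
- rewrite -[X in measurable X]setTI.
  by apply: (measurableT_comp measurable_fst measurable_fst).
- exact: collM_cylinder.
move=> p /= /not_implyP[_ H]; apply: contrapT => nA; apply: H; congr EFin.
have e1 : Num.max (e * (jumpH q p * rate (s, q) p.1.1)) 0 = Num.max (e * jumpH q p) 0 * rate (s, q) p.1.1.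
  by rewrite maxr_pMl ?rate_ge0// mul0r mulrA.
have e2 : mr T f s p.1.1 * a p = rate (s, q) p.1.1.
  rewrite /a /rate /=; case: (eqVneq (mr T f s p.1.1) 0) => m0.
    rewrite m0 mul0r; have [->|F'] := eqVneq (fclamp T f (s, (q.1, p.1.1))) 0; first by rewrite mul0r.
    by case: nA; split.
  by move: m0; move: (mr _ _ _ _) (sigmaK _ _) (fclamp _ _ _) => m g G m0; field.
by rewrite /lampos /lam /= e1 -e2 /k !mulrA.
Qed.

End lambda.

Lemma Rint_pm d (S : measurableType d) (R : realType) (mu : {measure set S -> \bar R}) D (g : S -> R) :
  measurable D -> rintble mu D g ->
  Rint mu D g = fine (\int[mu]_(p in D) (Num.max (1 * g p) 0)%:E)%E - fine (\int[mu]_(p in D) (Num.max (-1 * g p) 0)%:E)%E.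
Proof.
move=> mD ig; rewrite /Rint integralE.
rewrite (eq_integral (fun p => (Num.max (1 * g p) 0)%:E)); last by move=> p _; rewrite funeposE mul1r -EFin_max.
rewrite [X in fine (_ - X)](eq_integral (fun p => (Num.max (-1 * g p) 0)%:E)); last by move=> p _; rewrite funenegE mulN1r -EFin_max.
have H e : (\int[mu]_(p in D) (Num.max (e * g p) 0)%:E)%E \is a fin_num.
  apply: (integrable_fin_num mD).
  apply: (@rintble_le _ _ _ mu D (fun p => Num.max (e * g p) 0) (fun p => `|e| * `|g p|)) => //.
  - by apply: measurable_maxr => //; apply: measurable_funM => //; exact: rintble_measurable ig.
  - move=> p _; rewrite ger0_norm ?le_max ?lexx ?orbT// ge_max -normrM ler_norm /=.
    exact: normr_ge0.
  - by apply: rintbleZ => //; exact: rintble_norm.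
by apply: fineB.
Qed.

Lemma Gmeas_measurable (R : realType) d (Omega : measurableType d) (G : set (set Omega)) (h : Omega -> R) :
  sigma_algebra [set: Omega] G -> G `<=` measurable -> Gmeas G h -> measurable_fun setT h.
Proof.
move=> sG Gm Gh; apply: (measurability _ (RGenOInfty.measurableE R)) => // _ [_ [a ->] <-].
rewrite setTI (_ : _ @^-1` _ = [set w | a < h w]); first by apply: Gm; exact: Gmeas_gt.
by apply/seteqP; split => w /=; rewrite in_itv /= andbT.
Qed.

(** * The process on the whole time line, its laws, and Tonelli in time *)

Section process.
Context {R : realType}.
Variables (T : R).
Context d (Omega : measurableType d) (P : probability Omega R).
Variables (F : R -> set (set Omega)) (X Z : R -> Omega -> V3 R).
Hypothesis T0 : 0 < T.
Hypothesis hF : filtration T F.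
Hypothesis aX : adapted3 F T X.
Hypothesis aZ : adapted3 F T Z.
Hypothesis cXZ : forall w, cadlag_on T (fun t => (X t w, Z t w)).
Hypothesis hM : (ereal_sup [set (\int[pushforward P (fun w => (X t w, Z t w))]_q
  ((enorm q.2) ^+ 2)%:E)%E | t in [set t : R | (0 <= t <= T)%R]] < +oo)%E.

(** The process frozen before 0 and after T: its paths are right-continuous at every real time and
    each of its values is measurable. *)
Definition qc (s : R) (w : Omega) : V3 R * V3 R := (X (clamp T s) w, Z (clamp T s) w).

Let T0' : 0 <= T. Proof. exact: ltW. Qed.

Lemma qcE s w : 0 <= s <= T -> qc s w = (X s w, Z s w).
Proof. by move=> sT; rewrite /qc clamp_id. Qed.

Lemma measurable_adapted (Y : R -> Omega -> V3 R) t : adapted3 F T Y -> 0 <= t <= T -> measurable_fun setT (Y t).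
Proof.
move=> aY tT; have [sF Fm] := hF.1 _ tT.
have aY' (i : 'I_3) : Gmeas (F t) (fun w => coord3 (Y t w) i) by exact: aY.
apply: measurable_V3.
- exact: (Gmeas_measurable sF Fm (aY' ord0)).
- exact: (Gmeas_measurable sF Fm (aY' (lift ord0 ord0))).
- exact: (Gmeas_measurable sF Fm (aY' ord_max)).
Qed.

Lemma measurable_qc s : measurable_fun setT (qc s).
Proof. by apply: measurable_fun_pair; apply: measurable_adapted => //; exact: clamp_itv. Qed.

Lemma clamp_gt s : T <= s -> clamp T s = T.
Proof. by move=> sT; rewrite /clamp; apply/min_idPl; rewrite le_max sT orbT. Qed.

Lemma clamp_lt s : s <= 0 -> clamp T s = 0.
Proof. by move=> s0; rewrite /clamp (max_idPl s0); apply/min_idPr. Qed.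

Lemma qc_right w s : (fun x => qc x w) @ s^'+ --> qc s w.
Proof.
have [sT|sT] := leP T s.
  apply: cvg_near_cst; near=> x.
  have xT : T <= x by apply: le_trans sT _; near: x; exact: nbhs_right_ge.
  by rewrite /qc (clamp_gt xT) (clamp_gt sT).
have [s0|s0] := ltP s 0.
  apply: cvg_near_cst; near=> x.
  have x0 : x <= 0 by near: x; exact: nbhs_right_le.
  by rewrite /qc (clamp_lt x0) (clamp_lt (ltW s0)).
have := (cXZ w).1 s; rewrite s0 sT => /(_ isT) H.
rewrite qcE ?s0 ?ltW//; apply: cvg_trans H; apply: near_eq_cvg; near=> x.
rewrite qcE//; apply/andP; split.
  by apply: le_trans s0 _; near: x; exact: nbhs_right_ge.
by apply: ltW; near: x; exact: nbhs_right_lt.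
Unshelve. all: by end_near. Qed.

Lemma qc_left w s : 0 < s <= T -> exists l, (fun x => qc x w) @ s^'- --> l /\
  leftlim (X ^~ w) s = l.1 /\ leftlim (Z ^~ w) s = l.2.
Proof.
move=> sT; have [s0 sT'] := andP sT; have [l Hl] := (cXZ w).2 s sT.
exists l; split.
  apply: cvg_trans Hl; apply: near_eq_cvg; near=> x.
  rewrite qcE//; apply/andP; split; first by near: x; exact: nbhs_left_ge.
  by apply: le_trans sT'; near: x; exact: nbhs_left_le.
have HX : X ^~ w @ s^'- --> l.1 by apply: (cvg_comp (fun t => (X t w, Z t w)) fst Hl); exact: cvg_fst.
have HZ : Z ^~ w @ s^'- --> l.2 by apply: (cvg_comp (fun t => (X t w, Z t w)) snd Hl); exact: cvg_snd.
have E (Y : R -> V3 R) (y : V3 R) : Y @ s^'- --> y -> leftlim Y s = y.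
  move=> HY; have H1 : (fun u => (Y u).1) @ s^'- --> y.1 by apply: (cvg_comp Y fst HY); exact: cvg_fst.
  rewrite /leftlim; case: y HY H1 => -[a b] e HY H1; congr (_, _, _); apply/cvg_lim => //.
  - by apply: (cvg_comp (fun u => (Y u).1) fst H1); exact: cvg_fst.
  - by apply: (cvg_comp (fun u => (Y u).1) snd H1); exact: cvg_snd.
  - by apply: (cvg_comp Y snd HY); exact: cvg_snd.
by split; exact: E.
Unshelve. all: by end_near. Qed.

(** Each real coordinate is right-continuous in time and measurable at fixed times, which is enough
    by sampling on a grid. *)
Lemma measurable_qc_joint : measurable_fun [set: Omega * R] (fun y => qc y.2 y.1).
Proof.
have H (h : V3 R * V3 R -> R) : continuous h -> measurable_fun [set: V3 R * V3 R] h ->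
    measurable_fun [set: Omega * R] (fun y => h (qc y.2 y.1)).
  move=> ch mh; apply: (@measurable_fun_rcont R _ _ (fun y : Omega * R => y.2) (fun x y => h (qc x y.1))).
  - exact: measurable_snd.
  - by move=> x; apply: (measurableT_comp mh); exact: (measurableT_comp (measurable_qc x) measurable_fst).
  - by move=> y; apply: (cvg_comp _ h (@qc_right y.1 y.2)); exact: ch.
have c1 : continuous (fst : V3 R * V3 R -> V3 R) by move=> q; exact: cvg_fst.
have c2 : continuous (snd : V3 R * V3 R -> V3 R) by move=> q; exact: cvg_snd.
have cc (S U V : topologicalType) (g : S -> U) (k : U -> V) : continuous g -> continuous k -> continuous (k \o g).
  by move=> cg ck x; apply: continuous_comp; [exact: cg|exact: ck].
have d1 : continuous (fun v : V3 R => v.1.1) by apply: (cc _ _ _ fst fst); move=> q; exact: cvg_fst.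
have d2 : continuous (fun v : V3 R => v.1.2) by apply: (cc _ _ _ fst snd); move=> q; [exact: cvg_fst|exact: cvg_snd].
have d3 : continuous (fun v : V3 R => v.2) by move=> q; exact: cvg_snd.
have [a1 a2 a3] := measurable_V3_coord (@measurable_fst _ _ (V3 R) (V3 R)).
have [b1 b2 b3] := measurable_V3_coord (@measurable_snd _ _ (V3 R) (V3 R)).
have -> : (fun y : Omega * R => qc y.2 y.1) = fun y => ((qc y.2 y.1).1, (qc y.2 y.1).2) by [].
apply: measurable_fun_pair; apply: measurable_V3.
- by apply: (H (fun q => q.1.1.1)) => //; exact: (cc _ _ _ fst (fun v => v.1.1)).
- by apply: (H (fun q => q.1.1.2)) => //; exact: (cc _ _ _ fst (fun v => v.1.2)).
- by apply: (H (fun q => q.1.2)) => //; exact: (cc _ _ _ fst (fun v => v.2)).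
- by apply: (H (fun q => q.2.1.1)) => //; exact: (cc _ _ _ snd (fun v => v.1.1)).
- by apply: (H (fun q => q.2.1.2)) => //; exact: (cc _ _ _ snd (fun v => v.1.2)).
- by apply: (H (fun q => q.2.2)) => //; exact: (cc _ _ _ snd (fun v => v.2)).
Qed.

Lemma integral_law s (g : V3 R * V3 R -> \bar R) : 0 <= s <= T -> measurable_fun setT g ->
  (\int[pushforward P (fun w => (X s w, Z s w))]_q g q = \int[P]_w g (qc s w))%E.
Proof.
move=> sT mg; have mq := measurable_qc s.
have E : (fun w => (X s w, Z s w)) = qc s by apply/funext => w; rewrite qcE.
rewrite E; have := integral_transfer (m1 := P) (m2 := pushforward P (qc s)) mq (fun A mA => erefl) measurableT mg.
by rewrite preimage_setT => ->.
Qed.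

Lemma moment_process : exists S, 0 <= S /\ forall s, (\int[P]_w (enorm (qc s w).2 ^+ 2)%:E <= S%:E)%E.
Proof.
have me : measurable_fun [set: V3 R * V3 R] (fun q => (enorm q.2 ^+ 2)%:E).
  apply/measurable_EFinP; apply: measurable_funX; apply: measurable_enorm; exact: measurable_snd.
have := hM; set A := ereal_sup _ => hA.
have HA s : (\int[P]_w (enorm (qc s w).2 ^+ 2)%:E <= A)%E.
  have cs := clamp_itv s T0'.
  have -> : (\int[P]_w (enorm (qc s w).2 ^+ 2)%:E = \int[P]_w (enorm (qc (clamp T s) w).2 ^+ 2)%:E)%E.
    by apply: eq_integral => w _; rewrite /qc (clamp_id cs).
  rewrite -(integral_law (g := fun q => (enorm q.2 ^+ 2)%:E) cs me); apply: ereal_sup_ubound.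
  by exists (clamp T s).
have A0 : (0 <= A)%E by apply: le_trans (HA 0); apply: integral_ge0 => w _; rewrite lee_fin sqr_ge0.
exists (fine A); split; first exact: fine_ge0.
by move=> s; rewrite fineK// ge0_fin_numE.
Qed.

Section tonelli.
Variables (t : R) (Phi : R * (V3 R * V3 R) -> \bar R) (K : R).
Hypothesis t0 : 0 <= t.
Hypothesis mPhi : measurable_fun setT Phi.
Hypothesis Phi0 : forall u, (0 <= Phi u)%E.
Hypothesis K0 : 0 <= K.
Hypothesis PhiK : forall u, (Phi u <= (K * (1 + enorm u.2.2 ^+ 2))%:E)%E.

Definition mean_at s : \bar R := (\int[P]_w Phi (s, qc s w))%E.
Definition time_int w : \bar R := (\int[@lebR R]_(s in `]0%R, t]) Phi (s, qc s w))%E.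

Let mPq : measurable_fun [set: Omega * R] (fun y => Phi (y.2, qc y.2 y.1)).
Proof.
apply: (measurableT_comp mPhi); apply: measurable_fun_pair; [exact: measurable_snd|exact: measurable_qc_joint].
Qed.

Let G (y : Omega * R) : \bar R := (Phi (y.2, qc y.2 y.1) * (\1_(`]0, t]%classic) y.2)%:E)%E.
Let mG : measurable_fun setT G.
Proof.
apply: emeasurable_funM => //; apply/measurable_EFinP.
by apply: (measurableT_comp _ measurable_snd); apply: measurable_indic; exact: measurable_itv.
Qed.
Let G0 y : (0 <= G y)%E. Proof. by rewrite mule_ge0// lee_fin. Qed.

Let meanle s (S : R) : (\int[P]_w (enorm (qc s w).2 ^+ 2)%:E <= S%:E)%E -> (mean_at s <= (K * (1 + S))%:E)%E.
Proof.
move=> HS; have me : measurable_fun [set: Omega] (fun w => (enorm (qc s w).2 ^+ 2)%:E).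
  apply/measurable_EFinP; apply: measurable_funX; apply: measurable_enorm.
  exact: (measurableT_comp measurable_snd (measurable_qc s)).
apply: (@le_trans _ _ (\int[P]_w (K%:E * (1%:E + (enorm (qc s w).2 ^+ 2)%:E)))%E).
  apply: ge0_le_integral => //.
  - exact: (measurableT_comp mPq (measurable_pair2 s)).
  - by apply: measurable_funeM; exact: emeasurable_funD.
rewrite ge0_integralZl_EFin//; last 2 first.
- by move=> w _; rewrite adde_ge0// lee_fin sqr_ge0.
- exact: emeasurable_funD.
rewrite ge0_integralD//; last by move=> w _; rewrite lee_fin sqr_ge0.
rewrite EFinM EFinD; apply: lee_wpmul2l; first by rewrite lee_fin.
apply: leeD => //; rewrite integral_cst// mul1e.
exact: probability_le1.
Qed.

(** Tonelli for P and Lebesgue measure applied to Phi(s, q_s) on ]0, t]. The growth bound and the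
    uniform second moment S bound every mean by K (1 + S), so the double integral is finite. *)
Lemma phi_tonelli : exists B, [/\ (forall s, (mean_at s <= B%:E)%E),
  measurable_fun setT (fun s => fine (mean_at s)),
  measurable_fun setT (fun w => fine (time_int w)), 
  (\int[P]_w time_int w = \int[@lebR R]_(s in `]0%R, t]) mean_at s)%E &
  (\int[P]_w time_int w < +oo)%E] /\ measurable_fun setT time_int.
Proof.
have [S [S0 HS]] := moment_process.
have IE w : time_int w = (\int[@lebR R]_s G (w, s))%E.
  rewrite /time_int integral_mkcond; apply: eq_integral => s _.
  by rewrite patchE /G /= indicE; case: ifPn => _; rewrite ?mule1 ?mule0.
have mI : measurable_fun setT time_int.
  rewrite (_ : time_int = fun w => \int[@lebR R]_s G (w, s))%E; last exact/funext.
  exact: (@measurable_fun_fubini_tonelli_F _ _ _ _ R (@lebR R) _ mG).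
have mM : measurable_fun setT mean_at.
  apply: (@measurable_fun_fubini_tonelli_G _ _ _ _ R P (fun y => Phi (y.2, qc y.2 y.1))) => //.
have EE : (\int[P]_w time_int w = \int[@lebR R]_(s in `]0%R, t]) mean_at s)%E.
  under eq_integral do rewrite IE.
  rewrite -(@fubini_tonelli1 _ _ _ _ R P (@lebR R) G mG G0).
  rewrite (@fubini_tonelli2 _ _ _ _ R P (@lebR R) G mG G0) [RHS]integral_mkcond.
  apply: eq_integral => s _; rewrite patchE /fubini_G /G /= indicE; case: ifPn => _.
    by apply: eq_integral => w _; rewrite mule1.
  by apply: integral0_eq => w _; rewrite mule0.
exists (K * (1 + S)); split; last exact: mI; split => //.
- by move=> s; exact: meanle.
- exact: measurableT_comp.
- exact: measurableT_comp.
rewrite EE; apply: (@le_lt_trans _ _ (\int[@lebR R]_(s in `]0%R, t]) (K * (1 + S))%:E)%E).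
  apply: ge0_le_integral => //.
  - by move=> s _; apply: integral_ge0.
  - exact: measurable_funTS.
  - by move=> s _; exact: meanle.
by rewrite integral_cst// [X in (_ * X)%E](lebR_itv false false t0) -EFinM ltry.
Qed.

End tonelli.
End process.

(** * The formula in expectation *)

Section assembly.
Context {R : realType}.
Variables (Q : {sigma_finite_measure set R -> \bar R}) (c : R) (I J : V3 R -> V3 R).
Variables (T : R) (f : R -> V3 R -> V3 R -> R).
Context d (Omega : measurableType d) (P : probability Omega R).
Variables (F : R -> set (set Omega)) (N : Omega -> {measure set (Mk R) -> \bar R}).
Variables (X Z : R -> Omega -> V3 R).
Hypothesis QA : hypA' Q c.
Hypothesis IJ : frame I J.
Hypothesis T0 : 0 < T.
Hypothesis fprob : prob_densities T f.
Hypothesis fcont : cont_on T f.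
Hypothesis fB2 : B2 T f.
Hypothesis hF : filtration T F.
Hypothesis hN : poisson_random_measure P F T (intensity Q T f) N.
Hypothesis aX : adapted3 F T X.
Hypothesis aZ : adapted3 F T Z.
Hypothesis cXZ : forall w, cadlag_on T (fun t => (X t w, Z t w)).

Let Qfin : forall eps : R, 0 < eps -> (Q [set x : R | (eps <= x)%R] < +oo)%E.
Proof. by have [_ H _ _] := QA. Qed.

Let T0' : 0 <= T. Proof. exact: ltW. Qed.

Let mN A : measurable A -> measurable_fun [set: Omega] (fun w => N w A).
Proof. by move=> mA; have [_ H _ _] := hN; exact/Gmeasb_measurable/H. Qed.

Definition two_atoms n t m k : set Omega :=
  [set w | (2%:E <= N w (Bset n `*` `](k%:R * step t m)%R, (k.+1%:R * step t m)%R]))%E].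

Let mtwo n t m k : measurable (two_atoms n t m k).
Proof.
have mS : measurable ((Bset n : set (V3 R * R * R * R)) `*` `](k%:R * step t m), (k.+1%:R * step t m)]).
  by apply: measurableX; [exact: measurable_Bset|exact: measurable_itv].
rewrite -[X in measurable X]setTI; apply: emeasurable_fun_c_infty; last exact: mN.
exact: measurableT.
Qed.

(* The probability that some cell of the grid of mesh h contains two atoms is O(h). *)
Lemma isolated_atoms t : 0 < t <= T -> {ae P, forall w, forall n m0 : nat,
  exists2 m : nat, (m0 <= m)%N & forall k, (k <= m)%N -> ~ two_atoms n t m k w}.
Proof.
move=> /andP[t0 tT]; apply: ae_foralln => n; apply: ae_foralln => m0.
pose A m := \big[setU/set0]_(k < m.+1) two_atoms n t m k.
have mA m : measurable (A m) by apply: bigsetU_measurable => k _; exact: mtwo.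
pose b m := Cset Q n ^+ 2 * t * step t m.
have PA m : (P (A m) <= (b m)%:E)%E.
  apply: le_trans (Boole_inequality _ _) _; first by move=> k _; exact: mtwo.
  have -> : b m = \sum_(k < m.+1) (Cset Q n * step t m) ^+ 2.
    by rewrite sumr_const card_ord -mulr_natl /b; move: (stepE t m); move: (step t m) => h <-; ring.
  rewrite -sumEFin; apply: lee_sum => k _.
  have h0 := ltW (step_gt0 m t0).
  have k0 : 0 <= k%:R * step t m by rewrite mulr_ge0.
  have kk : k%:R * step t m <= k.+1%:R * step t m by rewrite ler_wpM2r// ler_nat.
  have kT : k.+1%:R * step t m <= T.
    by apply: le_trans tT; rewrite -[leRHS](stepE t m) ler_wpM2r// ler_nat ltnS -ltnS.
  have ba : k.+1%:R * step t m - k%:R * step t m = step t m.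
    by rewrite -natr1 mulrDl mul1r addrAC subrr add0r.
  by have := prm_ge2 T0 fprob fcont Qfin hF hN n k0 kk kT; rewrite ba.
(* The bad event: every grid from index m0 on has a cell with two atoms. It is contained in each A m
   with m >= m0, and the bounds b m tend to 0. *)
pose D := \bigcap_(m in [set m | (m0 <= m)%N]) A m.
have mD : measurable D by apply: bigcap_measurable => //; exists m0 => /=.
exists D; split => //.
  apply/eqP; rewrite -measure_le0.
  have b0 : b m @[m --> \oo] --> (0 : R).
    by rewrite -[X in _ --> X](mulr0 (Cset Q n ^+ 2 * t)); apply: cvgMr; exact: step_cvg0.
  have PDfin : P D \is a fin_num by exact: fin_num_measure.
  rewrite -[X in (X <= _)%E](fineK PDfin) lee_fin; apply: (ler_cvg_to (cvg_cst (fine (P D))) b0).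
  exists m0 => // m /= m0m; rewrite -lee_fin fineK//; apply: le_trans (PA m).
  by apply: measure_le => // w; exact.
move=> w /= nw m /= m0m; apply: contrapT => nA; apply: nw; exists m => // k km tk; apply: nA.
by rewrite /A -bigcup_mkord; exists k.
Qed.

Section good.
Variables (w : Omega) (t : R).
Hypothesis tT : 0 < t <= T.
Hypothesis wO : Ogood T N w.
Hypothesis wS : system_S I J c T f X Z N w.
Hypothesis wI : forall n m0 : nat,
  exists2 m : nat, (m0 <= m)%N & forall k, (k <= m)%N -> ~ two_atoms n t m k w.

Definition LQ (w : Omega) (s : R) : V3 R * V3 R := (leftlim (X ^~ w) s, leftlim (Z ^~ w) s).

(** The mark domain without its time condition, which [slab] supplies. *)
Definition Dmark : set (Mk R) := [set p | [/\ 0 < pth p <= pi, 0 <= pph p < 2 * pi & 0 <= pr p]].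

Lemma measurable_Dmark : measurable Dmark.
Proof.
have -> : Dmark = (@pth R) @^-1` `]0, pi] `&` (@pph R) @^-1` `[0, 2 * pi[ `&` (@pr R) @^-1` `[0, +oo[.
  apply/seteqP; split => p /=; rewrite /Dmark /= !in_itv /= ?andbT.
    by move=> [].
  by move=> [[]].
by repeat apply: measurableI; rewrite -[X in measurable X]setTI;
  first [exact: measurable_pth|exact: measurable_pph|exact: measurable_pr].
Qed.

Notation E := (slab (@ps R) Dmark).
Notation L := (slab (@id R) setT).

Let mE a b : measurable (E a b).
Proof. by apply: measurable_slab; [exact: measurable_ps|exact: measurable_Dmark]. Qed.

Lemma DallE : Dall T = E 0 T.
Proof. by apply/seteqP; split => p; [move=> [? ? ? ?]; split; [split|]|move=> [[? ? ?] ?]; split]. Qed.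

Let jump i (p : Mk R) : R :=
  let Zm := leftlim (fun s => Z s w) (ps p) in
  coord3 (alpha I J Zm (pv p) (pth p) (pph p)) i *
  (if pr p <= sigmaK c (enorm (Zm - pv p)) * fcond f (ps p) (X (ps p) w) (pv p) then 1 else 0).

Let DtE s : [set p : Mk R | [/\ 0 < pth p <= pi, 0 <= pph p < 2 * pi, 0 <= pr p & 0 < ps p <= s]] = E 0 s.
Proof. by apply/seteqP; split => p; [move=> [? ? ? ?]; split; [split|]|move=> [[? ? ?] ?]; split]. Qed.

Let S (s : R) (i : 'I_3) : 0 <= s <= T ->
  [/\ coord3 (X s w) i = coord3 (X 0 w) i + Rint (@lebesgue_measure R) `[0, s] (fun u => coord3 (Z u w) i),
      rintble (N w) (E 0 s) (jump i)
    & coord3 (Z s w) i = coord3 (Z 0 w) i + Rint (N w) (E 0 s) (jump i)].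
Proof. by move=> sT; have := wS sT i; rewrite DtE. Qed.

(** The jumps of (S), set to 0 off the times ]0, T]: the system yields their measurability only on
    that region, while the pathwise formula asks for it on the whole mark space. *)
Definition jp : Mk R -> V3 R := fun p => ((jump 0 \_ (E 0 T)) p, (jump 1 \_ (E 0 T)) p, (jump 2 \_ (E 0 T)) p).

Let TT : 0 <= T <= T. Proof. by rewrite T0' lexx. Qed.
Let i0 : 'I_3 := ord0.
Let i1 : 'I_3 := lift ord0 ord0.
Let i2 : 'I_3 := ord_max.

Let jT i : rintble (N w) (E 0 T) (jump i) -> measurable_fun setT (jump i \_ (E 0 T)).
Proof.
by move=> /rintble_measurable m; exact: ((measurable_restrictT (jump i) (mE 0 T)).1 m).
Qed.

Let JT0 : rintble (N w) (E 0 T) (jump 0). Proof. by have [] := S i0 TT. Qed.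
Let JT1 : rintble (N w) (E 0 T) (jump 1). Proof. by have [] := S i1 TT. Qed.
Let JT2 : rintble (N w) (E 0 T) (jump 2). Proof. by have [] := S i2 TT. Qed.

Lemma measurable_jp : measurable_fun setT jp.
Proof. by apply: measurable_V3; exact: jT. Qed.

Let jpE i p : E 0 T p -> (jump i \_ (E 0 T)) p = jump i p.
Proof. by move=> Ep; rewrite patchE mem_set. Qed.

Let rint_patch i : rintble (N w) (E 0 T) (jump i) -> rintble (N w) (E 0 T) (jump i \_ (E 0 T)).
Proof.
move=> H; apply: (@rintble_le _ _ _ _ _ _ (fun p => `|jump i p|)) => //.
- by apply: measurable_funTS; exact: jT.
- by move=> p Ep; rewrite jpE.
- exact: rintble_norm.
Qed.

Let slabsub a b : 0 <= a -> b <= T -> E a b `<=` E 0 T.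
Proof. exact: slab_sub. Qed.

Let jr0 a b : 0 <= a -> b <= T -> rintble (N w) (E a b) (fun p => (jp p).1.1).
Proof. by move=> a0 bT; apply: (rintbleS (mE 0 T) (mE a b) (slabsub a0 bT)); exact: rint_patch. Qed.
Let jr1 a b : 0 <= a -> b <= T -> rintble (N w) (E a b) (fun p => (jp p).1.2).
Proof. by move=> a0 bT; apply: (rintbleS (mE 0 T) (mE a b) (slabsub a0 bT)); exact: rint_patch. Qed.
Let jr2 a b : 0 <= a -> b <= T -> rintble (N w) (E a b) (fun p => (jp p).2).
Proof. by move=> a0 bT; apply: (rintbleS (mE 0 T) (mE a b) (slabsub a0 bT)); exact: rint_patch. Qed.

Let V3ext (x y : V3 R) : x.1.1 = y.1.1 -> x.1.2 = y.1.2 -> x.2 = y.2 -> x = y.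
Proof. by case: x => -[a b] e; case: y => -[a' b'] e' /= -> -> ->. Qed.

Let Rint_jp i s : 0 <= s <= T -> Rint (N w) (E 0 s) (jump i) = Rint (N w) (E 0 s) (jump i \_ (E 0 T)).
Proof.
move=> /andP[s0 sT]; apply: eq_Rint => p Ep; rewrite jpE//; exact: (slabsub (lexx 0) sT).
Qed.

Let Z0E s : 0 <= s <= T -> Z s w = Z 0 w + Rint3 (N w) jp (E 0 s).
Proof.
move=> sT; apply: V3ext.
- by have [_ _] := S i0 sT; rewrite Rint_jp.
- by have [_ _] := S i1 sT; rewrite Rint_jp.
- by have [_ _] := S i2 sT; rewrite Rint_jp.
Qed.

Let cT s : 0 <= s -> s <= T -> clamp T s = s.
Proof. by move=> s0 sT; rewrite clamp_id// s0. Qed.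

Definition Xp s := (qc T X Z s w).1.
Definition Zp s := (qc T X Z s w).2.

Lemma Zp_incr a b : 0 <= a -> a <= b -> b <= T -> Zp b = Zp a + Rint3 (N w) jp (E a b).
Proof.
move=> a0 ab bT; have aT := le_trans ab bT; have b0 := le_trans a0 ab.
rewrite /Zp !qcE ?a0 ?b0//= (Z0E (s := b)) ?b0// (Z0E (s := a)) ?a0// -addrA; congr (_ + _).
rewrite /Rint3 (Rint_slab_cat (@measurable_ps R) measurable_Dmark a0 ab (jr0 (lexx 0) bT)).
rewrite (Rint_slab_cat (@measurable_ps R) measurable_Dmark a0 ab (jr1 (lexx 0) bT)).
by rewrite (Rint_slab_cat (@measurable_ps R) measurable_Dmark a0 ab (jr2 (lexx 0) bT)).
Qed.

(** The size of Z_0 plus the integral of the sizes of the jumps, which dominates the whole path of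
    Z. It depends on the sample point. *)
Definition Kp : R := n1 (Z 0 w) + Rint (N w) (E 0 T) (fun p => n1 (jp p)).

Let in1 a b : 0 <= a -> b <= T -> rintble (N w) (E a b) (fun p => n1 (jp p)).
Proof. by move=> a0 bT; apply: rintble_n1 => //; [exact: jr0|exact: jr1|exact: jr2]. Qed.

Lemma Kp_ge0 : 0 <= Kp.
Proof. by rewrite addr_ge0 ?n1_ge0//; apply: Rint_ge0 => p _; exact: n1_ge0. Qed.

Let n1D (x y : V3 R) : n1 (x + y) <= n1 x + n1 y.
Proof.
rewrite /n1 /=; have := ler_normD x.1.1 y.1.1; have := ler_normD x.1.2 y.1.2; have := ler_normD x.2 y.2.
by lra.
Qed.

Lemma Zp_le s : n1 (Zp s) <= Kp.
Proof.
have /andP[s0 sT] := clamp_itv s T0'; rewrite /Zp /qc /=; set u := clamp T s in s0 sT *.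
rewrite (Z0E (s := u)) ?s0//; apply: le_trans (n1D _ _) _; rewrite lerD2l.
apply: le_trans (n1_Rint3 (mE 0 u) (jr0 (lexx 0) sT) (jr1 (lexx 0) sT) (jr2 (lexx 0) sT) (mE 0 u) (@subset_refl _ _)) _.
rewrite (Rint_slab_cat (@measurable_ps R) measurable_Dmark s0 sT (in1 (lexx 0) (lexx T))).
by rewrite lerDl; apply: Rint_ge0 => p _; exact: n1_ge0.
Qed.

Lemma Zp_right s : Zp @ s^'+ --> Zp s.
Proof.
have H : (fun x => qc T X Z x w) @ s^'+ --> qc T X Z s w by exact: qc_right.
have K : (snd \o (fun x => qc T X Z x w)) @ s^'+ --> (qc T X Z s w).2.
  by apply: (cvg_comp _ snd H); exact: cvg_snd.
exact: K.
Qed.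

Let cadlag_clamp s : 0 < s <= T -> Xp @ s^'- --> (LQ w s).1 /\ Zp @ s^'- --> (LQ w s).2.
Proof.
move=> sT; have [l [Hl [HX HZ]]] := qc_left cXZ w sT.
rewrite /LQ /= HX HZ; split.
  have K : (fst \o (fun x => qc T X Z x w)) @ s^'- --> l.1 by apply: (cvg_comp _ fst Hl); exact: cvg_fst.
  exact: K.
have K : (snd \o (fun x => qc T X Z x w)) @ s^'- --> l.2 by apply: (cvg_comp _ snd Hl); exact: cvg_snd.
exact: K.
Qed.

Let LE a b : L a b = `]a, b]%classic :> set R.
Proof. by apply/seteqP; split => x /=; rewrite /slab /= in_itv /=; [case|split]. Qed.

Let Zmeas (h : V3 R -> R) : continuous h -> measurable_fun [set: R] (fun s => h (Zp s)).
Proof.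
move=> ch; apply: (@measurable_fun_rcont R _ R id (fun x _ => h (Zp x))) => // x.
exact: (cvg_comp Zp h (@Zp_right x) (ch (Zp x))).
Qed.

Let Zrint (h : V3 R -> R) a b : continuous h -> (forall y, `|h y| <= n1 y) -> a <= b ->
  rintble (@lebR R) (L a b) (fun s => h (Zp s)).
Proof.
move=> ch hn ab.
have mL : measurable (L a b : set R) by exact: measurable_slab.
apply: (@rintble_le _ _ _ _ _ _ (cst Kp)) => //.
- by apply: measurable_funTS; exact: Zmeas.
- by move=> s _; apply: le_trans (hn _) (Zp_le s).
- by apply: rintble_cst => //; rewrite LE [X in (X < _)%E](lebR_itv false false ab) ltry.
Qed.

Let leb_to_lebR (i : 'I_3) (h : V3 R -> R) s : 0 <= s <= T -> continuous h -> (forall y, h y = coord3 y i) ->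
  Rint (@lebesgue_measure R) `[0, s] (fun u => coord3 (Z u w) i) = Rint (@lebR R) (L 0 s) (fun u => h (Zp u)).
Proof.
move=> /andP[s0 sT] ch hE; rewrite /Rint; congr fine.
have mh (A : set R) : measurable_fun A (fun u => (h (Zp u))%:E).
  by apply: measurable_funTS; apply/measurable_EFinP; exact: Zmeas.
transitivity (\int[@lebesgue_measure R]_(u in `[0%R, s]) (h (Zp u))%:E)%E.
  apply: eq_integral => u /set_mem; rewrite /= in_itv /= => /andP[u0 us].
  by rewrite hE /Zp qcE// u0 (le_trans us).
rewrite -integral_itv_obnd_cbnd; last by exact: mh.
by rewrite integral_lebR// LE.
Qed.

Let n1_le (y : V3 R) : [/\ `|y.1.1| <= n1 y, `|y.1.2| <= n1 y & `|y.2| <= n1 y].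
Proof. by rewrite /n1; split; have := normr_ge0 y.1.1; have := normr_ge0 y.1.2; have := normr_ge0 y.2; lra. Qed.

Let cf11 : continuous (fun v : V3 R => v.1.1).
Proof. by move=> v; apply: (cvg_comp fst fst (@cvg_fst _ _ _ _ _)); exact: cvg_fst. Qed.
Let cf12 : continuous (fun v : V3 R => v.1.2).
Proof. by move=> v; apply: (cvg_comp fst snd (@cvg_fst _ _ _ _ _)); exact: cvg_snd. Qed.
Let cf2 : continuous (fun v : V3 R => v.2).
Proof. by move=> v; exact: cvg_snd. Qed.

Lemma Xp_incr a b : 0 <= a -> a <= b -> b <= T -> Xp b = Xp a + Rint3 (@lebR R) Zp (L a b).
Proof.
move=> a0 ab bT; have aT := le_trans ab bT; have b0 := le_trans a0 ab.
have H (i : 'I_3) (h : V3 R -> R) : continuous h -> (forall y, h y = coord3 y i) -> (forall y, `|h y| <= n1 y) ->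
    h (X b w) = h (X a w) + Rint (@lebR R) (L a b) (fun s => h (Zp s)).
  move=> ch hE hn.
  have bb : 0 <= b <= T by rewrite b0.
  have aa : 0 <= a <= T by rewrite a0.
  have [Eb _ _] := S i bb; have [Ea _ _] := S i aa.
  rewrite (leb_to_lebR bb ch hE) in Eb; rewrite (leb_to_lebR aa ch hE) in Ea.
  rewrite !hE Eb Ea -addrA; congr (_ + _).
  by apply: Rint_slab_cat => //; exact: Zrint.
rewrite /Xp !qcE ?a0 ?b0//=; apply: V3ext.
- by apply: (H i0 (fun y => y.1.1)) => // y; case: (n1_le y).
- by apply: (H i1 (fun y => y.1.2)) => // y; case: (n1_le y).
- by apply: (H i2 (fun y => y.2)) => // y; case: (n1_le y).
Qed.

Let MV A : measurable A -> (exists k : nat, N w A = k%:R%:E) \/ N w A = +oo%E.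
Proof. by have [H _ _ _] := hN; exact: H. Qed.

Definition Bp n : set (Mk R) := (Bset n : set (V3 R * R * R * R)) `*` [set: R].

Let mBp n : measurable (Bp n).
Proof. by apply: measurableX => //; exact: measurable_Bset. Qed.

Let t0 : 0 < t. Proof. by case/andP: tT. Qed.
Let tT' : t <= T. Proof. by case/andP: tT. Qed.

Let Bcov p : E 0 t p -> exists n0, forall n, (n0 <= n)%N -> Bp n p.
Proof.
move=> Ep; have : (\bigcup_n Dset T n) p.
  by rewrite bigcup_Dset -/(Dall T) DallE; exact: (slabsub (lexx 0) tT').
move=> [n0 _ Dp]; exists n0 => n n0n.
have /subsetPset/(_ p Dp)[Bq _] := nondecreasing_Dset T n0n.
by split.
Qed.

Let freq n m0 : exists2 m : nat, (m0 <= m)%N &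
  forall k, (k <= m)%N -> ~ (2%:E <= N w (E (k%:R * step t m)%R (k.+1%:R * step t m)%R `&` Bp n))%E.
Proof.
have [m m0m H] := wI n m0; exists m => // k km le2; apply: (H k km).
apply: le_trans le2 _; apply: measure_le.
- by apply: measurableI.
- by apply: measurableX; [exact: measurable_Bset|exact: measurable_itv].
by move=> p [[_ /= sp] [Bq _]]; split => //=; rewrite in_itv.
Qed.

Let Zl s : 0 < s <= t -> Zp @ s^'- --> (LQ w s).2.
Proof. by move=> /andP[s0 st]; apply: (cadlag_clamp _).2; rewrite s0 (le_trans st). Qed.

Let ZE a b : 0 <= a -> a <= b -> b <= t -> Zp b = Zp a + Rint3 (N w) jp (E a b).
Proof. by move=> a0 ab bt; apply: Zp_incr => //; exact: le_trans bt tT'. Qed.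

Let XE a b : 0 <= a -> a <= b -> b <= t -> Xp b = Xp a + Rint3 (@lebR R) Zp (L a b).
Proof. by move=> a0 ab bt; apply: Xp_incr => //; exact: le_trans bt tT'. Qed.

(** Continuity of X. It is what turns the X_s of the thinning in (S) into a predictable quantity. *)
Lemma LQ_X s : 0 < s <= t -> (LQ w s).1 = Xp s.
Proof.
move=> st; have sT : 0 < s <= T by case/andP: st => -> /le_trans ->.
have H1 := (cadlag_clamp sT).1.
have H2 := X_left XE Kp_ge0 Zp_le Zp_right st.
exact: (cvg_unique (@norm_hausdorff _ (V3 R)) H1 H2).
Qed.

Lemma LQ_ae : {ae (@lebR R), forall s, `]0, t]%classic s -> LQ w s = qc T X Z s w}.
Proof.
have := left_limit_ae t0 measurable_Dmark (jr0 (lexx 0) tT') (jr1 (lexx 0) tT') (jr2 (lexx 0) tT')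
  ZE Zp_le Zp_right Zl.
rewrite LE; apply: filterS => s H st; have := H st; rewrite /= in_itv /= in st.
rewrite /Zp => E2; have := LQ_X st; rewrite /Xp => E1.
by rewrite [LQ w s]surjective_pairing [qc _ _ _ _ _]surjective_pairing E1 E2.
Qed.

Lemma measurable_LQ : measurable_fun (`]0, t]%classic : set R) (LQ w).
Proof.
have H (Y : R -> V3 R) (l : R -> V3 R) : (forall s, 0 < s <= t -> Y @ s^'- --> l s) ->
    forall h : V3 R -> R, continuous h -> measurable_fun (`]0, t]%classic : set R) (fun s => h (l s)).
  move=> Yl h ch.
  have mg m : measurable_fun [set: R] (fun s => h (Y (gridL t m s))).
    apply: (@measurable_fun_grid R _ _ _ _ (cell (step t m)) (fun k s => h (Y (k%:~R * step t m)))) => //.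
    by apply: measurable_cell; exact: step_gt0.
  apply: (measurable_fun_cvg (fun m => measurable_funTS (mg m))) => s; rewrite /= in_itv /= => st.
  have cY : Y (gridL t m s) @[m --> \oo] --> l s.
    by apply: (cvg_comp (fun m => gridL t m s) Y); [exact: gridL_cvg|exact: Yl].
  by apply: (cvg_comp _ h cY); exact: ch.
have H3 (Y : R -> V3 R) (l : R -> V3 R) : (forall s, 0 < s <= t -> Y @ s^'- --> l s) ->
    measurable_fun (`]0, t]%classic : set R) l.
  move=> Yl; have -> : l = fun s => (((l s).1.1, (l s).1.2), (l s).2).
    by apply/funext => s; case: (l s) => -[].
  apply: measurable_fun_pairD; first apply: measurable_fun_pairD.
  - exact: (H Y l Yl (fun v => v.1.1)).
  - exact: (H Y l Yl (fun v => v.1.2)).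
  - exact: (H Y l Yl (fun v => v.2)).
apply: measurable_fun_pairD.
  by apply: (H3 Xp (fun s => (LQ w s).1)) => s /andP[s0 st]; apply: (cadlag_clamp _).1; rewrite s0 (le_trans st).
by apply: (H3 Zp (fun s => (LQ w s).2)) => s; exact: Zl.
Qed.

(** Compensation produces left limits, the weak formulation the current values; they differ at a
    Lebesgue-null set of times. *)
Lemma integral_LQ (Phi : R * (V3 R * V3 R) -> \bar R) : measurable_fun setT Phi -> (forall u, (0 <= Phi u)%E) ->
  (\int[@lebR R]_(s in `]0%R, t]) Phi (s, LQ w s) = time_int T X Z t Phi w)%E.
Proof.
move=> mPhi Phi0; apply: ge0_ae_eq_integral => //.
- by apply: (measurableT_comp mPhi); apply: measurable_fun_pairD => //; exact: measurable_LQ.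
- apply: measurable_funTS; apply: (measurableT_comp mPhi); apply: measurable_fun_pair => //.
  exact: (measurableT_comp (measurable_qc_joint T0 hF aX aZ cXZ) (measurable_pair1 w)).
by apply: filterS LQ_ae => s H st; rewrite H.
Qed.

Section psi.
Variable psi : V3 R * V3 R -> R.
Hypothesis psi2 : C2c psi.

Lemma transport_drift q : transport psi q = drift psi q q.2.
Proof.
have H (g : nat -> R) : \sum_(i < 3) g i = g 0%N + (g 1%N + g 2%N).
  by rewrite !big_ord_recl big_ord0 addr0.
rewrite /transport (H (fun i => coord3 q.2 i * 'D_(e6 i) psi q)) /drift.
congr (_ + (_ + _)); exact: mulrC.
Qed.

(** The jump is alpha times an indicator with values 0 and 1, so the increment of psi over the jump
    is the indicator times its increment over alpha. This identifies the integrand of the pathwise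
    formula with a measurable function of left limits and mark. *)
Lemma Gj_hmark e p : E 0 t p ->
  Num.max (e * Gj jp Xp psi (fun s => (LQ w s).2) p) 0 = hmark c I J T f psi e (LQ w (ps p)) p.
Proof.
move=> Ep; have [[th ph rp] /= sp] := Ep; have [s0 st] := andP sp.
have sT : 0 <= ps p <= T by rewrite (ltW s0) (le_trans st).
have ET : E 0 T p by exact: (slabsub (lexx 0) tT').
have XE' := LQ_X sp.
have thinE : thin c T f (LQ w (ps p)) p = (if pr p <= sigmaK c (enorm (leftlim (fun s => Z s w) (ps p) - pv p))
    * fcond f (ps p) (X (ps p) w) (pv p) then 1 else 0).
  rewrite /thin /fcond XE' /fclamp /= (clamp_id sT) (mrE T0 fcont _ sT).
  by rewrite /Xp qcE.
have jE : jp p = thin c T f (LQ w (ps p)) p *: alpha I J (LQ w (ps p)).2 (pv p) (pth p) (pph p).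
  rewrite thinE; apply: V3ext; rewrite /jp /= !jpE// /jump mulrC; exact: erefl.
have -> : Gj jp Xp psi (fun s => (LQ w s).2) p =
  psi (Xp (ps p), (LQ w (ps p)).2 + jp p) - psi (Xp (ps p), (LQ w (ps p)).2) by [].
move: jE XE'; rewrite /hmark /jumpH /zstar; clear thinE.
case: (LQ w (ps p)) => lx lz; rewrite [(lx, lz).1]/= [(lx, lz).2]/= => -> <-.
rewrite /thin; case: ifP => _; first by rewrite scale1r mulr1; exact: erefl.
by rewrite scale0r addr0 subrr mulr0 mulr0 maxxx.
Qed.

Definition PhiD (e : R) (u : R * (V3 R * V3 R)) : \bar R := (Num.max (e * transport psi u.2) 0)%:E.

Definition hE e (u : Omega * Mk R) : \bar R :=
  (\1_(E 0 t) u.2 * hmark c I J T f psi e (LQ u.1 (ps u.2)) u.2)%:E.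

Definition Jw e w : \bar R := (\int[N0 T N w]_(p in Dall T) hE e (w, p))%E.

Lemma pathwise : psi (qc T X Z t w) = psi (qc T X Z 0 w)
  + (fine (time_int T X Z t (PhiD 1) w) - fine (time_int T X Z t (PhiD (-1)) w))
  + (fine (Jw 1 w) - fine (Jw (-1) w)).
Proof.
have [i1' i2' IT] := path_ito t0 measurable_Dmark MV psi2 measurable_jp (jr0 (lexx 0) tT') (jr1 (lexx 0) tT')
  (jr2 (lexx 0) tT') ZE XE Kp_ge0 Zp_le Zp_right Zl mBp Bcov freq.
have q0 s : qc T X Z s w = (Xp s, Zp s) by rewrite /Xp /Zp -surjective_pairing.
have mL : measurable (L 0 t : set R) by exact: measurable_slab.
rewrite !q0 IT (Rint_pm mL i1') (Rint_pm (mE 0 t) i2'); congr (_ + _ + _).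
  have H e : (\int[@lebR R]_(s in L 0%R t) (Num.max (e * gdr Xp Zp psi s) 0)%:E = time_int T X Z t (PhiD e) w)%E.
    rewrite LE; apply: eq_integral => s _; rewrite /PhiD /gdr; congr (Num.max (_ * _) _)%:E.
    by rewrite q0 transport_drift.
  by rewrite !H.
have H e : (\int[N w]_(p in E 0%R t) (Num.max (e * Gj jp Xp psi (fun s => (LQ w s).2) p) 0)%:E = Jw e w)%E.
  rewrite /Jw N0E// integral_mkcond [RHS]integral_mkcond; apply: eq_integral => p _.
  rewrite !patchE /hE /= indicE; case: ifPn => pE.
    have Ep := set_mem pE.
    rewrite Gj_hmark// mem_set ?mul1r//; rewrite DallE; exact: (slabsub (lexx 0) tT').
  by case: ifP => _ //; rewrite mul0r.
by rewrite !H.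
Qed.

End psi.
End good.
End assembly.

(** A nonnegative function with finite integral is finite almost everywhere, so [fine] modifies it
    on a null set only. *)
Lemma rintble_fine d (S : measurableType d) (R : realType) (mu : {measure set S -> \bar R}) (g : S -> \bar R) :
  measurable_fun setT g -> (forall x, (0 <= g x)%E) -> (\int[mu]_x g x < +oo)%E ->
  rintble mu setT (fun x => fine (g x)) /\ Rint mu setT (fun x => fine (g x)) = fine (\int[mu]_x g x)%E.
Proof.
move=> mg g0 gfin.
have ig : mu.-integrable setT g.
  apply/integrableP; split => //; rewrite (eq_integral g)// => x _; by rewrite gee0_abs.
have mf : measurable_fun setT (fun x => (fine (g x))%:E).
  by apply/measurable_EFinP; exact: measurableT_comp.
have E : (\int[mu]_x (fine (g x))%:E = \int[mu]_x g x)%E.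
  apply: ge0_ae_eq_integral => //; first by move=> x _; rewrite lee_fin fine_ge0.
  by apply: filterS (integrable_ae measurableT ig) => x H Tx; rewrite fineK//; exact: H.
split; last by rewrite /Rint E.
apply/integrableP; split => //; rewrite (eq_integral (fun x => (fine (g x))%:E)) ?E// => x _.
by rewrite gee0_abs// lee_fin fine_ge0.
Qed.

(** * Expectations of the transport and jump terms *)

Section final.
Context {R : realType}.
Variables (Q : {sigma_finite_measure set R -> \bar R}) (c : R) (I J : V3 R -> V3 R).
Variables (T : R) (f : R -> V3 R -> V3 R -> R).
Context d (Omega : measurableType d) (P : probability Omega R).
Variables (F : R -> set (set Omega)) (N : Omega -> {measure set (Mk R) -> \bar R}).
Variables (X Z : R -> Omega -> V3 R).
Hypothesis QA : hypA' Q c.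
Hypothesis IJ : frame I J.
Hypothesis T0 : 0 < T.
Hypothesis fprob : prob_densities T f.
Hypothesis fcont : cont_on T f.
Hypothesis fB2 : B2 T f.
Hypothesis hF : filtration T F.
Hypothesis hN : poisson_random_measure P F T (intensity Q T f) N.
Hypothesis aX : adapted3 F T X.
Hypothesis aZ : adapted3 F T Z.
Hypothesis cXZ : forall w, cadlag_on T (fun t => (X t w, Z t w)).
Hypothesis hS : {ae P, forall w, system_S I J c T f X Z N w}.
Hypothesis hM : (ereal_sup [set (\int[pushforward P (fun w => (X t w, Z t w))]_q
  ((enorm q.2) ^+ 2)%:E)%E | t in [set t : R | (0 <= t <= T)%R]] < +oo)%E.
Variable psi : V3 R * V3 R -> R.
Hypothesis psi2 : C2c psi.

Notation q_ := (qc T X Z).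
Notation Lam_ := (Lam Q c I J T f psi).
Notation PD := (PhiD psi).

Let T0' : 0 <= T. Proof. exact: ltW. Qed.
Let Qfin : forall eps : R, 0 < eps -> (Q [set x : R | (eps <= x)%R] < +oo)%E.
Proof. by have [_ H _ _] := QA. Qed.

Lemma PhiD_ge0 e u : (0 <= PD e u)%E.
Proof. by rewrite lee_fin le_max lexx orbT. Qed.

Lemma measurable_transport : measurable_fun setT (transport psi).
Proof.
have md (i : 'I_6) : measurable_fun setT ('D_(e6 i) psi).
  by apply: continuous_measurable6; have [_ H _] := psi2; have [_ D _ _] := H i i; exact: D.
have [b1 b2 b3] := measurable_V3_coord (@measurable_snd _ _ (V3 R) (V3 R)).
have -> : transport psi = fun q => drift psi q q.2 by apply/funext => q; exact: transport_drift.
apply: measurable_funD; last apply: measurable_funD; apply: measurable_funM => //.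
- exact: (md ord0).
- exact: (md (Ordinal (isT : (1 < 6)%N))).
- exact: (md (Ordinal (isT : (2 < 6)%N))).
Qed.

Lemma measurable_PhiD e : measurable_fun setT (PD e).
Proof.
apply/measurable_EFinP; apply: measurable_maxr => //; apply: measurable_funM => //.
exact: (measurableT_comp measurable_transport measurable_snd).
Qed.

Lemma transport_le : exists K, 0 <= K /\ forall q, `|transport psi q| <= K * (1 + enorm q.2 ^+ 2).
Proof.
have [C [C0 _ dC _]] := C2c_bounds psi2.
exists (C * 3); split; first by rewrite mulr_ge0.
move=> q; rewrite transport_drift; apply: le_trans (drift_le dC q q.2) _.
by rewrite -mulrA; apply: ler_wpM2l => //; exact: n1_le_sqr.
Qed.

Lemma PhiD_le K u e : `|e| = 1 -> `|transport psi u.2| <= K * (1 + enorm u.2.2 ^+ 2) ->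
  (PD e u <= (K * (1 + enorm u.2.2 ^+ 2))%:E)%E.
Proof.
move=> e1 H; rewrite lee_fin; apply: le_trans H; rewrite ge_max normr_ge0 andbT.
by apply: le_trans (ler_norm _) _; rewrite normrM e1 mul1r.
Qed.

Let norm1 e : e = 1 \/ e = -1 -> `|e| = 1 :> R.
Proof. by move=> [->|->]; rewrite ?normrN1 ?normr1. Qed.

(* The four nonnegative functionals (positive and negative parts of the transport term
   and of the collision term) are all dominated by the energy. *)
Definition dominated (Phi : R * (V3 R * V3 R) -> \bar R) := [/\ measurable_fun setT Phi, (forall u, (0 <= Phi u)%E) &
  exists K, 0 <= K /\ forall u, (Phi u <= (K * (1 + enorm u.2.2 ^+ 2))%:E)%E].

Lemma dominated_PhiD e : e = 1 \/ e = -1 -> dominated (PD e).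
Proof.
move=> /norm1 e1; split; [exact: measurable_PhiD|exact: PhiD_ge0|].
by have [K [K0 HK]] := transport_le; exists K; split => // u; exact: PhiD_le.
Qed.

Lemma dominated_Lam e : e = 1 \/ e = -1 -> dominated (Lam_ e).
Proof.
move=> /norm1 e1; split; [exact: measurable_Lam|exact: Lam_ge0|].
have [K [K0 HK]] := Lam_bound QA IJ T0 fprob fcont fB2 psi2.
by exists K; split => // u; exact: (Lam_le IJ T0 fcont psi2 e1 (HK u)).
Qed.

Section dom.
Variable (Phi : R * (V3 R * V3 R) -> \bar R).
Hypothesis dPhi : dominated Phi.

Notation mean := (mean_at T P X Z Phi).

Lemma mean_ge0 s : (0 <= mean s)%E.
Proof. by have [_ H _] := dPhi; exact: integral_ge0. Qed.

Lemma mean_props : exists B, [/\ 0 <= B, (forall s, (mean s <= B%:E)%E) & measurable_fun setT (fun s => fine (mean s))].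
Proof.
have [mP P0 [K [K0 HK]]] := dPhi.
have [B [[H1 H2 _ _ _] _]] := phi_tonelli T0 hF aX aZ cXZ hM (lexx 0) mP P0 K0 HK.
exists (Num.max 0 B); split => //; first by rewrite le_max lexx.
by move=> s; apply: le_trans (H1 s) _; rewrite lee_fin le_max lexx orbT.
Qed.

Lemma mean_fin s : mean s \is a fin_num.
Proof.
have [B [B0 HB _]] := mean_props; rewrite ge0_fin_numE ?mean_ge0//.
by apply: le_lt_trans (HB s) _; rewrite ltry.
Qed.

Lemma dom_rint s : rintble P setT (fun w => fine (Phi (s, q_ s w))) /\
  Rint P setT (fun w => fine (Phi (s, q_ s w))) = fine (mean s).
Proof.
have [mP P0 _] := dPhi; apply: rintble_fine => //.
  apply: (measurableT_comp mP); apply: measurable_fun_pair => //.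
  exact: (measurable_qc T0 hF aX aZ s).
by have := mean_fin s; rewrite ge0_fin_numE ?mean_ge0.
Qed.

Lemma rintble_mean t : 0 <= t -> rintble (@lebR R) (`]0, t]%classic) (fun s => fine (mean s)).
Proof.
move=> t0; have [B [B0 HB mB]] := mean_props.
apply: (@rintble_le _ _ _ _ _ _ (cst B)) => //.
- exact: measurable_funTS.
- move=> s _; rewrite ger0_norm ?fine_ge0 ?mean_ge0//.
  by rewrite -lee_fin fineK ?mean_fin.
- by apply: rintble_cst => //; rewrite [X in (X < _)%E](lebR_itv false false t0) ltry.
Qed.

Lemma time_int_props t : 0 <= t -> [/\ measurable_fun setT (time_int T X Z t Phi),
   (forall w, 0 <= time_int T X Z t Phi w)%E, (\int[P]_w time_int T X Z t Phi w < +oo)%E &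
   fine (\int[P]_w time_int T X Z t Phi w)%E = Rint (@lebR R) (`]0, t]%classic) (fun s => fine (mean s))].
Proof.
move=> t0; have [mP P0 [K [K0 HK]]] := dPhi.
have [B [[H1 H2 H3 H4 H5] H6]] := phi_tonelli T0 hF aX aZ cXZ hM t0 mP P0 K0 HK.
split => //; first by move=> w; apply: integral_ge0.
rewrite H4 /Rint; congr fine; apply: eq_integral => s _; by rewrite fineK ?mean_fin.
Qed.
End dom.

Section fixt.
Variable t : R.
Hypothesis tT : 0 < t <= T.

Notation E := (slab (@ps R) Dmark).
Notation hE_ := (hE c I J T f X Z t psi).
Notation J_ := (Jw c I J T f N X Z t psi).
Notation PT := (g_sigma_algebraType (pred_gen T F)).

Let t0 : 0 < t. Proof. by case/andP: tT. Qed.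
Let tT' : t <= T. Proof. by case/andP: tT. Qed.

Let mEt : measurable (E 0 t).
Proof. by apply: measurable_slab; [exact: measurable_ps|exact: measurable_Dmark]. Qed.

Let EU (u : Omega * Mk R) : E 0 t u.2 -> @Upos R T d Omega F u.
Proof. by move=> [_ /= /andP[a b]]; rewrite /Upos /= a (le_trans b). Qed.

Lemma hE_ge0 e u : (0 <= hE_ e u)%E.
Proof. by rewrite lee_fin mulr_ge0// hmark_ge0. Qed.

(** The integrand vanishes off [Upos], so predictability of left limits on that region gives
    measurability on the whole space. *)
Lemma predictable_hE e : measurable_fun [set: PT] (hE_ e : PT -> \bar R).
Proof.
pose H (y : (V3 R * V3 R) * Mk R) : R := \1_(E 0 t) y.2 * hmark c I J T f psi e y.1 y.2.
have mH : measurable_fun setT H.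
  apply: measurable_funM; last exact: measurable_hmark.
  by apply: (measurableT_comp _ measurable_snd); exact: measurable_indic.
have m1 := measurable_predictable T0 hF aX aZ cXZ mH.
have m2 := (measurable_restrictT _ (measurable_Upos T0 hF)).1 m1.
apply/measurable_EFinP.
have -> : (fun u : PT => \1_(E 0 t) u.2 * hmark c I J T f psi e (LQ X Z u.1 (ps u.2)) u.2) =
    (fun u : PT => H ((leftlim (X ^~ u.1) (ps u.2), leftlim (Z ^~ u.1) (ps u.2)), u.2)) \_ (@Upos R T d Omega F).
  apply/funext => u; rewrite patchE /H /=; case: ifPn => // /negP nU.
  rewrite indicE memNset ?mul0r// => Eu; apply: nU; apply/mem_set; exact: EU.
exact: m2.
Qed.

Let comp e := compensation T0 fprob fcont Qfin hF hN (predictable_hE e) (hE_ge0 e).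

Let mhE e : measurable_fun [set: Omega * Mk R] (hE_ e).
Proof. by have [] := comp e. Qed.

Let mJ e : measurable_fun setT (J_ e).
Proof. by have [_ H _] := comp e. Qed.

Let J0 e w : (0 <= J_ e w)%E.
Proof. by apply: integral_ge0 => p _; exact: hE_ge0. Qed.

Let Fw e (w : Omega) (p : Mk R) : \bar R := (hE_ e (w, p) * (rho T f p)%:E)%E.

Let mFw e : measurable_fun [set: Omega * Mk R] (fun u => Fw e u.1 u.2).
Proof.
apply: emeasurable_funM; first by have -> : (fun u : Omega * Mk R => hE_ e (u.1, u.2)) = hE_ e by apply/funext => -[].
by apply/measurable_EFinP; exact: (measurableT_comp (measurable_rho T0 fprob fcont) measurable_snd).
Qed.

Let Fw0 e w p : (0 <= Fw e w p)%E.
Proof. by rewrite mule_ge0 ?hE_ge0// lee_fin (rho_ge0 T0 fprob). Qed.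

(** Tonelli with time as the outer variable; each time slice with s in ]0, t] is evaluated by
    [hmark_slice] at the left limit of the path, and the others vanish. *)
Let mark_time e w : (\int[markM Q]_(p in Dall T) Fw e w p = \int[@lebR R]_(s in `]0%R, t]) Lam_ e (s, LQ X Z w s))%E.
Proof.
have EA : E 0 t `<=` Dall T by rewrite DallE; exact: slab_sub.
have mF1 : measurable_fun [set: Mk R] (Fw e w) by exact: (measurableT_comp (mFw e) (measurable_pair1 w)).
have -> : (\int[markM Q]_(p in Dall T) Fw e w p = \int[markM Q]_p Fw e w p)%E.
  rewrite integral_mkcond; apply: eq_integral => p _; rewrite patchE; case: ifPn => // /negP np.
  rewrite /Fw /hE /= indicE memNset ?mul0r ?mul0e// => Ep; apply: np; apply/mem_set; exact: EA.
rewrite (@fubini_tonelli2 _ _ _ _ R (markE Q) (@lebR R) (Fw e w) mF1 (Fw0 e w)).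
rewrite [RHS]integral_mkcond; apply: eq_integral => s _; rewrite patchE /fubini_G.
case: ifPn => [/set_mem|/negP ns]; last first.
  apply: integral0_eq => y _; rewrite /Fw /hE /= indicE memNset ?mul0r ?mul0e// => -[_ /= st].
  by apply: ns; apply/mem_set; rewrite /= in_itv.
rewrite /= in_itv /= => st; have sT : 0 < s <= T by case/andP: st => -> /le_trans ->.
rewrite -(hmark_slice QA IJ T0 fprob fcont psi2 e (LQ X Z w s) sT).
apply: eq_integral => y _; rewrite /Fw /hE /=; congr ((_ * _)%:E * _)%E.
rewrite !indicE; congr (nat_of_bool _)%:R; apply/idP/idP => /set_mem H; apply/mem_set; first exact: EA.
by case: H => h1 h2 h3 h4; split.
Qed.

Let good : {ae P, forall w, [/\ Ogood T N w, system_S I J c T f X Z N w & forall n m0 : nat,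
  exists2 m : nat, (m0 <= m)%N & forall k, (k <= m)%N -> ~ two_atoms N n t m k w]}.
Proof.
have H := isolated_atoms QA T0 fprob fcont hF hN tT.
by apply: filterS3 (Ogood_ae T0 fprob fcont Qfin hF hN) hS H => w; split.
Qed.

(** After compensation the path enters through its left limits, which for almost every sample point
    may be replaced by its values inside the time integral. *)
Lemma mean_J e : e = 1 \/ e = -1 -> (\int[P]_w J_ e w = \int[P]_w time_int T X Z t (Lam_ e) w)%E.
Proof.
move=> e1; have [_ _ E2] := comp e; rewrite [LHS]E2.
have [mL L0 _] := dominated_Lam e1.
have [mti ti0 _ _] := time_int_props (dominated_Lam e1) (ltW t0).
apply: ge0_ae_eq_integral => //.
- have -> : (fun w => \int[markM Q]_(p in Dall T) (hE_ e (w, p) * (rho T f p)%:E))%E =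
     (fun w => \int[markM Q]_p (Fw e w p))%E.
    apply/funext => w; rewrite integral_mkcond; apply: eq_integral => p _; rewrite patchE; case: ifPn => // /negP np.
    rewrite /Fw /hE /= indicE memNset ?mul0r ?mul0e// => Ep; apply: np; apply/mem_set; rewrite DallE.
    exact: (slab_sub (lexx 0) tT').
  exact: (@measurable_fun_fubini_tonelli_F _ _ _ _ R (markM Q) _ (mFw e)).
- by move=> w _; apply: integral_ge0 => p _; exact: Fw0.
apply: filterS good => w [_ wS _] _.
rewrite -(integral_LQ T0 hF aX aZ cXZ tT wS mL L0).
exact: mark_time.
Qed.

(** The pathwise formula holds almost surely, and the four nonnegative functionals in it have finite
    expectation, so it may be integrated term by term. *)
Lemma mean_identity :
  Rint P setT (fun w => psi (q_ t w)) = Rint P setT (fun w => psi (q_ 0 w))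
  + Rint (@lebR R) (`]0, t]%classic) (fun s => fine (mean_at T P X Z (PD 1) s) - fine (mean_at T P X Z (PD (-1)) s))
  + Rint (@lebR R) (`]0, t]%classic) (fun s => fine (mean_at T P X Z (Lam_ 1) s) - fine (mean_at T P X Z (Lam_ (-1)) s)).
Proof.
have t0' := ltW t0.
have p1 : 1 = 1 :> R \/ 1 = -1 :> R by left.
have n1 : -1 = 1 :> R \/ -1 = -1 :> R by right.
have mpsi : measurable_fun setT psi by apply: continuous_measurable6; case: psi2.
have [C [C0 pC _ _]] := C2c_bounds psi2.
have ipsi s : rintble P setT (fun w => psi (q_ s w)).
  apply: (@rintble_le _ _ _ _ _ _ (cst C)) => //.
  - exact: (measurableT_comp mpsi (measurable_qc T0 hF aX aZ s)).
  - by apply: rintble_cst => //; apply: le_lt_trans (probability_le1 P measurableT) _; rewrite ltry.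
have D e : e = 1 \/ e = -1 -> rintble P setT (fun w => fine (time_int T X Z t (PD e) w)) /\
    Rint P setT (fun w => fine (time_int T X Z t (PD e) w)) = Rint (@lebR R) (`]0, t]%classic) (fun s => fine (mean_at T P X Z (PD e) s)).
  move=> e1; have [a1 a2 a3 a4] := time_int_props (dominated_PhiD e1) t0'.
  by have [b1 b2] := rintble_fine a1 a2 a3; rewrite b2 a4.
have JJ e : e = 1 \/ e = -1 -> rintble P setT (fun w => fine (J_ e w)) /\
    Rint P setT (fun w => fine (J_ e w)) = Rint (@lebR R) (`]0, t]%classic) (fun s => fine (mean_at T P X Z (Lam_ e) s)).
  move=> e1; have [a1 a2 a3 a4] := time_int_props (dominated_Lam e1) t0'.
  (* The random jump integral has no a priori bound; its expectation is finite because it equals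
     that of the compensator, which the energy controls. *)
  have Jfin : (\int[P]_w J_ e w < +oo)%E by rewrite (mean_J e1).
  by have [b1 b2] := rintble_fine (mJ e) (J0 e) Jfin; rewrite b2 (mean_J e1) a4.
have [d1 D1] := D 1 p1; have [d2 D2] := D (-1) n1.
have [j1 J1] := JJ 1 p1; have [j2 J2] := JJ (-1) n1.
rewrite (RintB _ (rintble_mean (dominated_PhiD p1) t0') (rintble_mean (dominated_PhiD n1) t0'))//.
rewrite (RintB _ (rintble_mean (dominated_Lam p1) t0') (rintble_mean (dominated_Lam n1) t0'))//.
rewrite -D1 -D2 -J1 -J2.
have dd := rintbleB measurableT d1 d2; have jj := rintbleB measurableT j1 j2.
rewrite -(RintB measurableT d1 d2) -(RintB measurableT j1 j2).
rewrite -(RintD measurableT (ipsi 0) dd).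
have pd := rintbleD measurableT (ipsi 0) dd.
rewrite -(RintD measurableT pd jj).
apply: ae_eq_Rint => //.
- exact: rintble_measurable (ipsi t).
- exact: rintble_measurable (rintbleD measurableT pd jj).
apply: filterS good => w [wO wS wI] _.
exact: (pathwise T0 fcont hN cXZ tT wO wS wI psi2).
Qed.

End fixt.
End final.

(** Passing from ]0, t] to [0, t] adds a null point. The integrands agree on [0, t] only: G comes
    from the process frozen outside [0, T]. *)
Lemma Rint_lebesgue_lebR (R : realType) (t : R) (G g : R -> R) : measurable_fun [set: R] G ->
  rintble (@lebR R) (`]0, t]%classic) G -> (forall s, 0 <= s <= t -> g s = G s) ->
  (@lebesgue_measure R).-integrable `[0, t] (fun s => (g s)%:E) /\
  Rint (@lebesgue_measure R) `[0, t] g = Rint (@lebR R) (`]0, t]%classic) G.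
Proof.
move=> mG iG gG.
have mE (A : set R) : measurable_fun A (fun s => (G s)%:E).
  by apply: measurable_funTS; exact/measurable_EFinP.
have mA (A : set R) : measurable_fun A (fun s => `|(G s)%:E|%E) by exact: measurableT_comp.
have E : {in `[0, t]%classic, (fun s => (g s)%:E) =1 (fun s => (G s)%:E)}.
  by move=> s /set_mem; rewrite /= in_itv /= => /gG ->.
split.
  apply/integrableP; split.
    have mg : measurable_fun (`[0, t]%classic : set R) (fun s => (g s)%:E).
      by apply: (eq_measurable_fun (fun s => (G s)%:E)) => // s /E ->.
    exact: mg.
  apply: (@le_lt_trans _ _ (\int[@lebR R]_(s in `]0%R, t]) `|(G s)%:E|)%E); last by have /integrableP[] := iG.
  rewrite -integral_lebR// integral_itv_obnd_cbnd; last exact: mA.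
  rewrite le_eqVlt; apply/orP; left; apply/eqP.
  by apply: eq_integral => s /E ->.
rewrite /Rint; congr fine.
transitivity (\int[@lebesgue_measure R]_(s in `[0%R, t]) (G s)%:E)%E.
  by apply: eq_integral => s /E ->.
rewrite -integral_itv_obnd_cbnd; last exact: mE.
by rewrite integral_lebR.
Qed.

Section law.
Context {R : realType}.
Variables (T : R).
Context d (Omega : measurableType d) (P : probability Omega R).
Variables (F : R -> set (set Omega)) (X Z : R -> Omega -> V3 R).
Hypothesis T0 : 0 < T.
Hypothesis hF : filtration T F.
Hypothesis aX : adapted3 F T X.
Hypothesis aZ : adapted3 F T Z.
Notation mu s := (pushforward P (fun w => (X s w, Z s w))).

Lemma law_measure s : 0 <= s <= T -> [/\ mu s set0 = 0%E, (forall A, measurable A -> (0 <= mu s A)%E),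
  semi_sigma_additive (mu s) & mu s [set: V3 R * V3 R] = 1%E].
Proof.
move=> sT; have E : (fun w => (X s w, Z s w)) = qc T X Z s by apply/funext => w; rewrite qcE.
have mq := measurable_qc T0 hF aX aZ s.
rewrite E; split.
- by rewrite /pushforward preimage_set0 measure0.
- by move=> A mA; rewrite /pushforward measure_ge0.
- exact: (@measure_semi_sigma_additive _ _ _ (pushforward P (qc T X Z s))).
- by rewrite /pushforward preimage_setT probability_setT.
Qed.

Lemma law_integrable s (g : V3 R * V3 R -> R) : 0 <= s <= T -> measurable_fun setT g ->
  rintble P setT (fun w => g (qc T X Z s w)) ->
  (mu s).-integrable [set: V3 R * V3 R] (fun q => (g q)%:E) /\
  Rint (mu s) [set: V3 R * V3 R] g = Rint P setT (fun w => g (qc T X Z s w)).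
Proof.
move=> sT mg ig.
have mE : measurable_fun setT (fun q => (g q)%:E) by exact/measurable_EFinP.
split.
  apply/integrableP; split => //.
  rewrite (integral_law P T0 hF aX aZ (g := fun q => `|(g q)%:E|%E) sT); last exact: measurableT_comp.
  by have /integrableP[] := ig.
by rewrite /Rint (integral_law P T0 hF aX aZ sT mE).
Qed.
End law.
Unset Implicit Arguments.
Set Strict Implicit.

Theorem theorem4p1 (R : realType)
    (Q : {sigma_finite_measure set R -> \bar R}) (c : R)
    (I J : V3 R -> V3 R)
    (T : R) (f : R -> V3 R -> V3 R -> R)
    (d : measure_display) (Omega : measurableType d) (P : probability Omega R)
    (F : R -> set (set Omega))
    (N : Omega -> {measure set (Mk R) -> \bar R})
    (X Z : R -> Omega -> V3 R) :
  hypA' Q c ->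
  frame I J ->
  0 < T ->
  prob_densities T f ->
  strong_solution Q I J c T f ->
  cont_on T f ->
  B2 T f ->
  filtration T F ->
  poisson_random_measure P F T (intensity Q T f) N ->
  adapted3 F T X -> adapted3 F T Z ->
  (forall w, cadlag_on T (fun t => (X t w, Z t w))) ->
  {ae P, forall w, system_S I J c T f X Z N w} ->
  (ereal_sup [set (\int[pushforward P (fun w => (X t w, Z t w))]_q
                     ((enorm q.2) ^+ 2)%:E)%E | t in [set t : R | (0 <= t <= T)%R]] < +oo)%E ->
  weak_solution Q I J c T f (fun t => pushforward P (fun w => (X t w, Z t w))).

Proof.
move=> QA IJ T0 fprob _ fcont fB2 hF hN aX aZ cXZ hS hM; split.
  by move=> t tT; exact: (law_measure P T0 hF aX aZ).
move=> t /andP[t0 tT] psi psi2.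
have p1 : 1 = 1 :> R \/ 1 = -1 :> R by left.
have n1 : -1 = 1 :> R \/ -1 = -1 :> R by right.
pose D e := dominated_PhiD psi2 (e := e).
pose L e := dominated_Lam QA IJ T0 fprob fcont fB2 psi2 (e := e).
pose mean := mean_at T P X Z.
have ip Phi (dPhi : dominated Phi) := dom_rint T0 hF aX aZ cXZ hM dPhi.
have im Phi (dPhi : dominated Phi) : measurable_fun setT (fun s => fine (mean Phi s)).
  by have [B [_ _]] := mean_props T0 hF aX aZ cXZ hM dPhi.
pose G1 s := fine (mean (PhiD psi 1) s) - fine (mean (PhiD psi (-1)) s).
pose G2 s := fine (mean (Lam Q c I J T f psi 1) s) - fine (mean (Lam Q c I J T f psi (-1)) s).
have mG1 : measurable_fun setT G1 by apply: measurable_funB; apply: im; exact: D.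
have mG2 : measurable_fun setT G2 by apply: measurable_funB; apply: im; exact: L.
have iG1 : rintble (@lebR R) (`]0, t]%classic) G1.
  by apply: rintbleB => //; apply: (rintble_mean T0 hF aX aZ cXZ hM) => //; exact: D.
have iG2 : rintble (@lebR R) (`]0, t]%classic) G2.
  by apply: rintbleB => //; apply: (rintble_mean T0 hF aX aZ cXZ hM) => //; exact: L.
have sT s : 0 <= s <= t -> 0 <= s <= T by move=> /andP[-> /le_trans ->].
(* [PhiD] ignores its time argument, so 0 is a placeholder. *)
have trE q : transport psi q = fine (PhiD psi 1 (0, q)) - fine (PhiD psi (-1) (0, q)).
  rewrite /PhiD /= mul1r mulN1r; move: (transport psi q) => x; case: (leP 0 x) => h.
    have h' : - x <= 0 by rewrite oppr_le0.
    by rewrite (max_idPr h') subr0.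
  have h' : 0 <= - x by rewrite oppr_ge0 ltW.
  by rewrite (max_idPl h') sub0r opprK.
have Tr s : 0 <= s <= t -> (pushforward P (fun w => (X s w, Z s w))).-integrable
     [set: V3 R * V3 R] (fun q => (transport psi q)%:E) /\
    Rint (pushforward P (fun w => (X s w, Z s w))) [set: V3 R * V3 R] (transport psi) = G1 s.
  move=> /sT sT'; have [a1 b1] := ip _ (D 1 p1) s; have [a2 b2] := ip _ (D (-1) n1) s.
  have E : (fun w => transport psi (qc T X Z s w)) =
      (fun w => fine (PhiD psi 1 (s, qc T X Z s w)) - fine (PhiD psi (-1) (s, qc T X Z s w))).
    by apply/funext => w; rewrite trE.
  have it : rintble P setT (fun w => transport psi (qc T X Z s w)) by rewrite E; exact: rintbleB.
  have [H1 H2] := law_integrable T0 hF aX aZ sT' (measurable_transport psi2) it.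
  by split => //; rewrite H2 E RintB// b1 b2.
have Lg s : 0 <= s <= t -> (pushforward P (fun w => (X s w, Z s w))).-integrable
     [set: V3 R * V3 R] (fun q => (Lgen Q I J c f s psi q)%:E) /\
    Rint (pushforward P (fun w => (X s w, Z s w))) [set: V3 R * V3 R] (Lgen Q I J c f s psi) = G2 s.
  move=> /sT sT'; have [a1 b1] := ip _ (L 1 p1) s; have [a2 b2] := ip _ (L (-1) n1) s.
  have E0 : Lgen Q I J c f s psi = (fun q => fine (Lam Q c I J T f psi 1 (s, q)) - fine (Lam Q c I J T f psi (-1) (s, q))).
    by apply/funext => q; rewrite (Lgen_Lam QA IJ T0 fprob fcont fB2 psi2).
  have mL e : measurable_fun setT (fun q => fine (Lam Q c I J T f psi e (s, q))).
    have m0 : measurable_fun setT (Lam Q c I J T f psi e) by exact: measurable_Lam.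
    have m1 : measurable_fun setT (fun q => Lam Q c I J T f psi e (s, q)).
      exact: (measurableT_comp m0 (measurable_pair1 s)).
    exact: measurableT_comp m1.
  have mLg : measurable_fun setT (Lgen Q I J c f s psi) by rewrite E0; exact: measurable_funB.
  have it : rintble P setT (fun w => Lgen Q I J c f s psi (qc T X Z s w)) by rewrite E0; exact: rintbleB.
  have [H1 H2] := law_integrable T0 hF aX aZ sT' mLg it.
  by split => //; rewrite H2 E0 RintB// b1 b2.
have [I1 E1] := Rint_lebesgue_lebR mG1 iG1 (fun s st => (Tr s st).2).
have [I2 E2] := Rint_lebesgue_lebR mG2 iG2 (fun s st => (Lg s st).2).
split => //.
  move=> s st; have [H1 _] := Tr s st; have [H2 _] := Lg s st; split => //.
  by move=> q; apply: (integrable_Lgen QA IJ T0 fprob fcont fB2 psi2) => //; exact: sT.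
rewrite E1 E2.
have mpsi : measurable_fun setT psi by apply: continuous_measurable6; case: (psi2).
have law s : 0 <= s <= T -> Rint (pushforward P (fun w => (X s w, Z s w))) [set: V3 R * V3 R] psi =
    Rint P setT (fun w => psi (qc T X Z s w)).
  move=> sT'; rewrite /Rint (integral_law P T0 hF aX aZ (g := fun q => (psi q)%:E) sT')//.
  exact/measurable_EFinP.
rewrite law ?t0// law ?lexx ?ltW//.
(* At t = 0 there is no grid to build, and both time integrals run over the empty interval. *)
move: t0; rewrite le_eqVlt => /predU1P[<-|t0].
  have E0 : (`]0, 0]%classic : set R) = set0.
    by apply/seteqP; split => x //=; rewrite in_itv /= => /andP[a b]; lra.
  by rewrite E0 /Rint !integral_set0 !addr0.
by apply: (mean_identity QA IJ T0 fprob fcont fB2 hF hN aX aZ cXZ hS hM psi2); rewrite t0.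
Qed.
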